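(* Let $d\ge 1$ and let $M\subseteq\mathbb{R}^d$ be a nonempty multirectangle. For $f\in\operatorname{Rec}_d(M)$ and $i\in\{1,\dots,d\}$ define $$T_i(f)=\sum_{x\in\mathbb{R}^d}\operatorname{vol}^\otimes_{d,i}\big(\{y\in M: f(y)-y=x\}\big)\otimes x_i\ \in\mathbb{R}^{\otimes(d+1)}$$ (the sets $\{y\in M:f(y)-y=x\}$ are multirectangles, empty for all but finitely many $x$, and $x_i$ denotes the $i$-th coordinate of $x$), and $T(f)=(T_1(f),\dots,T_d(f))$. Then $T$ is a group homomorphism from $\operatorname{Rec}_d(M)$ onto $\big(\mathbb{R}^{\otimes(d-1)}\otimes\textstyle\bigwedge^2_{\mathbb{Q}}\mathbb{R}\big)^d\subseteq(\mathbb{R}^{\otimes(d+1)})^d$, and its kernel is exactly the derived subgroup $D(\operatorname{Rec}_d(M))$. Consequently the abelianization of $\operatorname{Rec}_d(M)$ is isomorphic to $\big(\mathbb{R}^{\otimes(d-1)}\otimes\bigwedge^2_{\mathbb{Q}}\mathbb{R}\big)^d$.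
   Context: A rectangle in $\mathbb{R}^d$ is a set $\prod_{i=1}^d[a_i,b_i)$ with $a_i<b_i$ real numbers. A multirectangle is a finite union of rectangles. For a multirectangle $M\subseteq\mathbb{R}^d$, $\operatorname{Rec}_d(M)$ denotes the group, under composition, of all bijections $f:M\to M$ for which there exists a finite partition of $M$ into rectangles such that the restriction of $f$ to each piece is a translation. All tensor products are over $\mathbb{Q}$, and $\mathbb{R}^{\otimes k}$ is the $k$-th tensor power of $\mathbb{R}$ over $\mathbb{Q}$. The tensor volume $\operatorname{vol}^\otimes_d$ is the unique map from multirectangles of $\mathbb{R}^d$ to $\mathbb{R}^{\otimes d}$, additive on disjoint unions, with $\operatorname{vol}^\otimes_d(\prod_{j=1}^d[a_j,a_j+t_j))=t_1\otimes\cdots\otimes t_d$. Letting $\sigma_i$ be the $\mathbb{Q}$-linear automorphism of $\mathbb{R}^{\otimes d}$ exchanging the $i$-th and $d$-th tensor factors, $\operatorname{vol}^\otimes_{d,i}=\sigma_i\circ\operatorname{vol}^\otimes_d$; thus $\operatorname{vol}^\otimes_{d,i}(\prod_j[a_j,a_j+t_j))=t_1\otimes\cdots\otimes t_{i-1}\otimes t_{i+1}\otimes\cdots\otimes t_d\otimes t_i$. Here $\bigwedge^2_{\mathbb{Q}}\mathbb{R}$ is identified with the $\mathbb{Q}$-subspace of $\mathbb{R}^{\otimes2}$ spanned by the elements $a\otimes b-b\otimes a$ (with $a\wedge b=a\otimes b-b\otimes a$), so that $\mathbb{R}^{\otimes(d-1)}\otimes\bigwedge^2_{\mathbb{Q}}\mathbb{R}\subseteq\mathbb{R}^{\otimes(d+1)}$.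 $D(G)$ is the derived subgroup of $G$. *)

(* Defs.v *)
From HB Require Import structures.
From mathcomp Require Import all_boot all_order all_algebra.
From mathcomp Require Import boolp classical_sets reals.
Set Implicit Arguments. Unset Strict Implicit. Unset Printing Implicit Defensive.
Import Order.TTheory GRing.Theory Num.Theory.
Local Open Scope ring_scope.

Section Rect.
Variables (R : realType) (d : nat).
Implicit Types (a b y t : 'rV[R]_d) (S M : set 'rV[R]_d).

Definition rect a b : set 'rV[R]_d :=
  fun y => forall j, a ord0 j <= y ord0 j /\ y ord0 j < b ord0 j.
Definition valid_rect a b := forall j, a ord0 j < b ord0 j.

Definition rect_decomp S (s : seq ('rV[R]_d * 'rV[R]_d)) :=
  [/\ forall k, (k < size s)%N ->
         valid_rect (nth (0,0) s k).1 (nth (0,0) s k).2,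
      forall k l, (k < size s)%N -> (l < size s)%N -> k <> l ->
         forall y, rect (nth (0,0) s k).1 (nth (0,0) s k).2 y ->
                   rect (nth (0,0) s l).1 (nth (0,0) s l).2 y -> False
    & forall y, S y <-> exists2 k, (k < size s)%N &
                   rect (nth (0,0) s k).1 (nth (0,0) s k).2 y].

Definition multirect M := exists s : seq ('rV[R]_d * 'rV[R]_d),
  (forall p, p \in s -> valid_rect p.1 p.2) /\
  (forall y, M y <-> exists2 p, p \in s & rect p.1 p.2 y).

(* Rec_d(M): bijections of M, piecewise translations on a finite rectangle
   partition; represented as maps of R^d equal to the identity outside M. *)
Definition inRec M (f : 'rV[R]_d -> 'rV[R]_d) :=
  [/\ forall y, ~ M y -> f y = y,
      forall y, M y -> M (f y),
      forall y z, M y -> M z -> f y = f z -> y = z,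
      forall z, M z -> exists2 y, M y & f y = z
    & exists s : seq ('rV[R]_d * 'rV[R]_d * 'rV[R]_d),
        rect_decomp M [seq p.1 | p <- s] /\
        forall k y, (k < size s)%N ->
          rect (nth (0,0,0) s k).1.1 (nth (0,0,0) s k).1.2 y ->
          f y = y + (nth (0,0,0) s k).2].

Inductive derived M : ('rV[R]_d -> 'rV[R]_d) -> Prop :=
  | der_id : derived M id
  | der_mul g g' h h' k : inRec M g -> inRec M h ->
      cancel g g' -> cancel g' g -> cancel h h' -> cancel h' h ->
      derived M k -> derived M (k \o (g' \o h' \o g \o h)).
End Rect.

Section Tensor.
Variable R : realType.

(* formal finite Q-linear combinations of pure tensors t_1 (x) ... (x) t_k *)
Definition ftens k := seq (rat * k.-tuple R).

Definition coef k (s : ftens k) (t : k.-tuple R) : rat :=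
  \sum_(p <- s | p.2 == t) p.1.
Definition tscale k (q : rat) (s : ftens k) : ftens k :=
  [seq (q * p.1, p.2) | p <- s].
Definition tset k (t : k.-tuple R) (i : 'I_k) (x : R) : k.-tuple R :=
  [tuple if j == i then x else tnth t j | j < k].

(* the Q-subspace of relations (multilinearity) in the free Q-vector space *)
Inductive tzero k : ftens k -> Prop :=
  | tz_add t i a b :
      tzero [:: (1, tset t i (a + b)); (-1, tset t i a); (-1, tset t i b)]
  | tz_hom t i (q : rat) a :
      tzero [:: (1, tset t i (ratr q * a)); (-q, tset t i a)]
  | tz_scale q s : tzero s -> tzero (tscale q s)
  | tz_cat s1 s2 : tzero s1 -> tzero s2 -> tzero (s1 ++ s2)
  | tz_ext s1 s2 : (forall t, coef s1 t = coef s2 t) -> tzero s1 -> tzero s2.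

Definition teq k (s1 s2 : ftens k) := tzero (s1 ++ tscale (-1) s2).

Definition tens_r k (v : ftens k) (c : R) : ftens k.+1 :=
  [seq (p.1, rcons_tuple p.2 c) | p <- v].

Definition tswap n (i : 'I_n.+1) (v : ftens n.+1) : ftens n.+1 :=
  [seq (p.1, [tuple tnth p.2 (if j == i then ord_max
                             else if j == ord_max then i else j) | j < n.+1])
  | p <- v].

(* R^{(x)n} (x) /\^2 R inside R^{(x)(n+2)} *)
Definition inW n (w : ftens n.+2) :=
  exists l : seq (rat * n.-tuple R * R * R),
    teq w (flatten [seq [:: (p.1.1.1, rcons_tuple (rcons_tuple p.1.1.2 p.1.2) p.2);
                          (- p.1.1.1, rcons_tuple (rcons_tuple p.1.1.2 p.2) p.1.2)]
                   | p <- l]).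
End Tensor.

Section Vol.
Variables (R : realType) (d : nat).

Definition tvol_of_rects (s : seq ('rV[R]_d * 'rV[R]_d)) : ftens R d :=
  [seq (1, [tuple (p.2 : 'rV[R]_d) ord0 j - (p.1 : 'rV[R]_d) ord0 j | j < d])
  | p : 'rV[R]_d * 'rV[R]_d <- s].
Definition is_tvol (S : set 'rV[R]_d) (v : ftens R d) :=
  exists s, rect_decomp S s /\ v = tvol_of_rects s.
(* vol^(x)_d (S) (a representative, chosen; well-defined up to teq) *)
Definition tvol (S : set 'rV[R]_d) : ftens R d := xget [::] (is_tvol S).
End Vol.

Definition Tmap (R : realType) n (M : set 'rV[R]_n.+1)
    (f : 'rV[R]_n.+1 -> 'rV[R]_n.+1) (i : 'I_n.+1) : ftens R n.+2 :=
  xget [::] (fun w => exists xs : seq 'rV[R]_n.+1,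
    [/\ uniq xs, forall y, M y -> f y - y \in xs &
        w = flatten [seq tens_r (tswap i (tvol (fun y => M y /\ f y - y = x)))
                             (x ord0 i) | x <- xs]]).

(* Main.v *)
Require Import Defs.
From HB Require Import structures.
From mathcomp Require Import all_boot all_order all_algebra.
From mathcomp Require Import perm zify ring lra.
From mathcomp Require Import boolp classical_sets reals.
Set Implicit Arguments. Unset Strict Implicit. Unset Printing Implicit Defensive.
Import Order.TTheory GRing.Theory Num.Theory.
Local Open Scope ring_scope.

(** A restricted rotation exchanges two adjacent pieces, of lengths s and t in
    the direction i, of a rectangle with other sides t_j; its invariant T_i is
    the tensor of the t_j times s (x) t - t (x) s, and its other T_j vanish.  A
    swap of two disjoint translates of a rectangle has zero invariant, and it
    is a commutator, as one sees by halving the rectangle.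

    Swaps and arbitrarily small rotations generate the group.  Cut M by a grid
    such that f translates every cell and the images of the cells are again
    unions of cells of a finer grid.  The equalities between the lengths of the
    cells and of their images are integral linear relations between positive
    reals, so the finer grid can be subdivided by lengths e_k in such a way
    that, in each direction, a cell and its image are subdivided by the same
    lengths up to order.  Rotations inside the cells correct the order, and the
    remaining map permutes equal cells, hence is a product of swaps.

    Modulo commutators the class of a small rotation depends only on the
    lengths (t_j, s, t), since a swap conjugates it to any other position; it
    is additive in each of them and antisymmetric in (s, t).  It therefore
    extends to a multiadditive map on the tensor power of R, which recovers the
    class of f in the abelianization from T(f). *)

(** * The tensor power as an abelian group *)

(** The abelianization is not known in advance to be a rational vector space, so rational scalars
    cannot be made to act on it. The remedy lies in R, which is divisible: an additive map of a real
    variable is determined by its values on a small interval, and a multiadditive map lets a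
    rational factor pass from one variable to another. Rotations have to be small because their
    class is computed at one fixed place, a box of side [eps *+ 6] in M. The sides of a small
    rotation are at most [eps *+ 2], and a second place at distance [eps *+ 4] inside the box allows
    a detour when the rotation may overlap its standard position. The lengths met by f may be
    rationally independent, so that no common unit exists. Instead, a nonnegative real solution of
    integral linear relations is a combination, with nonnegative real coefficients, of solutions in
    natural numbers; these coefficients are the lengths of the subdivision, and the natural numbers
    count how often each occurs. *)

Section QuotientGroup.
Local Open Scope quotient_scope.
Variables (T : choiceType) (op : T -> T -> T) (inv : T -> T) (e : T).
Variable E : T -> T -> Prop.
Hypotheses (Er : forall x, E x x) (Es : forall x y, E x y -> E y x)
  (Et : forall x y z, E x y -> E y z -> E x z).
Hypotheses (Eop : forall x x' y y', E x x' -> E y y' -> E (op x y) (op x' y')).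
Hypotheses (EA : forall x y z, E (op x (op y z)) (op (op x y) z))
  (EC : forall x y, E (op x y) (op y x)) (E0 : forall x, E (op e x) x)
  (EN : forall x, E (op (inv x) x) e).

Let er : rel T := fun x y => `[< E x y >].
Let er_refl : reflexive er. Proof. by move=> x; apply/asboolP. Qed.
Let er_sym : symmetric er.
Proof. by move=> x y; apply/asboolP/asboolP => /Es. Qed.
Let er_trans : transitive er.
Proof. by move=> y x z /asboolP h /asboolP h'; apply/asboolP; apply: Et h h'. Qed.
Let ers := EquivRel er er_refl er_sym er_trans.
Let Q := {eq_quot ers}.
Let cl (x : T) : Q := \pi x.
Let clP x y : cl x = cl y <-> E x y.
Proof. by split=> [/eqmodP/asboolP|h]; last by apply/eqmodP/asboolP. Qed.
Let add (a b : Q) : Q := cl (op (repr a) (repr b)).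
Let opp (a : Q) : Q := cl (inv (repr a)).
Let clK (a : Q) : cl (repr a) = a. Proof. exact: reprK. Qed.
Let rE x : E (repr (cl x)) x. Proof. by apply/clP; rewrite clK. Qed.
Let addcl x y : add (cl x) (cl y) = cl (op x y).
Proof. by apply/clP/Eop. Qed.
Let addA : associative add.
Proof.
by move=> a b c; rewrite -(clK a) -(clK b) -(clK c) !addcl; apply/clP.
Qed.
Let addC : commutative add. Proof. by move=> a b; apply/clP. Qed.
Let add0 : left_id (cl e) add.
Proof. by move=> a; rewrite -(clK a) addcl; apply/clP. Qed.
Let addN : left_inverse (cl e) opp add.
Proof. by move=> a; rewrite -{2}(clK a) addcl; apply/clP. Qed.

(** Serves twice: for the tensor power, as formal combinations modulo [teq], and for the
    abelianization. Both are afterwards known only through these two properties of the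
    projection. *)
Lemma quotient_zmod : exists (A : zmodType) (f : T -> A),
  (forall x y, f (op x y) = f x + f y) /\ (forall x y, f x = f y <-> E x y).
Proof.
pose m := GRing.isZmodule.Build Q addA addC add0 addN.
pose A : zmodType := HB.pack {eq_quot ers} m.
by exists A, cl; split=> // x y; rewrite [RHS]addcl.
Qed.
End QuotientGroup.

Section AdditiveMaps.
Variables (U A : zmodType) (f : U -> A).
Hypothesis fD : forall x y, f (x + y) = f x + f y.

Lemma addmap0 : f 0 = 0.
Proof. by apply: (addrI (f 0)); rewrite -fD !addr0. Qed.

Lemma addmapN x : f (- x) = - f x.
Proof. by apply: (addrI (f x)); rewrite -fD !subrr addmap0. Qed.

Lemma addmapMn x m : f (x *+ m) = f x *+ m.
Proof. by elim: m => [|m IH]; rewrite ?mulr0n ?addmap0 // !mulrS fD IH. Qed.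

Lemma addmapMz x (m : int) : f (x *~ m) = f x *~ m.
Proof.
case: m => m; first by rewrite -!pmulrn addmapMn.
by rewrite NegzE !mulrNz addmapN -!pmulrn addmapMn.
Qed.

Lemma addmap_sum I (r : seq I) (P : pred I) (F : I -> U) :
  f (\sum_(i <- r | P i) F i) = \sum_(i <- r | P i) f (F i).
Proof. exact: (big_morph f fD addmap0). Qed.
End AdditiveMaps.

(** Division takes place in R and not in A: with x and y written as [denq q] times a real, both
    sides become the same integral multiple of one value of B. *)
Lemma biadditive_ratr (R : realType) (A : zmodType) (B : R -> R -> A) :
  (forall x x' y, B (x + x') y = B x y + B x' y) ->
  (forall x y y', B x (y + y') = B x y + B x y') ->
  forall q x y, B (ratr q * x) y = B x (ratr q * y).
Proof.
move=> Bl Br q x y.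
have d0 : ((denq q)%:~R : R) != 0 by rewrite intr_eq0 denq_eq0.
have E (z : R) : z = (z / (denq q)%:~R) *~ denq q.
  by rewrite -mulrzl mulrCA divff ?mulr1.
have E' (z : R) : ratr q * z = (z / (denq q)%:~R) *~ numq q.
  by rewrite /ratr -mulrzl; ring.
have Mx z n w : B (z *~ n) w = B z w *~ n.
  exact: (addmapMz (f := B^~ w) (fun x x' => Bl x x' w)).
have My z n w : B z (w *~ n) = B z w *~ n.
  exact: (addmapMz (f := B z) (Br z)).
by rewrite !E' [in LHS](E y) [in RHS](E x) !Mx !My -!mulrzA [denq q * _]mulrC.
Qed.

Section Tuples.
Variables (R : realType) (k : nat).
Implicit Types (t : k.-tuple R) (i j : 'I_k) (x y : R).

Lemma tnth_tset t i x j : tnth (tset t i x) j = if j == i then x else tnth t j.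
Proof. by rewrite tnth_mktuple. Qed.

Lemma tset_id t i : tset t i (tnth t i) = t.
Proof. by apply: eq_from_tnth => j; rewrite tnth_tset; case: eqP => // ->. Qed.

Lemma tset_tset t i x y : tset (tset t i x) i y = tset t i y.
Proof. by apply: eq_from_tnth => j; rewrite !tnth_tset; case: eqP. Qed.

Lemma tsetC t i j x y : i != j ->
  tset (tset t i x) j y = tset (tset t j y) i x.
Proof.
move=> ij; apply: eq_from_tnth => l; rewrite !tnth_tset.
by case: (eqVneq l j) => // ->; rewrite eq_sym (negPf ij).
Qed.

Definition multiadditive (A : zmodType) (F : k.-tuple R -> A) :=
  forall t i x y, F (tset t i (x + y)) = F (tset t i x) + F (tset t i y).

Section Multiadditive.
Variables (A : zmodType) (F : k.-tuple R -> A).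
Hypothesis FD : multiadditive F.

Lemma multiadditive0 t i : tnth t i = 0 -> F t = 0.
Proof. by move=> t0; rewrite -(tset_id t i) t0 (addmap0 (FD t i)). Qed.

Lemma multiadditiveN t i x : F (tset t i (- x)) = - F (tset t i x).
Proof. exact: (addmapN (f := fun x => F (tset t i x)) (FD t i)). Qed.

Lemma multiadditiveMn t i x m : F (tset t i (x *+ m)) = F (tset t i x) *+ m.
Proof. exact: (addmapMn (f := fun x => F (tset t i x)) (FD t i)). Qed.

Lemma multiadditive_ratr t i j q :
  F (tset t i (ratr q * tnth t i)) = F (tset t j (ratr q * tnth t j)).
Proof.
have [-> //|ij] := eqVneq i j.
pose B x y := F (tset (tset t i x) j y).
have Ei x : F (tset t i x) = B x (tnth t j).
  rewrite /B; congr F; rewrite -[LHS](tset_id _ j) tnth_tset.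
  by rewrite eq_sym (negPf ij).
have Ej y : F (tset t j y) = B (tnth t i) y by rewrite /B tset_id.
rewrite Ei Ej; apply: biadditive_ratr => [x x' y|x y y']; last exact: FD.
by rewrite /B !(tsetC _ _ _ ij) FD.
Qed.
End Multiadditive.
End Tuples.

Section TensorSpace.
Variables (R : realType) (k : nat).
Implicit Types (s : ftens R k.+1) (t : k.+1.-tuple R).

Lemma coef_cat s s' t : coef (s ++ s') t = coef s t + coef s' t.
Proof. by rewrite /coef big_cat. Qed.

Lemma coef_tscale q s t : coef (tscale q s) t = q * coef s t.
Proof. by rewrite /coef big_map mulr_sumr. Qed.

Lemma tzero_nil : tzero ([::] : ftens R k.+1).
Proof.
(* [tzero] has no constructor for the empty combination; it is obtained as 0 times a basic relation,
   which exists because there is at least one factor. *)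
pose t : k.+1.-tuple R := [tuple 0 | _ < k.+1].
apply: tz_ext (tz_scale 0 (tz_add t ord0 0 0)) => u.
by rewrite coef_tscale mul0r /coef big_nil.
Qed.

Lemma tzero_coef s s' : (forall t, coef s t = coef s' t) -> teq s s'.
Proof.
move=> e; apply: tz_ext tzero_nil => t.
by rewrite coef_cat coef_tscale e mulN1r subrr /coef big_nil.
Qed.

Lemma teq_refl s : teq s s. Proof. exact: tzero_coef. Qed.

Lemma teq_sym s s' : teq s s' -> teq s' s.
Proof.
move=> h; apply: tz_ext (tz_scale (-1) h) => t.
by rewrite coef_tscale !coef_cat !coef_tscale; ring.
Qed.

Lemma teq_trans s1 s2 s3 : teq s1 s2 -> teq s2 s3 -> teq s1 s3.
Proof.
move=> h h'; apply: tz_ext (tz_cat h h') => t.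
by rewrite !coef_cat !coef_tscale; ring.
Qed.

Lemma teq_cat s1 s1' s2 s2' : teq s1 s1' -> teq s2 s2' ->
  teq (s1 ++ s2) (s1' ++ s2').
Proof.
move=> h h'; apply: tz_ext (tz_cat h h') => t.
by rewrite !coef_cat !coef_tscale !coef_cat; ring.
Qed.

Lemma tensor_space : exists (V : zmodType) (f : ftens R k.+1 -> V),
  (forall s s', f (s ++ s') = f s + f s') /\
  (forall s s', f s = f s' <-> teq s s').
Proof.
apply: (quotient_zmod (T := {classic (ftens R k.+1)}) (op := cat)
  (inv := tscale (-1)) (e := [::]) (E := @teq R k.+1)).
- exact: teq_refl.
- exact: teq_sym.
- exact: teq_trans.
- exact: teq_cat.
- by move=> x y z; rewrite catA; exact: teq_refl.
- by move=> x y; apply: tzero_coef => t; rewrite !coef_cat addrC.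
- by move=> x; exact: teq_refl.
- move=> x; apply: tzero_coef => t.
  by rewrite coef_cat coef_tscale mulN1r addNr /coef big_nil.
Qed.

Section Lift.
Variables (A : zmodType) (F : k.+1.-tuple R -> A).
Hypothesis FD : multiadditive F.

(** The rational coefficient is absorbed by the last factor, since A has no rational scalars; by
    [multiadditive_ratr] any other factor would give the same value. *)
Definition tlift s : A :=
  \sum_(p <- s) F (tset p.2 ord_max (ratr p.1 * tnth p.2 ord_max)).

Lemma tlift_cat s s' : tlift (s ++ s') = tlift s + tlift s'.
Proof. by rewrite /tlift big_cat. Qed.

Let G q t := F (tset t ord_max (ratr q * tnth t ord_max)).
Let GD q q' t : G (q + q') t = G q t + G q' t.
Proof. by rewrite /G rmorphD /= mulrDl FD. Qed.
Let G0 t : G 0 t = 0. Proof. exact: (addmap0 (fun q q' => GD q q' t)). Qed.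

(** Shows that [tlift] depends on the coefficients alone, which is what the constructor [tz_ext]
    asks for. *)
Lemma tlift_coef s r : uniq r -> {subset [seq p.2 | p <- s] <= r} ->
  tlift s = \sum_(t <- r) G (coef s t) t.
Proof.
move=> ur; rewrite /tlift; elim: s => [|[q t] s IH] sr.
  rewrite big_nil big1_seq // => t _; rewrite /coef big_nil; exact: G0.
rewrite big_cons IH; last by move=> u us; apply: sr; rewrite inE us orbT.
have tr : t \in r by apply: sr; rewrite inE eqxx.
rewrite !(perm_big _ (perm_to_rem tr)) !big_cons /= addrA; congr (_ + _).
  by rewrite /coef big_cons eqxx GD.
apply: eq_big_seq => u; rewrite mem_rem_uniq // => /andP[ut _].
by rewrite /coef big_cons /= eq_sym (negPf ut).
Qed.

Let Gtset q t i x : G q (tset t i x) = F (tset t i (ratr q * x)).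
Proof.
by rewrite /G (multiadditive_ratr FD _ _ i) tset_tset tnth_tset eqxx.
Qed.

Lemma tlift_tzero s : tzero s -> tlift s = 0.
Proof.
(* The claim is strengthened to all rational multiples: without scalars on A, the case [tz_scale]
   does not follow from the vanishing of [tlift s] alone. *)
move=> s0; suff : forall q, tlift (tscale q s) = 0.
  by move/(_ 1) => <-; congr tlift; rewrite -[LHS]map_id; apply: eq_map => -[q t];
    rewrite mul1r.
elim: s0 => {s} [t i a b|t i r a|r s _ IH|s s' _ IH _ IH'|s s' e _ IH] q.
- rewrite /tlift !big_cons big_nil /= -!/(G _ _) !Gtset mulr1 mulrN1 mulrDr FD.
  by rewrite rmorphN !mulNr !(multiadditiveN FD) addr0 addrACA !subrr addr0.
- rewrite /tlift !big_cons big_nil /= -!/(G _ _) !Gtset mulr1 mulrN.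
  by rewrite rmorphN rmorphM /= mulNr (multiadditiveN FD) mulrA addr0 subrr.
- rewrite -[RHS](IH (q * r)); congr tlift; rewrite /tscale -map_comp.
  by apply: eq_map => -[? ?] /=; rewrite mulrA.
- by rewrite /tscale map_cat tlift_cat IH IH' addr0.
- pose r := undup ([seq p.2 | p <- tscale q s] ++ [seq p.2 | p <- tscale q s']).
  rewrite -[RHS](IH q) !(@tlift_coef _ r) ?undup_uniq //.
  + by apply: eq_bigr => t _; rewrite !coef_tscale e.
  + by move=> t h; rewrite mem_undup mem_cat h.
  + by move=> t h; rewrite mem_undup mem_cat h orbT.
Qed.

Lemma tlift_teq s s' : teq s s' -> tlift s = tlift s'.
Proof.
move/tlift_tzero; rewrite tlift_cat => /eqP; rewrite addr_eq0 => /eqP ->.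
rewrite /tlift big_map -sumrN; apply: eq_bigr => -[q t] _ /=.
by rewrite mulN1r rmorphN mulNr (multiadditiveN FD) opprK.
Qed.
End Lift.
End TensorSpace.

(** * Extending multiadditive maps from a box *)

Section BoxExtension.
Variables (R : realType) (A : zmodType) (eps : R).
Hypothesis eps_gt0 : 0 < eps.
Implicit Types (x y z : R) (m : nat).

Let N x := (Num.bound (`|x| / eps)).+1.
Let N_gt0 x : 0 < (N x)%:R :> R. Proof. by rewrite ltr0n. Qed.

Lemma norm_div_bound x : `|x| / (N x)%:R <= eps.
Proof.
rewrite ler_pdivrMr // mulrC -ler_pdivrMr //.
apply: le_trans (ltW (archi_boundP _)) _; last by rewrite ler_nat.
by rewrite divr_ge0 // ltW.
Qed.

Let div_box x : 0 < x -> 0 < x / (N x)%:R <= eps.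
Proof. by move=> x0; rewrite divr_gt0 //= -{1}(gtr0_norm x0) norm_div_bound. Qed.

Section OneVariable.
Variable F : R -> A.

Definition box_additive := forall x y, 0 < x -> 0 < y -> x + y <= eps ->
  F (x + y) = F x + F y.

(* The additive extension of a map known on (0, eps] takes the value
   [N F(x / N)] at [x > 0], for any [N >= x / eps]. *)
Definition box_ext x :=
  if 0 < x then F (x / (N x)%:R) *+ N x
  else if x < 0 then - (F (- x / (N x)%:R) *+ N x) else 0.

Lemma box_extN x : box_ext (- x) = - box_ext x.
Proof.
rewrite /box_ext oppr_gt0 oppr_lt0 opprK /N normrN.
by case: ltgtP => _; rewrite ?opprK ?oppr0.
Qed.

Hypothesis FD : box_additive.

Let FMn x m : 0 < x -> x *+ m.+1 <= eps -> F (x *+ m.+1) = F x *+ m.+1.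
Proof.
move=> x0; elim: m => [|m IH] le; first by rewrite !mulr1n.
have le' : x *+ m.+1 <= eps.
  by apply: le_trans le; rewrite [leRHS]mulrS lerDr ltW.
by rewrite mulrS [RHS]mulrS FD ?IH -?mulrS ?pmulrn_lgt0.
Qed.

Let F_div x m : 0 < x <= eps -> F (x / m.+1%:R) *+ m.+1 = F x.
Proof.
move=> /andP[x0 xe]; have E : x = (x / m.+1%:R) *+ m.+1.
  by rewrite -mulr_natr divfK // pnatr_eq0.
by rewrite [in RHS]E FMn -?E // divr_gt0 // ltr0n.
Qed.

(** Independence of the number of parts: the subdivisions into [N x] and into [m.+1] parts are
    compared through their common refinement. *)
Lemma box_ext_pos x m : 0 < x -> x / m.+1%:R <= eps ->
  box_ext x = F (x / m.+1%:R) *+ m.+1.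
Proof.
move=> x0 xm; rewrite /box_ext x0 -(F_div m (div_box x0)).
rewrite -(@F_div (x / m.+1%:R) (N x).-1); last by rewrite divr_gt0 ?ltr0n.
by rewrite -!mulrnA prednK // mulrAC mulnC.
Qed.

Lemma box_ext_id x : 0 < x <= eps -> box_ext x = F x.
Proof.
by move=> /andP[x0 xe]; rewrite (@box_ext_pos x 0) // ?divr1 ?mulr1n.
Qed.

(** For positive arguments one number of parts, that of the sum, serves all three terms; the other
    signs reduce to this case by oddness and by moving a term across. *)
Lemma box_extD x y : box_ext (x + y) = box_ext x + box_ext y.
Proof.
have pos u v : 0 < u -> 0 < v -> box_ext (u + v) = box_ext u + box_ext v.
  move=> u0 v0; have uv0 : 0 < u + v by rewrite addr_gt0.
  have /andP[_ le] := div_box uv0.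
  have lw w : w <= u + v -> w / (N (u + v))%:R <= eps.
    by move=> h; apply: le_trans le; rewrite ler_pM2r // invr_gt0.
  rewrite !(@box_ext_pos _ (N (u + v)).-1) ?lw ?lerDl ?lerDr ?(ltW u0) ?(ltW v0) //.
  rewrite -mulrnDl mulrDl FD // -?mulrDl // ?divr_gt0 //.
have ext0 : box_ext 0 = 0 by rewrite /box_ext ltxx.
have mixed u v : 0 < u -> v < 0 -> box_ext (u + v) = box_ext u + box_ext v.
  move=> u0 v0; have nv : 0 < - v by rewrite oppr_gt0.
  have [s0|s0|s0] := ltgtP 0 (u + v).
  - by rewrite -[in RHS](addrK v u) (pos (u + v)) // box_extN addrNK.
  - have -> : box_ext v = - box_ext (u + - (u + v)).
      by rewrite -box_extN; congr box_ext; lra.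
    by rewrite (pos u (- (u + v))) ?oppr_gt0 // box_extN opprD opprK addNKr.
  - have -> : v = - u by lra.
    by rewrite subrr ext0 box_extN subrr.
have [x0|x0|<-] := ltgtP 0 x; last by rewrite add0r ext0 add0r.
- have [y0|y0|<-] := ltgtP 0 y; last by rewrite addr0 ext0 addr0.
  + exact: pos.
  + exact: mixed.
- have [y0|y0|<-] := ltgtP 0 y; last by rewrite addr0 ext0 addr0.
  + by rewrite addrC mixed // addrC.
  + apply: oppr_inj; rewrite -box_extN opprD pos ?oppr_gt0 //.
    by rewrite !box_extN opprD.
Qed.
End OneVariable.

Lemma box_ext_eq (F G : R -> A) x : (forall z, 0 < z <= eps -> F z = G z) ->
  box_ext F x = box_ext G x.
Proof.
move=> FG; rewrite /box_ext; case: ltgtP => // x0; first by rewrite FG ?div_box.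
by rewrite FG //; move: (@div_box (- x)); rewrite oppr_gt0 /N normrN; apply.
Qed.

Lemma box_ext_add (F G : R -> A) x :
  box_ext (fun z => F z + G z) x = box_ext F x + box_ext G x.
Proof.
rewrite /box_ext; case: ltgtP => // x0; rewrite ?mulrnDl ?opprD //.
by rewrite addr0.
Qed.

Section ManyVariables.
Variable k : nat.
Implicit Types (t : k.-tuple R) (F : k.-tuple R -> A) (J : seq 'I_k).

(** J lists the exempt entries, those in which the map has already been extended to all reals. *)
Definition in_box t J := forall j, j \notin J -> 0 < tnth t j <= eps.

(** The index i joins J in the condition on t because entry i of t is overwritten. *)
Definition box_multiadditive F J := forall t i x y, in_box t (i :: J) ->
  (i \in J) || [&& 0 < x, 0 < y & x + y <= eps] ->
  F (tset t i (x + y)) = F (tset t i x) + F (tset t i y).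

Definition box_ext_at j F t := box_ext (fun x => F (tset t j x)) (tnth t j).

(** In the variable j this is [box_extD]. Additivity in another variable survives because [box_ext]
    is additive in the function and consults only its values on (0, eps]. *)
Lemma box_ext_atP j F J : j \notin J -> box_multiadditive F J ->
  box_multiadditive (box_ext_at j F) (j :: J).
Proof.
move=> jJ FD t i x y tb; rewrite inE /box_ext_at !tnth_tset.
case: (eqVneq i j) tb => [->{i} tb _|ij tb /= ixy].
  under [in LHS]eq_fun do rewrite tset_tset.
  under [in RHS]eq_fun do rewrite tset_tset.
  under [X in _ = _ + box_ext X _]eq_fun do rewrite tset_tset.
  apply: box_extD => u v u0 v0 uv; apply: FD; last by rewrite u0 v0 uv orbT.
  by move=> l; rewrite inE negb_or => /andP[li lJ]; apply: tb; rewrite !inE !negb_or li.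
rewrite -box_ext_add; apply: box_ext_eq => z zb.
rewrite !(tsetC _ _ _ ij); apply: FD ixy => l; rewrite inE negb_or => /andP[li lJ].
rewrite tnth_tset; case: eqVneq => // lj.
by apply: tb; rewrite !inE !negb_or li lj.
Qed.

Lemma box_ext_at_id j F J t : j \notin J -> box_multiadditive F J ->
  in_box t J -> box_ext_at j F t = F t.
Proof.
move=> jJ FD tb; rewrite -[in RHS](tset_id t j).
apply: (box_ext_id (F := fun x => F (tset t j x))); last exact: tb.
move=> x y x0 y0 xy; apply: FD; last by rewrite x0 y0 xy orbT.
by move=> l; rewrite inE negb_or => /andP[_]; apply: tb.
Qed.

Lemma multiadditive_extension F : box_multiadditive F [::] ->
  exists2 F', multiadditive F' & forall t, in_box t [::] -> F' t = F t.
Proof.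
move=> FD; have [F' F'D F'E] : exists2 F', box_multiadditive F' (enum 'I_k) &
    forall t, in_box t [::] -> F' t = F t.
  elim: (enum _) (enum_uniq 'I_k) => [_|j J IH /= /andP[jJ /IH[F' F'D F'E]]].
    by exists F.
  exists (box_ext_at j F'); first exact: box_ext_atP.
  move=> t tb; rewrite -F'E //; apply: box_ext_at_id F'D _ => // l _.
  exact: tb.
exists F' => // t i x y; apply: F'D; last by rewrite mem_enum.
by move=> j; rewrite inE mem_enum orbT.
Qed.

(** Used for surjectivity. A positive entry is a multiple of one in (0, eps], and a negative entry
    is the opposite of a positive one. *)
Lemma multiadditive_span F (H : A -> Prop) : multiadditive F ->
  H 0 -> (forall a b, H a -> H b -> H (a - b)) ->
  (forall t, in_box t [::] -> H (F t)) -> forall t, H (F t).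
Proof.
move=> FD H0 HB Hb; have HN a : H a -> H (- a).
  by move=> h; rewrite -sub0r; apply: HB.
have HMn a m : H a -> H (a *+ m).
  move=> h; elim: m => [|m IH]; first by rewrite mulr0n.
  by rewrite mulrSr -[a in _ + a]opprK; apply: HB => //; apply: HN.
suff span J t : in_box t J -> H (F t).
  by move=> t; apply: (span (enum 'I_k)) => j; rewrite mem_enum.
elim: J t => [|j J IH] t tb; first exact: Hb.
have pos x : 0 < x -> H (F (tset t j x)).
  move=> x0; have -> : x = (x / (N x)%:R) *+ N x by rewrite -mulr_natr divfK // gt_eqF.
  rewrite (multiadditiveMn FD); apply/HMn/IH => l lJ; rewrite tnth_tset.
  by case: eqVneq => [_|lj]; [exact: div_box|apply: tb; rewrite inE negb_or lj].
rewrite -(tset_id t j); have [x0|x0|x0] := ltgtP 0 (tnth t j).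
- exact: pos.
- by rewrite -[tnth t j]opprK (multiadditiveN FD); apply/HN/pos; rewrite oppr_gt0.
- by rewrite (multiadditive0 FD (i := j)) // tnth_tset eqxx.
Qed.
End ManyVariables.
End BoxExtension.

(** * Commensurable subdivisions *)

Section RationalCone.
Variable R : realType.

Section OneRelation.
Variables (T : finType) (g : T -> R) (c : T -> int).
Hypotheses (g_ge0 : forall i, 0 <= g i) (cg : \sum_i (c i)%:~R * g i = 0).

Let S := \sum_(i | 0 < c i) (c i)%:~R * g i.
Let pn (x : T * T) := (0 < c x.1) && (c x.2 < 0).

Let e (x : T * T) := if pn x then g x.1 * g x.2 / S else g x.1.
Let b (x : T * T) (l : T) : nat :=
  if pn x then (`|c x.2| * (l == x.1) + `|c x.1| * (l == x.2))%N
  else [&& x.1 == x.2, c x.1 == 0 & l == x.1].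

Let negS : \sum_(j | c j < 0) `|c j|%:R * g j = S.
Proof.
apply/eqP; rewrite -subr_eq0 -oppr_eq0 opprB -[X in _ == X]cg /S.
rewrite [X in _ == X](bigID (fun i => 0 < c i)) /=; apply/eqP; congr (_ + _).
rewrite [RHS](bigID (fun i => c i < 0)) /= [X in _ + X]big1 ?addr0; last first.
  move=> i /andP[]; rewrite -!leNgt => h h'.
  by (have -> : c i = 0 by lia); rewrite mul0r.
rewrite -sumrN; apply: eq_big => [i|i h]; first lia.
by rewrite -mulNr; congr (_ * _); rewrite natr_absz ltr0_norm // rmorphN opprK.
Qed.

(** Covers the degenerate division by [S = 0] in [e]: both signed halves of the relation are then
    sums of nonnegative terms equal to 0. *)
Let g0S l : c l != 0 -> S = 0 -> g l = 0.
Proof.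
move=> cl S0; have [cl0|cl0] := ltP 0 (c l).
  have pos i : 0 < c i -> 0 <= (c i)%:~R * g i.
    by move=> ci; rewrite mulr_ge0 // ler0z ltW.
  have /eqP := psumr_eq0P pos S0 cl0.
  by rewrite mulf_eq0 intr_eq0 (negPf cl) => /eqP.
have {}cl0 : c l < 0 by lia.
have neg i : c i < 0 -> 0 <= `|c i|%:R * g i :> R by rewrite mulr_ge0 ?ler0n.
have /eqP := psumr_eq0P neg (etrans negS S0) cl0.
rewrite mulf_eq0 pnatr_eq0 => /orP[|/eqP//].
by move=> h; exfalso; lia.
Qed.

(* With [S] the sum of the positive terms of the relation, [g] is the sum over
   the pairs [c i > 0 > c j] of [g i * g j / S] times the vector with entries
   [`|c j|] at [i] and [`|c i|] at [j]; the [i] with [c i = 0] contribute themselves. *)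
Lemma cone_one_relation : exists (T' : finType) (e : T' -> R) (b : T' -> T -> nat),
  [/\ forall k, 0 <= e k, forall i, g i = \sum_k e k *+ b k i
    & forall k, \sum_i c i * (b k i)%:Z = 0].
Proof.
exists (T * T)%type, e, b; split.
- move=> x; rewrite /e; case: ifP => // _; rewrite divr_ge0 ?mulr_ge0 //.
  by apply: sumr_ge0 => i /ltW ci; rewrite mulr_ge0 // ler0z.
- move=> l.
  (* The index l receives contributions as the positive member of a pair, as the negative member,
     and on its own when [c l = 0]; these are A, B and C below, and exactly one of the sign
     conditions holds. *)
  transitivity (\sum_i \sum_j ((if pn (i, j) && (l == i) then g i * g j / S *+ `|c j| else 0)
      + (if pn (i, j) && (l == j) then g i * g j / S *+ `|c i| else 0)
      + (if [&& i == j, c i == 0 & l == i] then g l else 0))); last first.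
    rewrite pair_bigA /=; apply: eq_bigr => -[i j] _; rewrite /e /b /=.
    have [/andP[/= ci cj]|_] := boolP (pn _).
      have -> /= : (c i == 0) = false by lia.
      rewrite andbF addr0 mulrnDr !mulrnA.
      by case: eqP => _; case: eqP => _; rewrite ?mulr1n ?mulr0n.
    by rewrite /= !add0r; case: ifP => [/and3P[_ _ /eqP ->]|]; rewrite ?mulr1n ?mulr0n.
  under eq_bigr do rewrite !big_split /=.
  rewrite !big_split /=.
  set A := \sum_i _; set B := \sum_i _; set C := \sum_i _.
  have -> : A = if 0 < c l then g l / S * S else 0.
    rewrite /A (bigD1 l) //= [X in _ + X]big1 ?addr0; last first.
      by move=> i il; rewrite big1 // => j _; rewrite (eq_sym l) (negPf il) andbF.
    rewrite eqxx; case: ifP => cl; last by rewrite big1 // => j _; rewrite /pn /= cl.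
    rewrite -[in X in _ = _ * X]negS mulr_sumr [RHS]big_mkcond /=; apply: eq_bigr => j _.
    by rewrite /pn /= cl andbT /=; case: ifP => // _; rewrite -mulr_natr; ring.
  have -> : B = if c l < 0 then g l / S * S else 0.
    rewrite /B exchange_big /= (bigD1 l) //= [X in _ + X]big1 ?addr0; last first.
      by move=> i il; rewrite big1 // => j _; rewrite (eq_sym l) (negPf il) andbF.
    rewrite eqxx; case: ifP => cl; last by rewrite big1 // => j _; rewrite /pn /= cl andbF.
    transitivity (g l / S * (\sum_(i | 0 < c i) (c i)%:~R * g i)); last by [].
    rewrite mulr_sumr [RHS]big_mkcond /=; apply: eq_bigr => i _.
    rewrite /pn /= cl !andbT; case: ifP => // ci; rewrite -mulr_natr.
    have -> : (`|c i|%N%:R : R) = (c i)%:~R by rewrite natr_absz gtr0_norm.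
    ring.
  have -> : C = if c l == 0 then g l else 0.
    rewrite /C (bigD1 l) //= [X in _ + X]big1 ?addr0; last first.
      by move=> i il; rewrite big1 // => j _; rewrite (eq_sym l) (negPf il) !andbF.
    rewrite (bigD1 l) //= [X in _ + X]big1 ?addr0.
      by rewrite !eqxx /= andbT.
    by move=> j jl; rewrite (eq_sym l) (negPf jl).
  have [cl|cl|cl] := ltgtP (c l) 0.
  - have [S0|S0] := eqVneq S 0; last by rewrite divfK // add0r addr0.
    by rewrite (g0S _ S0) ?lt_eqF // !mul0r !addr0.
  - have [S0|S0] := eqVneq S 0; last by rewrite divfK // !addr0.
    by rewrite (g0S _ S0) ?gt_eqF // !mul0r !addr0.
  - by rewrite !add0r.
- move=> [i j]; rewrite /b; have [/andP[/= ci cj]|_] := boolP (pn (i, j)).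
    have ij : i != j by apply: contraTneq ci => ->; rewrite -leNgt ltW.
    rewrite (bigD1 i) // (bigD1 j) 1?eq_sym //= big1 ?addr0; last first.
      by move=> l /andP[/negPf -> /negPf ->]; lia.
    by rewrite /= !eqxx (eq_sym j) (negPf ij); nia.
  rewrite (bigD1 i) //= big1 ?addr0; last by move=> l /negPf ->; rewrite !andbF mulr0.
  by have [->|/negPf _] := eqVneq (c i) 0; rewrite ?mul0r /= ?andbF ?mulr0.
Qed.
End OneRelation.

(** Once the first relation is solved by [e1] and [b1], the others turn into integral relations [c1]
    between the entries of [e1]; the two matrices of natural numbers are then multiplied. *)
Lemma cone_relations (rels : nat) : forall (T : finType) (g : T -> R)
  (c : 'I_rels -> T -> int), (forall i, 0 <= g i) ->
  (forall r, \sum_i (c r i)%:~R * g i = 0) ->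
  exists (T' : finType) (e : T' -> R) (b : T' -> T -> nat),
  [/\ forall k, 0 <= e k, forall i, g i = \sum_k e k *+ b k i
    & forall r k, \sum_i c r i * (b k i)%:Z = 0].
Proof.
elim: rels => [|rels IH] T g c g0 cg.
  exists T, g, (fun k i => (k == i) : nat); split=> [//|i|[]//].
  by rewrite (bigD1 i) //= eqxx big1 ?addr0 // => k /negPf ->.
have [T1 [e1 [b1 [e10 gE cb1]]]] := cone_one_relation g0 (cg ord0).
pose c1 r k := \sum_i c (lift ord0 r) i * (b1 k i)%:Z.
have [r|T2 [e2 [b2 [e20 e1E cb2]]]] := IH T1 e1 c1 e10.
  rewrite -[RHS](cg (lift ord0 r)); under [RHS]eq_bigr do rewrite gE mulr_sumr.
  rewrite [RHS]exchange_big /=; apply: eq_bigr => k _.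
  rewrite rmorph_sum /= mulr_suml; apply: eq_bigr => i _.
  by rewrite rmorphM /= -mulrA -[e1 k *+ _]mulr_natr [_ * e1 k]mulrC.
exists T2, e2, (fun k i => \sum_j b2 k j * b1 j i)%N; split=> // [i|r k].
  rewrite gE; under eq_bigr do rewrite e1E -sumrMnl.
  rewrite exchange_big /=; apply: eq_bigr => k _.
  by rewrite -sumrMnr; apply: eq_bigr => j _; rewrite mulrnA.
have E r' : \sum_i c r' i * (\sum_j b2 k j * b1 j i)%N%:Z
    = \sum_j (\sum_i c r' i * (b1 j i)%:Z) * (b2 k j)%:Z.
  under [RHS]eq_bigr do rewrite mulr_suml.
  rewrite [RHS]exchange_big /=; apply: eq_bigr => i _.
  rewrite (big_morph Posz PoszD (erefl _)) mulr_sumr; apply: eq_bigr => j _.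
  by rewrite PoszM; ring.
rewrite E; case: (unliftP ord0 r) => [r' ->|->]; first exact: cb2.
by rewrite big1 // => j _; rewrite cb1 mul0r.
Qed.
End RationalCone.

(** * Consecutive cut points of a finite set of reals *)

Section CutPoints.
Variables (R : realType) (c : seq R).
Implicit Types (x y z : R) (k l : nat).

Definition pts := sort <=%R (undup c).
Definition pt k := nth 0 pts k.
Definition nint := (size pts).-1.
(** Consecutive cuts are described without indices, so that adjacency can be checked in a list that
    has not been sorted, as in [adj_wcuts]. *)
Definition adj x y := [&& x \in c, y \in c, x < y & all (fun z => (z <= x) || (y <= z)) c].

Lemma mem_pts x : (x \in pts) = (x \in c).
Proof. by rewrite mem_sort mem_undup. Qed.

Let sorted_pts : sorted <%R pts.
Proof. by rewrite sort_lt_sorted undup_uniq. Qed.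

Lemma lt_pt k l : (k < size pts)%N -> (l < size pts)%N -> (pt k < pt l) = (k < l)%N.
Proof. by move=> hk hl; apply: (lt_sorted_ltn_nth 0 sorted_pts). Qed.

Lemma le_pt k l : (k < size pts)%N -> (l < size pts)%N -> (pt k <= pt l) = (k <= l)%N.
Proof. by move=> hk hl; apply: (lt_sorted_leq_nth 0 sorted_pts). Qed.

Lemma pt_index x : x \in c -> (index x pts < size pts)%N /\ pt (index x pts) = x.
Proof. by rewrite -mem_pts => h; rewrite index_mem h /pt nth_index. Qed.

Lemma pt_ex x : x \in c -> exists k, (k < size pts)%N /\ pt k = x.
Proof. by move=> /pt_index h; exists (index x pts). Qed.

Lemma pt_mem k : (k < size pts)%N -> pt k \in c.
Proof. by move=> h; rewrite -mem_pts mem_nth. Qed.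

Lemma nint_lt k : (k < nint)%N -> (k.+1 < size pts)%N.
Proof. by rewrite /nint; case: (size pts). Qed.

Lemma le_nint k : (k < size pts)%N -> (k <= nint)%N.
Proof. by rewrite /nint; case: (size pts). Qed.

Lemma adj_pt k : (k < nint)%N -> adj (pt k) (pt k.+1).
Proof.
move=> /nint_lt k1; have k0 := ltnW k1.
rewrite /adj !pt_mem // lt_pt // ltnSn /=; apply/allP => z /pt_index[hz <-].
by rewrite !le_pt // leqNgt orNb.
Qed.

Lemma adjP x y : adj x y -> exists2 k : 'I_nint, x = pt k & y = pt k.+1.
Proof.
move=> /and4P[/pt_ex[i [hi <-]] /pt_ex[j [hj <-]]]; rewrite lt_pt // => ij /allP nb.
have i_n : (i < nint)%N by apply: leq_trans ij (le_nint hj).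
exists (Ordinal i_n) => //=; apply/eqP.
have := nb _ (pt_mem (nint_lt i_n)); rewrite !le_pt ?nint_lt // ltnn /= => le.
by rewrite eq_le !le_pt ?nint_lt // le ij.
Qed.

Lemma adj_uniq x y x' y' z : adj x y -> adj x' y' ->
  x <= z < y -> x' <= z < y' -> x = x' /\ y = y'.
Proof.
move=> /and4P[xc yc _ /allP nb] /and4P[xc' yc' _ /allP nb'] zx zx'.
have /orP[h1|h1] := nb _ xc'; have /orP[h2|h2] := nb _ yc';
  have /orP[h3|h3] := nb' _ xc; have /orP[h4|h4] := nb' _ yc; split; lra.
Qed.

Lemma adj_locate x y z : x \in c -> y \in c -> x <= z < y ->
  exists k : 'I_nint, pt k <= z < pt k.+1.
Proof.
move=> /pt_ex[i [hi <-]] /pt_ex[j [hj <-]] /andP[xz zy].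
pose P k := (k < size pts)%N && (pt k <= z).
have exP : exists k, P k by exists i; rewrite /P hi xz.
have ubP k : P k -> (k <= j)%N.
  by move=> /andP[hk kz]; rewrite -le_pt // ltW // (le_lt_trans kz).
case: (ex_maxnP exP ubP) => k /andP[hk kz] kmax.
have kn : (k < nint)%N.
  by apply: leq_trans (le_nint hj); rewrite -lt_pt //; exact: le_lt_trans zy.
exists (Ordinal kn) => /=; rewrite kz /= ltNge; apply/negP => h.
by have := kmax k.+1; rewrite /P nint_lt // h => /(_ isT); rewrite ltnn.
Qed.

Lemma sum_index_range (A : zmodType) (F : nat -> A) x y : x \in c -> y \in c ->
  \sum_(k < nint) (if x <= pt k < y then F k else 0)
  = \sum_(index x pts <= k < index y pts) F k.
Proof.
move=> /pt_index[hx xE] /pt_index[hy yE].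
rewrite -{1}xE -{1}yE; move: (index x pts) (index y pts) hx hy => i j hi hj.
rewrite -big_mkcond /= -(big_mkord (fun k => pt i <= pt k < pt j) F).
transitivity (\sum_(0 <= k < nint | (i <= k < j)%N) F k).
  rewrite big_nat_cond [RHS]big_nat_cond; apply: eq_bigl => k.
  apply: andb_id2l => /andP[_ /nint_lt/ltnW hk].
  by rewrite le_pt // lt_pt.
have le := le_nint hj.
rewrite (big_cat_nat (n := j)) //= [X in _ + X]big1_seq ?addr0; last first.
  by move=> k; rewrite mem_index_iota => /andP[/andP[_ kj] /andP[]]; rewrite leqNgt kj.
have [ij|ji] := leqP i j; last first.
  rewrite [RHS]big_geq ?(ltnW ji) // big1_seq // => k.
  by rewrite mem_index_iota => /andP[/andP[ik kj] _]; lia.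
rewrite (big_cat_nat (n := i)) //= [X in X + _]big1_seq ?add0r; last first.
  by move=> k; rewrite mem_index_iota => /andP[/andP[ik _] /andP[_ ki]]; lia.
rewrite big_nat_cond [RHS]big_nat_cond; apply: eq_bigl => k.
by case: (i <= k < j)%N.
Qed.

Lemma sum_increments x y : x \in c -> y \in c -> x <= y ->
  \sum_(k < nint) (if x <= pt k < y then pt k.+1 - pt k else 0) = y - x.
Proof.
move=> xc yc xy; rewrite (sum_index_range (fun k => pt k.+1 - pt k)) //.
have [hx xE] := pt_index xc; have [hy yE] := pt_index yc.
by rewrite telescope_sumr ?xE ?yE // -le_pt // xE yE.
Qed.
End CutPoints.

(** * Words whose letters carry lengths *)

Section Words.
Variables (R : realType) (T : finType) (len : T -> R).
Hypothesis len_gt0 : forall q, 0 < len q.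
Implicit Types u v : seq T.

Definition wlen u := \sum_(q <- u) len q.

Lemma wlen_nil : wlen [::] = 0. Proof. exact: big_nil. Qed.
Lemma wlen_cons q u : wlen (q :: u) = len q + wlen u. Proof. exact: big_cons. Qed.
Lemma wlen_cat u v : wlen (u ++ v) = wlen u + wlen v. Proof. exact: big_cat. Qed.
Lemma wlen_ge0 u : 0 <= wlen u. Proof. by apply: sumr_ge0 => q _; apply: ltW. Qed.

Lemma word_locate u z : 0 <= z < wlen u ->
  exists u1 q u2, u = u1 ++ q :: u2 /\ wlen u1 <= z < wlen u1 + len q.
Proof.
elim: u z => [|q u IH] z; first by rewrite wlen_nil; lra.
rewrite wlen_cons => zq; have [lt|ge] := ltP z (len q).
  by exists [::], q, u; split => //; rewrite wlen_nil; lra.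
have [|u1 [q' [u2 [-> h]]]] := IH (z - len q); first lra.
by exists (q :: u1), q', u2; split => //; rewrite wlen_cons; lra.
Qed.

Definition wcuts x u := [seq x + wlen (take m u) | m <- iota 0 (size u).+1].

Lemma mem_wcuts x u v : x + wlen u \in wcuts x (u ++ v).
Proof.
apply/mapP; exists (size u); last by rewrite take_size_cat.
by rewrite mem_iota /= ltnS size_cat leq_addr.
Qed.

Lemma adj_wcuts x u1 q u2 : adj (wcuts x (u1 ++ q :: u2)) (x + wlen u1) (x + wlen u1 + len q).
Proof.
apply/and4P; split; first exact: mem_wcuts.
- have -> : x + wlen u1 + len q = x + wlen (u1 ++ [:: q]).
    by rewrite wlen_cat wlen_cons wlen_nil addr0 addrA.
  by rewrite -[u1 ++ q :: u2]cat_rcons -cats1 mem_wcuts.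
- by rewrite ltrDl.
apply/allP => _ /mapP[m _ ->]; rewrite take_cat; case: ltnP => h.
  by rewrite -[in leRHS](cat_take_drop m u1) wlen_cat lerD2l lerDl wlen_ge0.
case: (m - size u1)%N => [|k]; first by rewrite take0 cats0 lexx.
by rewrite /= wlen_cat wlen_cons; have := wlen_ge0 (take k u2); lra.
Qed.
End Words.

Section Subdivision.
Variables (R : realType) (c : seq R).

(** Each equality of lengths is an integral relation between the increments [g] of c. By
    [cone_relations] the increment k is filled with [b q k] copies of the letter q, and the
    relations satisfied by each [b q] say that the two intervals contain q equally often. *)
Lemma subdivision (rels : seq ((R * R) * (R * R))) :
  (exists x, x \in c) ->
  (forall r, r \in rels -> [/\ r.1.1 \in c, r.1.2 \in c, r.2.1 \in c & r.2.2 \in c] /\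
     [/\ r.1.1 <= r.1.2, r.2.1 <= r.2.2 & r.1.2 - r.1.1 = r.2.2 - r.2.1]) ->
  exists (T : finType) (len : T -> R) (W : R -> R -> seq T) (c2 : seq R),
  [/\ forall q, 0 < len q, {subset c <= c2},
      forall x y, x \in c -> y \in c -> x <= y -> wlen len (W x y) = y - x /\
        forall u1 q u2, W x y = u1 ++ q :: u2 ->
          adj c2 (x + wlen len u1) (x + wlen len u1 + len q)
    & forall r, r \in rels -> perm_eq (W r.1.1 r.1.2) (W r.2.1 r.2.2)].
Proof.
move=> [x0 /pt_ex[i0 [hi0 _]]] relsP.
pose N := nint c; pose g (k : 'I_N) := pt c k.+1 - pt c k.
pose ind (p : R * R) (k : nat) : int := (nat_of_bool (p.1 <= pt c k < p.2))%:Z.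
have indE p (F : 'I_N -> R) : \sum_(k < N) (ind p k)%:~R * F k
    = \sum_(k < N) (if p.1 <= pt c k < p.2 then F k else 0).
  by apply: eq_bigr => k _; rewrite /ind; case: ifP => _; rewrite ?mul1r ?mul0r.
pose d := ((0, 0), (0, 0)) : (R * R) * (R * R).
pose rel r (k : 'I_N) := ind (nth d rels r).1 k - ind (nth d rels r).2 k.
have [k|r|T [e [b [e0 gE bE]]]] := @cone_relations R (size rels) _ g (fun r => rel r).
- by rewrite subr_ge0 le_pt // ?nint_lt // ltnW // nint_lt.
- have [[c1 c2 c3 c4] [le1 le2 E]] := relsP _ (mem_nth d (ltn_ord r)).
  under eq_bigr do rewrite /rel rmorphB mulrBl.
  by rewrite sumrB !indE !sum_increments // E subrr.
(* A letter with [e q = 0] is kept out of all words by [bn]; the value 1 only makes its length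
   positive. *)
pose len q := if 0 < e q then e q else 1.
pose bn q (k : nat) := if insub k is Some k' then
  (if 0 < e q then b q k' else 0%N) else 0%N.
have bnE q (k : 'I_N) : bn q k = if 0 < e q then b q k else 0%N.
  by rewrite /bn valK.
have len_gt0 q : 0 < len q by rewrite /len; case: ifP.
pose w k := flatten [seq nseq (bn q k) q | q <- enum T].
pose Wi i j := flatten [seq w k | k <- iota i (j - i)].
have WiD i j k : (i <= j <= k)%N -> Wi i k = Wi i j ++ Wi j k.
  move=> /andP[ij jk]; rewrite /Wi -flatten_cat -map_cat -{2}(subnKC ij) -iotaD.
  by congr flatten; congr map; congr iota; lia.
have wlen_flat (ss : seq (seq T)) : wlen len (flatten ss) = \sum_(s <- ss) wlen len s.
  by elim: ss => [|s ss IH]; rewrite ?big_nil ?wlen_nil //= wlen_cat big_cons IH.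
have wlen_nseq m q : wlen len (nseq m q) = len q *+ m.
  by elim: m => [|m IH]; rewrite ?wlen_nil //= wlen_cons IH mulrS.
have wlen_w (k : 'I_N) : wlen len (w k) = g k.
  rewrite wlen_flat big_map big_enum gE; apply: eq_bigr => q _.
  rewrite wlen_nseq bnE /len; case: ltP => // eq0.
  by rewrite mulr0n (_ : e q = 0) ?mul0rn //; apply/le_anti; rewrite eq0 e0.
have wlen_Wi i j : (i <= j)%N -> (j < size (pts c))%N -> wlen len (Wi i j) = pt c j - pt c i.
  move=> ij hj; rewrite wlen_flat big_map -telescope_sumr // big_seq [RHS]big_seq.
  apply: congr_big => // k.
  rewrite mem_iota subnKC // => /andP[_ kj].
  exact: (wlen_w (Ordinal (leq_trans kj (le_nint hj)))).
have count_w q (k : 'I_N) : count_mem q (w k) = bn q k.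
  rewrite count_flatten -map_comp sumnE big_map big_enum /= (bigD1 q) //= count_nseq /= eqxx mul1n.
  by rewrite big1 ?addn0 // => q' /negPf qq'; rewrite count_nseq /= qq' mul0n.
pose W x y := Wi (index x (pts c)) (index y (pts c)).
have count_W q x y : x \in c -> y \in c ->
    (count_mem q (W x y))%:Z = \sum_(k < N) ind (x, y) k * (bn q k)%:Z.
  move=> xc yc; rewrite count_flatten -map_comp sumnE big_map.
  have [hx xE] := pt_index xc; have [hy yE] := pt_index yc.
  transitivity (\sum_(k < N) (if x <= pt c k < y then (count_mem q (w k))%:Z else 0)).
    rewrite (sum_index_range (fun k => (count_mem q (w k))%:Z)) //.
    by rewrite (big_morph Posz PoszD (erefl _)).
  apply: eq_bigr => k _; rewrite count_w /ind /=; case: ifP => _.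
    by rewrite mul1r.
  by rewrite mul0r.
have ptE i : (i < size (pts c))%N -> pt c i = pt c 0 + wlen len (Wi 0 i).
  by move=> hi; rewrite wlen_Wi // addrC subrK.
have hN : (N < size (pts c))%N by rewrite /N /nint prednK // (leq_ltn_trans _ hi0).
(* One word spells the whole span of c and every [W x y] used here is a factor of it, so its cuts
   include those of each [W x y]. *)
exists T, len, W, (wcuts len (pt c 0) (Wi 0 N)); split=> //.
- move=> x xc; have [hx xE] := pt_index xc; rewrite -xE ptE //.
  by rewrite (WiD 0 _ N (le_nint hx : (0 <= _ <= N)%N)) mem_wcuts.
- move=> x y xc yc xy; have [hx xE] := pt_index xc; have [hy yE] := pt_index yc.
  have ij : (index x (pts c) <= index y (pts c))%N by rewrite -(@le_pt _ c) // xE yE.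
  split; first by rewrite wlen_Wi // xE yE.
  move=> u1 q u2 WE; have -> : x + wlen len u1 = pt c 0 + wlen len (Wi 0 (index x (pts c)) ++ u1).
    by rewrite wlen_cat addrA -ptE // xE.
  rewrite (WiD 0 _ N (le_nint hy : (0 <= _ <= N)%N)).
  rewrite (WiD 0 _ _ (ij : (0 <= _ <= _)%N)) -/(W x y) WE -!catA cat_cons catA.
  exact: adj_wcuts.
- move=> r rr; have [[c1 c2 c3 c4] _] := relsP r rr.
  apply/allP => q _ /=; rewrite -eqz_nat !count_W // -subr_eq0 -sumrB.
  have hr : (index r rels < size rels)%N by rewrite index_mem.
  have := bE (Ordinal hr) q; rewrite /rel /= nth_index //.
  rewrite -!surjective_pairing => bq.
  under eq_bigr do rewrite -mulrBl bnE.
  case: (0 < e q); first by rewrite bq.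
  by rewrite big1 // => k _; rewrite mulr0.
Qed.
End Subdivision.

(** * Grids and tilings *)

Section MultiadditiveExpansion.
Variables (R : realType) (A : zmodType) (d : nat) (F : d.-tuple R -> A).
Hypothesis FD : multiadditive F.

(** Distributivity, one entry at a time: expanding the entry [j0] adds the choice of [g j0]. *)
Lemma multiadditive_expand N (x : 'I_d -> 'I_N -> R) :
  F [tuple \sum_k x j k | j < d] = \sum_(g : {ffun 'I_d -> 'I_N}) F [tuple x j (g j) | j < d].
Proof.
(* With no index at all the entries are empty sums, so both sides vanish, unless d = 0 and both are
   F at the only tuple. *)
have [/existsP[k0 _]|/existsPn N0] := boolP [exists k : 'I_N, true]; last first.
  have [d0|d_gt0] := posnP d; last first.
    pose j0 := Ordinal d_gt0; rewrite big1 => [|g _]; last by have := N0 (g j0).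
    apply: (multiadditive0 FD (i := j0)); rewrite tnth_mktuple big1 // => k _.
    by have := N0 k.
  have e (t t' : d.-tuple R) : t = t'.
    by apply: eq_from_tnth => j; have := ltn_ord j; rewrite [X in (_ < X)%N]d0.
  rewrite (eq_bigr (fun=> F [tuple \sum_k x j k | j < d])); last by move=> g _; congr F; apply: e.
  by rewrite sumr_const card_ffun !card_ord [X in _ *+ (_ ^ X)]d0.
(* Choices on J are encoded as functions on all of ['I_d] frozen at [k0] outside J, which keeps one
   index type throughout the induction. *)
pose fam (J : seq 'I_d) := [pred g : {ffun 'I_d -> 'I_N} | [forall j, (j \in J) || (g j == k0)]].
suff H (J : seq 'I_d) (t : d.-tuple R) : uniq J ->
    F [tuple if j \in J then \sum_k x j k else tnth t j | j < d]
    = \sum_(g in fam J) F [tuple if j \in J then x j (g j) else tnth t j | j < d].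
  have := H (enum 'I_d) [tuple 0 | _ < d] (enum_uniq _).
  have -> : [tuple if j \in enum 'I_d then \sum_k x j k else tnth [tuple 0 | _ < d] j | j < d]
      = [tuple \sum_k x j k | j < d].
    by apply: eq_from_tnth => j; rewrite !tnth_mktuple mem_enum.
  move=> ->; apply: eq_big => [g|g _].
    by apply/forallP => j; rewrite mem_enum.
  by congr F; apply: eq_from_tnth => j; rewrite !tnth_mktuple mem_enum.
elim: J t => [|j0 J IH] t.
  move=> _; rewrite (big_pred1 [ffun => k0]) //= => g.
  rewrite inE; apply/forallP/eqP => [h|-> j]; last by rewrite ffunE eqxx.
  by apply/ffunP => j; rewrite ffunE; apply/eqP/h.
move=> /= /andP[jJ uJ].
set t1 := [tuple if j \in J then \sum_k x j k else tnth t j | j < d].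
have -> : [tuple if j \in j0 :: J then \sum_k x j k else tnth t j | j < d]
    = tset t1 j0 (\sum_k x j0 k).
  by apply: eq_from_tnth => j; rewrite tnth_tset !tnth_mktuple inE; case: eqVneq => [->|].
rewrite (addmap_sum (f := fun z => F (tset t1 j0 z)) (FD t1 j0)).
rewrite (partition_big (fun g : {ffun 'I_d -> 'I_N} => g j0) xpredT) //=.
apply: eq_bigr => k _.
have -> : tset t1 j0 (x j0 k)
    = [tuple if j \in J then \sum_k x j k else tnth (tset t j0 (x j0 k)) j | j < d].
  apply: eq_from_tnth => j; rewrite tnth_tset !tnth_mktuple.
  by case: eqVneq => [->|//]; rewrite (negPf jJ).
rewrite IH //.
pose h z (g : {ffun 'I_d -> 'I_N}) := [ffun j => if j == j0 then z else g j].
rewrite [RHS](reindex_onto (h k) (h k0)) /=; last first.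
  move=> g /andP[_ /eqP gk]; apply/ffunP => j; rewrite !ffunE.
  by case: eqVneq => // ->.
apply: eq_big => [g|g _].
  rewrite ffunE !eqxx andbT; apply/forallP/andP => [H|[/forallP H /eqP <-] j].
    split.
      by apply/forallP => j; rewrite inE ffunE; case: eqP => //= _; apply: H.
    apply/eqP/ffunP => j; rewrite !ffunE; case: eqVneq => // ->.
    by have := H j0; rewrite (negPf jJ) => /eqP.
  have := H j; rewrite inE !ffunE; case: eqP => //= _; by rewrite eqxx orbT.
congr F; apply: eq_from_tnth => j; rewrite !tnth_mktuple inE ffunE.
by case: eqVneq => [->|] //=; rewrite (negPf jJ).
Qed.
End MultiadditiveExpansion.

Section Grid.
Variables (R : realType) (d : nat).
Implicit Types (a b y z v : 'rV[R]_d) (c : seq R).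

Definition rectb a b y := [forall j, a ord0 j <= y ord0 j < b ord0 j].

Lemma rectbP a b y : reflect (rect a b y) (rectb a b y).
Proof.
apply: (iffP forallP) => h j; first by apply/andP/h.
by apply/andP; apply: h.
Qed.

Definition sides a b : d.-tuple R := [tuple b ord0 j - a ord0 j | j < d].

Definition cell_index c := {ffun 'I_d -> 'I_(nint c)}.
Definition clo c (g : cell_index c) : 'rV[R]_d := \row_j pt c (g j).
Definition chi c (g : cell_index c) : 'rV[R]_d := \row_j pt c (g j).+1.

Lemma pt_lt_cell c (k : 'I_(nint c)) : pt c k < pt c k.+1.
Proof. by rewrite lt_pt // ?nint_lt // ltnW // nint_lt. Qed.

Lemma clo_in_cell c (g : cell_index c) : rectb (clo g) (chi g) (clo g).
Proof. by apply/forallP => j; rewrite !mxE lexx pt_lt_cell. Qed.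

(* The same list of cuts serves all the coordinates. *)
Definition in_cuts c a := forall j, a ord0 j \in c.

Lemma clo_cuts c (g : cell_index c) : in_cuts c (clo g).
Proof. by move=> j; rewrite mxE pt_mem // ltnW // nint_lt. Qed.

Lemma chi_cuts c (g : cell_index c) : in_cuts c (chi g).
Proof. by move=> j; rewrite mxE pt_mem // nint_lt. Qed.

Lemma cell_of c a b y : in_cuts c a -> in_cuts c b -> rectb a b y ->
  exists g : cell_index c, rectb (clo g) (chi g) y.
Proof.
move=> ac bc /forallP ab.
have /fin_all_exists[k kP] : forall j, exists k : 'I_(nint c), pt c k <= y ord0 j < pt c k.+1.
  by move=> j; apply: (adj_locate (ac j) (bc j)).
by exists [ffun j => k j]; apply/forallP => j; rewrite !mxE ffunE kP.
Qed.

Lemma cell_uniq c (g g' : cell_index c) y :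
  rectb (clo g) (chi g) y -> rectb (clo g') (chi g') y -> g = g'.
Proof.
move=> /forallP h /forallP h'; apply/ffunP => j; apply/val_inj/eqP.
have := h j; have := h' j; rewrite !mxE => e' e.
have [E _] := adj_uniq (adj_pt (ltn_ord (g j))) (adj_pt (ltn_ord (g' j))) e e'.
have s k : (k < nint c)%N -> (k < size (pts c))%N by move/nint_lt/ltnW.
have [hk hk'] := (s _ (ltn_ord (g j)), s _ (ltn_ord (g' j))).
by rewrite eqn_leq -(le_pt hk hk') -(le_pt hk' hk) E lexx.
Qed.

(** To lie on the same side of every cut: a form of sharing a cell that also makes sense outside the
    grid. The large inequality matches half-open rectangles. *)
Definition eqc c y z := forall x j, x \in c -> (x <= y ord0 j) = (x <= z ord0 j).

Lemma eqc_rectb c a b y z : in_cuts c a -> in_cuts c b -> eqc c y z ->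
  rectb a b y = rectb a b z.
Proof. by move=> ac bc yz; apply: eq_forallb => j; rewrite !ltNge !yz. Qed.

Lemma cell_eqc c (g : cell_index c) y z :
  rectb (clo g) (chi g) y -> rectb (clo g) (chi g) z -> eqc c y z.
Proof.
move=> /forallP h /forallP h' x j xc; have := h j; have := h' j; rewrite !mxE => e' e.
have /and4P[_ _ _ /allP/(_ x xc)/orP[le|le]] := adj_pt (ltn_ord (g j)).
  by rewrite (le_trans le) 1?(le_trans le) //; case/andP: e; case/andP: e'.
apply/idP/idP => le'; exfalso; lra.
Qed.

Section Sum.
Variables (A : zmodType) (F : d.-tuple R -> A).
Hypothesis FD : multiadditive F.

Lemma rect_expand c a b : in_cuts c a -> in_cuts c b ->
  (forall j, a ord0 j <= b ord0 j) ->
  F (sides a b) = \sum_(g : cell_index c) (if rectb a b (clo g) then F (sides (clo g) (chi g)) else 0).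
Proof.
move=> ac bc ab; pose x (j : 'I_d) (k : 'I_(nint c)) :=
  if a ord0 j <= pt c k < b ord0 j then pt c k.+1 - pt c k else 0.
have -> : sides a b = [tuple \sum_k x j k | j < d].
  by apply: eq_from_tnth => j; rewrite !tnth_mktuple sum_increments.
rewrite multiadditive_expand //; apply: eq_bigr => g _.
case: ifPn => [/forallP h|].
  by congr F; apply: eq_from_tnth => j; have := h j; rewrite !tnth_mktuple !mxE /x => ->.
rewrite negb_forall => /existsP[j h].
apply: (multiadditive0 FD (i := j)); rewrite tnth_mktuple /x.
by move: h; rewrite mxE => /negPf ->.
Qed.
End Sum.

(** The weighted form of the fact that the tensor volume is well defined: on a grid containing all
    the corners, the sum over a tiling of S no longer depends on the tiling. The weight h is
    constant on each piece, with value w. *)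
Lemma tiling_sum (A : zmodType) (X : Type) (F : X -> d.-tuple R -> A) (h : 'rV[R]_d -> X)
    (I : eqType) (r : seq I) (lo hi : I -> 'rV[R]_d) (w : I -> X) (S : pred 'rV[R]_d) c :
  (forall x, multiadditive (F x)) ->
  (forall i, i \in r -> [/\ in_cuts c (lo i), in_cuts c (hi i) &
     forall j, lo i ord0 j <= hi i ord0 j]) ->
  (forall y, count (fun i => rectb (lo i) (hi i) y) r = S y) ->
  (forall i y, i \in r -> rectb (lo i) (hi i) y -> h y = w i) ->
  \sum_(i <- r) F (w i) (sides (lo i) (hi i))
  = \sum_(g : cell_index c) (if S (clo g) then F (h (clo g)) (sides (clo g) (chi g)) else 0).
Proof.
move=> FD lohi cnt hw.
transitivity (\sum_(i <- r) \sum_(g : cell_index c)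
    (if rectb (lo i) (hi i) (clo g) then F (h (clo g)) (sides (clo g) (chi g)) else 0)).
  apply: eq_big_seq => i ir; have [loc hic le] := lohi i ir.
  rewrite (rect_expand (FD (w i)) loc hic le); apply: eq_bigr => g _.
  by case: ifP => // /(hw _ _ ir) ->.
rewrite exchange_big /=; apply: eq_bigr => g _.
rewrite -big_mkcond big_const_seq cnt.
by case: (S (clo g)); rewrite //= addr0.
Qed.
End Grid.

(** * Rectangle exchanges *)

Lemma count_le1 (T : eqType) (r : seq T) (P : pred T) : uniq r ->
  (forall i j, i \in r -> j \in r -> P i -> P j -> i = j) -> count P r = has P r.
Proof.
move=> ur eqr; have [/hasP[i ir Pi]|/negPf h] := boolP (has P r); last first.
  by apply/eqP; rewrite eqn0Ngt -has_count h.
rewrite (@eq_in_count _ _ (pred1 i)) ?count_uniq_mem ?ir // => j jr /=.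
by apply/idP/eqP => [Pj|->//]; apply: eqr.
Qed.

Section Decompositions.
Variables (R : realType) (d : nat).
Implicit Types (a b y z v : 'rV[R]_d) (c : seq R) (M S : set 'rV[R]_d).

Lemma rect_decompI S (I : eqType) (r : seq I) (lo hi : I -> 'rV[R]_d) :
  uniq r -> (forall i, i \in r -> valid_rect (lo i) (hi i)) ->
  (forall i j y, i \in r -> j \in r -> rectb (lo i) (hi i) y -> rectb (lo j) (hi j) y -> i = j) ->
  (forall y, S y <-> exists2 i, i \in r & rectb (lo i) (hi i) y) ->
  rect_decomp S [seq (lo i, hi i) | i <- r].
Proof.
case: r => [_ _ _ cov|i0 r ur v disj cov].
  split=> // y; split=> [/cov[]//|[]//].
have nthE k : (k < size (i0 :: r))%N ->
    nth (0, 0) [seq (lo i, hi i) | i <- i0 :: r] k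
    = (lo (nth i0 (i0 :: r) k), hi (nth i0 (i0 :: r) k)).
  by move=> h; rewrite (nth_map i0).
split=> [k|k l|y]; rewrite ?size_map.
- by move=> h; rewrite nthE //; apply/v/mem_nth.
- move=> hk hl kl y; rewrite !nthE //= => /rectbP yk /rectbP yl.
  have /eqP := disj _ _ _ (mem_nth _ hk) (mem_nth _ hl) yk yl.
  by rewrite nth_uniq // => /eqP.
- rewrite cov; split=> [[i ir yi]|[k hk]].
    exists (index i (i0 :: r)); first by rewrite index_mem.
    by rewrite nthE ?index_mem // nth_index //; apply/rectbP.
  rewrite nthE // => /rectbP yk.
  by exists (nth i0 (i0 :: r) k) => //; apply: mem_nth.
Qed.

Lemma rect_decomp_valid S s p : rect_decomp S s -> p \in s -> valid_rect p.1 p.2.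
Proof. by case=> v _ _ /(nthP (0, 0))[k hk <-]; apply: v. Qed.

Lemma rect_decomp_count S s y : rect_decomp S s ->
  count (fun p => rectb p.1 p.2 y) s = `[< S y >].
Proof.
case=> _ disj cov; case: asboolP => [/cov[k hk /rectbP yk]|nS]; last first.
  apply/eqP; rewrite eqn0Ngt -has_count; apply/hasPn => p /(nthP (0, 0))[k hk <-].
  by apply/negP => /rectbP yk; apply: nS; apply/cov; exists k.
rewrite -(cat_take_drop k s) (drop_nth (0, 0)) // count_cat /= yk.
have z s' (f : nat -> nat) : (forall l, (l < size s')%N ->
     nth (0, 0) s' l = nth (0, 0) s (f l) /\ (f l < size s)%N /\ f l <> k) ->
   count (fun p => rectb p.1 p.2 y) s' = 0%N.
  move=> H; apply/eqP; rewrite eqn0Ngt -has_count; apply/hasPn => p /(nthP (0, 0))[l hl <-].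
  have [-> [hf fk]] := H l hl; apply/negP => /rectbP yl.
  by apply: (disj _ _ hf hk fk y) => //; apply/rectbP.
rewrite (z _ id) ?(z _ (fun l => k.+1 + l)%N) // => l.
  rewrite size_drop nth_drop ltn_subRL => lk; split=> //; split=> //.
  by move=> E; have := leq_addr l k.+1; rewrite E ltnn.
rewrite size_takel; last exact: ltnW.
move=> lk; rewrite nth_take //; split=> //; split; last lia.
exact: ltn_trans lk hk.
Qed.

(** A grid has cells only between its extreme cuts; this condition places S there, by [cell_of]. *)
Definition bounded_by c S := forall y, S y ->
  exists a b, [/\ in_cuts c a, in_cuts c b & rectb a b y].

Lemma cells_decomp c S : bounded_by c S ->
  (forall y z, eqc c y z -> S y -> S z) ->
  rect_decomp S [seq (clo g, chi g) | g <- [seq g <- enum (cell_index d c) | `[< S (clo g) >]]].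
Proof.
move=> bS eS; apply: rect_decompI.
- by rewrite filter_uniq // enum_uniq.
- by move=> g _ j; rewrite !mxE pt_lt_cell.
- by move=> g g' y _ _; apply: cell_uniq.
- move=> y; split=> [Sy|[g]].
    have [a [b [ac bc yab]]] := bS y Sy; have [g yg] := cell_of ac bc yab.
    exists g => //; rewrite mem_filter mem_enum andbT; apply/asboolP.
    exact: eS (cell_eqc yg (clo_in_cell g)) Sy.
  rewrite mem_filter => /andP[/asboolP Sg _] yg.
  exact: eS (cell_eqc (clo_in_cell g) yg) Sg.
Qed.

Definition endpoints (s : seq ('rV[R]_d * 'rV[R]_d)) : seq R :=
  [seq (p.1 : 'rV[R]_d) ord0 j | p <- s, j <- enum 'I_d]
  ++ [seq (p.2 : 'rV[R]_d) ord0 j | p <- s, j <- enum 'I_d].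

Lemma endpointsP s p : p \in s ->
  in_cuts (endpoints s) p.1 /\ in_cuts (endpoints s) p.2.
Proof.
move=> ps; split=> j; rewrite mem_cat; apply/orP; [left|right];
  by apply/allpairsP; exists (p, j); rewrite mem_enum.
Qed.

Lemma in_cutsS c c' a : {subset c <= c'} -> in_cuts c a -> in_cuts c' a.
Proof. by move=> cc' ac j; apply/cc'/ac. Qed.

Lemma eqcS c c' y z : {subset c <= c'} -> eqc c' y z -> eqc c y z.
Proof. by move=> cc' yz x j /cc'; apply: yz. Qed.

Lemma bounded_byS c c' S : {subset c <= c'} -> bounded_by c S -> bounded_by c' S.
Proof.
by move=> cc' bS y /bS[a [b [ac bc yab]]]; exists a, b; split=> //; apply: in_cutsS cc' _.
Qed.
End Decompositions.

(** * Grids adapted to a rectangle exchange *)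

Section RecGroup.
Variables (R : realType) (d : nat).
Implicit Types (a b y z v : 'rV[R]_d) (c : seq R) (M S : set 'rV[R]_d).
Implicit Types (f g : 'rV[R]_d -> 'rV[R]_d).

(* The cells of the grid [c] contained in M tile M and [f] translates each of them. *)
Definition adapted c M f := bounded_by c M /\
  forall y z, eqc c y z -> M y -> M z /\ f z - z = f y - y.

Lemma adaptedS c c' M f : {subset c <= c'} -> adapted c M f -> adapted c' M f.
Proof.
move=> cc' [bM e]; split=> [|y z /(eqcS cc')]; [exact: bounded_byS bM|exact: e].
Qed.

Lemma inRec_adapted M f : inRec M f -> exists c, adapted c M f.
Proof.
case=> _ _ _ _ [s [sM fE]]; exists (endpoints [seq p.1 | p <- s]).
have [_ _ cov] := sM; have mem_s k : (k < size s)%N ->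
    (nth (0, 0, 0) s k).1 \in [seq p.1 | p <- s].
  by move=> hk; apply/map_f/mem_nth.
split=> [y /cov[k]|y z yz /cov[k]]; rewrite size_map => hk;
  rewrite (nth_map (0, 0, 0)) // => /rectbP yk.
  by have [ac bc] := endpointsP (mem_s k hk); do 2![eexists]; split; [exact: ac|exact: bc|exact: yk].
have [ac bc] := endpointsP (mem_s k hk).
have zk := yk; rewrite (eqc_rectb ac bc yz) in zk; move/rectbP: zk; move/rectbP: yk => yk zk.
split.
  by apply/cov; exists k; rewrite ?size_map // (nth_map (0, 0, 0)).
by rewrite !(fE k) // !(addrC _ (nth _ _ _).2) !addrK.
Qed.

Lemma inRec_can M f : inRec M f -> exists f', [/\ cancel f f', cancel f' f,
  forall y, M y -> M (f' y) & forall y, ~ M y -> f' y = y].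
Proof.
case=> fid fM finj fsurj _.
have /choice[f' f'E] : forall z, exists y, f y = z /\ (M z <-> M y).
  move=> z; have [Mz|nMz] := pselect (M z).
    by have [y My yz] := fsurj z Mz; exists y.
  by exists z; split=> //; apply: fid.
have fMiff y : M (f y) <-> M y.
  split=> [|/fM//]; have [//|nMy] := pselect (M y); by rewrite fid.
have fi y z : f y = f z -> y = z.
  move=> yz; have [My|nMy] := pselect (M y).
    by apply: finj => //; apply/fMiff; rewrite -yz; apply/fMiff.
  have nMz : ~ M z by move=> /fMiff; rewrite -yz => /fMiff.
  by move: yz; rewrite !fid.
exists f'; split=> [y|y|y|y].
- by apply: fi; case: (f'E (f y)).
- by case: (f'E y).
- by case: (f'E y) => _ [].
- by move=> nMy; apply: fi; rewrite (fid y nMy); case: (f'E y).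
Qed.

(** The partition demanded by [inRec] consists of the cells whose lower corner is in M. *)
Lemma inRecI M f f' c : adapted c M f -> cancel f f' -> cancel f' f ->
  (forall y, ~ M y -> f y = y) -> (forall y, M y -> M (f y)) ->
  (forall y, M y -> M (f' y)) -> inRec M f.
Proof.
move=> [bM e] fK f'K fid fM f'M; split=> //.
- by move=> y z _ _; apply: (can_inj fK).
- by move=> z Mz; exists (f' z); [apply: f'M|rewrite f'K].
set r := [seq q <- enum (cell_index d c) | `[< M (clo q) >]].
exists [seq (clo q, chi q, f (clo q) - clo q) | q <- r]; split.
  rewrite -map_comp; apply: cells_decomp => // y z yz My.
  by case: (e y z yz My).
have rM q : q \in r -> M (clo q) by rewrite mem_filter => /andP[/asboolP].
case: r rM => [//|q0 r] rM k y; rewrite size_map => hk; rewrite (nth_map q0) //=.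
move=> /rectbP yq; have Mq := rM _ (mem_nth q0 hk).
have [_ E] := e _ _ (cell_eqc (clo_in_cell _) yq) Mq.
by rewrite -[nth _ _ _]/(nth _ _ _) -E addrC subrK.
Qed.

Lemma adapted_values c M f : adapted c M f ->
  exists vs : seq 'rV[R]_d, forall y, M y -> f y - y \in vs.
Proof.
move=> [bM e]; exists [seq f (clo q) - clo q | q : cell_index d c] => y My.
have [a [b [ac bc yab]]] := bM y My; have [q yq] := cell_of ac bc yab.
have [_ <-] := e _ _ (cell_eqc yq (clo_in_cell q)) My.
by apply: (map_f (fun q : cell_index d c => f (clo q) - clo q)); rewrite mem_enum.
Qed.

Lemma adapted_comp c1 c2 M f g : adapted c1 M f -> adapted c2 M g ->
  (forall y, M y -> M (g y)) ->
  exists c, {subset c2 <= c} /\ adapted c M (f \o g).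
Proof.
move=> [bM ef] ag gM; have [vs vsP] := adapted_values ag; have [_ eg] := ag.
pose zs := [seq (v : 'rV[R]_d) ord0 j | v <- vs, j <- enum 'I_d].
(* The grid of f is pulled back by the finitely many displacements of g. As the same cuts serve all
   coordinates, every coordinate of a displacement is subtracted from every cut. *)
pose c := c2 ++ [seq x - t | x <- c1, t <- zs].
have sub : {subset c2 <= c} by move=> x xc; rewrite mem_cat xc.
exists c; split=> //; split; first exact: bounded_byS (ag.1).
move=> y z yz My; have [Mz E] := eg _ _ (eqcS sub yz) My; split=> //=.
have gyz : eqc c1 (g y) (g z).
  move=> x j xc.
  have mem : x - (g y - y) ord0 j \in c.
    rewrite mem_cat; apply/orP; right; apply: allpairs_f => //.
    by apply: allpairs_f; rewrite ?vsP ?mem_enum.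
  have := yz _ j mem; have -> : g z = z + (g y - y) by rewrite -E addrC subrK.
  by rewrite !mxE !lerBlDr => <-; congr (_ <= _); ring.
have [_ E'] := ef _ _ gyz (gM _ My).
have -> : f (g z) - z = (f (g z) - g z) + (g z - z) by rewrite addrA subrK.
by rewrite E' E addrA subrK.
Qed.

Lemma inRec_comp M f g : inRec M f -> inRec M g -> inRec M (f \o g).
Proof.
move=> rf rg; have [c1 a1] := inRec_adapted rf; have [c2 a2] := inRec_adapted rg.
have [f' [fK f'K f'M _]] := inRec_can rf; have [g' [gK g'K g'M _]] := inRec_can rg.
have [fid fM _ _ _] := rf; have [gid gM _ _ _] := rg.
have [c [_ ac]] := adapted_comp a1 a2 gM.
apply: (inRecI (f' := g' \o f') ac).
- exact: can_comp.
- exact: can_comp.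
- by move=> y nMy /=; rewrite gid // fid.
- by move=> y /gM/fM.
- by move=> y /f'M/g'M.
Qed.
End RecGroup.

(** * The tensor invariant is a homomorphism *)

Section TensorInvariant.
Variables (R : realType) (n : nat) (V : zmodType) (tv : ftens R n.+2 -> V).
Hypotheses (tvD : forall s s', tv (s ++ s') = tv s + tv s')
  (tvE : forall s s', tv s = tv s' <-> teq s s').
Implicit Types (i j : 'I_n.+1) (t : n.+1.-tuple R) (x : R).

Lemma tv_nil : tv [::] = 0.
Proof. by apply: (addrI (tv [::])); rewrite -tvD addr0. Qed.

Lemma tv_sum s : tv s = \sum_(p <- s) tv [:: p].
Proof. by elim: s => [|p s IH]; rewrite ?big_nil ?tv_nil // big_cons -IH -tvD. Qed.

Lemma tv_flatten (T : Type) (F : T -> ftens R n.+2) (r : seq T) :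
  tv (flatten [seq F u | u <- r]) = \sum_(u <- r) tv (F u).
Proof. by elim: r => [|u r IH]; rewrite ?big_nil ?tv_nil //= big_cons tvD IH. Qed.

Lemma tv_scaleN s : tv (tscale (-1) s) = - tv s.
Proof.
apply: (addrI (tv s)); rewrite -tvD subrr -tv_nil; apply/tvE.
apply: tzero_coef => t; rewrite coef_cat coef_tscale mulN1r subrr.
by rewrite /coef big_nil.
Qed.

Lemma tv_multiadditive : multiadditive (fun t : n.+2.-tuple R => tv [:: (1, t)]).
Proof.
move=> t i x y; apply/eqP; rewrite -subr_eq0 opprD addrA; apply/eqP.
rewrite -!tv_scaleN -!tvD -tv_nil; apply/tvE.
by apply: tz_ext (tz_add t i x y) => u; rewrite coef_cat coef_tscale mulN1r
  [coef [::] u]/coef big_nil subr0 /= !mulr1.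
Qed.

Lemma tv_rat (t : n.+2.-tuple R) q k : tv [:: (q, t)] = tv [:: (1, tset t k (ratr q * tnth t k))].
Proof.
apply/esym/eqP; rewrite -subr_eq0; apply/eqP.
rewrite -!tv_scaleN -!tvD -tv_nil; apply/tvE.
apply: tz_ext (tz_hom t k q (tnth t k)) => u; rewrite coef_cat coef_tscale mulN1r.
by rewrite [coef [::] u]/coef big_nil subr0 /= mulN1r tset_id.
Qed.

Definition swap_last i j : 'I_n.+1 :=
  if j == i then ord_max else if j == ord_max then i else j.

Lemma swap_lastK i : involutive (swap_last i).
Proof.
move=> j; rewrite /swap_last; case: (eqVneq j i) => [->|ji].
  by case: eqVneq => [->|]; rewrite ?eqxx.
case: (eqVneq j ord_max) => [->|jm]; first by rewrite eqxx.
by rewrite (negPf ji) (negPf jm).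
Qed.

Definition swapt i t : n.+1.-tuple R := [tuple tnth t (swap_last i j) | j < n.+1].

(** The term of T_i due to a box with sides t that is moved by x in direction i. *)
Definition Phi i x t : V := tv [:: (1, rcons_tuple (swapt i t) x)].

Lemma tnth_rcons_tuple m (t : m.-tuple R) x (k : 'I_m.+1) : tnth (rcons_tuple t x) k
  = if unlift ord_max k is Some j then tnth t j else x.
Proof.
case: unliftP => [j ->|->]; rewrite !(tnth_nth 0) nth_rcons size_tuple.
  by rewrite lift_max ltn_ord.
by rewrite ltnn eqxx.
Qed.

Lemma rcons_tset t j x y :
  rcons_tuple (tset t j y) x = tset (rcons_tuple t x) (lift ord_max j) y.
Proof.
apply: eq_from_tnth => k; rewrite tnth_tset !tnth_rcons_tuple.
case: (unliftP ord_max k) => [l ->|->]; last by rewrite (negPf (neq_lift _ _)).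
by rewrite tnth_tset (inj_eq lift_inj).
Qed.

Lemma rcons_tset_last t x y : rcons_tuple t x = tset (rcons_tuple t y) ord_max x.
Proof.
apply: eq_from_tnth => k; rewrite tnth_tset !tnth_rcons_tuple.
case: (unliftP ord_max k) => [l ->|->]; last by rewrite eqxx.
by rewrite eq_sym (negPf (neq_lift _ _)).
Qed.

Lemma swapt_tset i j t y : swapt i (tset t j y) = tset (swapt i t) (swap_last i j) y.
Proof.
apply: eq_from_tnth => k; rewrite tnth_tset !tnth_mktuple.
by rewrite (can2_eq (swap_lastK i) (swap_lastK i)).
Qed.

Lemma Phi_multiadditive i x : multiadditive (Phi i x).
Proof.
by move=> t j y z; rewrite /Phi !swapt_tset !rcons_tset tv_multiadditive.
Qed.

Lemma Phi_add i t x y : Phi i (x + y) t = Phi i x t + Phi i y t.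
Proof.
rewrite /Phi (rcons_tset_last _ (x + y) 0) tv_multiadditive.
by rewrite -!rcons_tset_last.
Qed.

Section GridSum.
Variable M : set 'rV[R]_n.+1.
Implicit Types (c : seq R) (f g : 'rV[R]_n.+1 -> 'rV[R]_n.+1).

Definition grid_sum c (h : 'rV[R]_n.+1 -> R) i : V :=
  \sum_(q : cell_index n.+1 c)
    (if `[< M (clo q) >] then Phi i (h (clo q)) (sides (clo q) (chi q)) else 0).

Lemma count_cells c (P : 'rV[R]_n.+1 -> cell_index n.+1 c -> bool) y :
  (forall q q', M (clo q) -> M (clo q') -> P y q -> P y q' -> q = q') ->
  (M y <-> exists q, M (clo q) /\ P y q) ->
  count (P y) [seq q <- enum (cell_index n.+1 c) | `[< M (clo q) >]] = `[< M y >].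
Proof.
move=> Pi MP; set r := filter _ _.
have ur : uniq r by apply: filter_uniq; apply: enum_uniq.
rewrite (count_le1 ur); last first.
  by move=> q q'; rewrite !mem_filter => /andP[/asboolP Mq _] /andP[/asboolP Mq' _]; apply: Pi.
congr (nat_of_bool _); apply/hasP/asboolP => [[q]|/MP[q [Mq Pq]]].
  by rewrite mem_filter => /andP[/asboolP Mq _] Pq; apply/MP; exists q.
by exists q => //; rewrite mem_filter mem_enum andbT; apply/asboolP.
Qed.

Lemma cells_cover c f y : adapted c M f -> M y ->
  exists q : cell_index n.+1 c, M (clo q) /\ rectb (clo q) (chi q) y.
Proof.
move=> [bM e] My; have [a [b [ac bc yab]]] := bM y My; have [q yq] := cell_of ac bc yab.
by exists q; split=> //; case: (e _ _ (cell_eqc yq (clo_in_cell q)) My).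
Qed.

Lemma cells_sub c f y (q : cell_index n.+1 c) : adapted c M f -> M (clo q) ->
  rectb (clo q) (chi q) y -> M y /\ f y - y = f (clo q) - clo q.
Proof. by move=> [bM e] Mq yq; apply: (e _ _ (cell_eqc (clo_in_cell q) yq)). Qed.

Lemma grid_sumE c (r : seq (cell_index n.+1 c)) :
  r = [seq q <- enum (cell_index n.+1 c) | `[< M (clo q) >]] ->
  forall F : cell_index n.+1 c -> V,
  \sum_(q : cell_index n.+1 c) (if `[< M (clo q) >] then F q else 0) = \sum_(q <- r) F q.
Proof. by move=> -> F; rewrite big_filter big_enum_cond /= -big_mkcond. Qed.

Lemma grid_sum_refine c c' f i : {subset c <= c'} -> adapted c M f ->
  grid_sum c (fun y => (f y - y) ord0 i) i = grid_sum c' (fun y => (f y - y) ord0 i) i.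
Proof.
move=> cc' ac; rewrite /grid_sum (grid_sumE erefl).
set r := [seq _ <- _ | _].
rewrite (tiling_sum (c := c') (S := fun y => `[< M y >]) (F := Phi i)
  (h := fun y => (f y - y) ord0 i)) //.
- exact: Phi_multiadditive.
- move=> q _; split=> [||j]; first exact: in_cutsS cc' (clo_cuts _).
    exact: in_cutsS cc' (chi_cuts _).
  by rewrite !mxE ltW // pt_lt_cell.
- move=> y; apply: (count_cells (P := fun y q => rectb (clo q) (chi q) y)) => [q q' _ _|].
    exact: cell_uniq.
  by split=> [/(cells_cover ac)//|[q [Mq yq]]]; case: (cells_sub ac Mq yq).
- move=> q y; rewrite mem_filter => /andP[/asboolP Mq _] yq.
  by have [_ ->] := cells_sub ac Mq yq.
Qed.

(** [Tmap] chooses a list of displacements and a decomposition of each level set. On the grid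
    refined by all the endpoints of these decompositions the choices disappear, and
    [grid_sum_refine] returns to c. *)
Lemma Tmap_grid c f i : inRec M f -> adapted c M f ->
  tv (Tmap M f i) = grid_sum c (fun y => (f y - y) ord0 i) i.
Proof.
move=> rf ac; pose S v := (fun y => M y /\ f y - y = v) : set 'rV[R]_n.+1.
have [vs vsP] := adapted_values ac.
have [xs [uxs xsP ->]] : exists xs, [/\ uniq xs, forall y, M y -> f y - y \in xs &
    Tmap M f i = flatten [seq tens_r (tswap i (tvol (S v))) (v ord0 i) | v <- xs]].
  apply: (@xgetPex _ [::] (fun w => exists xs : seq 'rV[R]_n.+1,
    [/\ uniq xs, forall y, M y -> f y - y \in xs &
        w = flatten [seq tens_r (tswap i (tvol (S v))) (v ord0 i) | v <- xs]])).
  eexists; exists (undup vs); split; [exact: undup_uniq| |reflexivity].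
  by move=> y My; rewrite mem_undup vsP.
have /choice[s sP] : forall v, exists s, rect_decomp (S v) s /\ tvol (S v) = tvol_of_rects s.
  move=> v; apply: (@xgetPex _ [::] (is_tvol (S v))).
  eexists; eexists; split; last reflexivity.
  apply: (cells_decomp (c := c)); first by move=> y [/ac.1].
  by move=> y z yz [My E]; have [Mz E'] := ac.2 y z yz My; split=> //; rewrite E'.
pose c' := c ++ flatten [seq endpoints (s v) | v <- xs].
rewrite (@grid_sum_refine c c') //; last by move=> x xc; rewrite mem_cat xc.
rewrite tv_flatten.
transitivity (\sum_(v <- xs) \sum_(q : cell_index n.+1 c')
    (if `[< S v (clo q) >] then Phi i (v ord0 i) (sides (clo q) (chi q)) else 0)).
  apply: eq_big_seq => v vxs; have [dec ->] := sP v.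
  rewrite -(tiling_sum (S := fun y => `[< S v y >]) (F := fun _ : unit => Phi i (v ord0 i))
    (h := fun _ => tt) (r := s v) (lo := fst) (hi := snd) (w := fun _ => tt)) //.
  - rewrite tv_sum /tens_r /tswap /tvol_of_rects -!map_comp big_map.
    by apply: eq_bigr => p _.
  - by move=> _; apply: Phi_multiadditive.
  - move=> p ps; have [e1 e2] := endpointsP ps.
    have sub : {subset endpoints (s v) <= c'}.
      move=> x xe; rewrite mem_cat; apply/orP; right.
      by apply/flattenP; exists (endpoints (s v)) => //; apply: map_f.
    split=> [||j]; [exact: in_cutsS sub e1|exact: in_cutsS sub e2|].
    by apply/ltW/(rect_decomp_valid dec ps).
  - by move=> y; apply: rect_decomp_count.
rewrite exchange_big /=; apply: eq_bigr => q _.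
case: asboolP => Mq; last first.
  by rewrite big1 // => v _; rewrite asboolF // => -[].
rewrite (bigD1_seq (f (clo q) - clo q)) ?xsP //= asboolT //.
rewrite big1 ?addr0 // => v /eqP vq; rewrite asboolF // => -[_ E].
by apply: vq.
Qed.

(** The displacement of [f \o g] at y is that of f at [g y] plus that of g at y. The first summand
    yields T(f) because the images under g of the cells tile M again, with the same sides. *)
Lemma Tmap_comp f g i : inRec M f -> inRec M g ->
  tv (Tmap M (f \o g) i) = tv (Tmap M f i) + tv (Tmap M g i).
Proof.
move=> rf rg; have [c1 a1] := inRec_adapted rf; have [c2 a2] := inRec_adapted rg.
have [_ gM _ _ _] := rg; have [g' [gK g'K g'M _]] := inRec_can rg.
have [c [sub afg]] := adapted_comp a1 a2 gM; have ag := adaptedS sub a2.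
rewrite (Tmap_grid i (inRec_comp rf rg) afg) (Tmap_grid i rg ag).
pose H y := (f (g y) - g y) ord0 i.
rewrite /grid_sum; transitivity (\sum_(q : cell_index n.+1 c)
   ((if `[< M (clo q) >] then Phi i (H (clo q)) (sides (clo q) (chi q)) else 0) +
   (if `[< M (clo q) >] then Phi i ((g (clo q) - clo q) ord0 i) (sides (clo q) (chi q)) else 0))).
  apply: eq_bigr => q _; case: ifP => _; last by rewrite addr0.
  by rewrite -Phi_add; congr (Phi _ _ _); rewrite /H /= !mxE; ring.
rewrite big_split; congr (_ + _) => /=.
rewrite (grid_sumE erefl); set r := [seq _ <- _ | _].
pose lo (q : cell_index n.+1 c) := g (clo q).
pose hi (q : cell_index n.+1 c) := g (clo q) + (chi q - clo q).
pose cuts : seq R := endpoints [seq (lo q, hi q) | q <- r].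
have sub1 : {subset c1 <= c1 ++ cuts} by move=> x xc; rewrite mem_cat xc.
rewrite (Tmap_grid i rf (adaptedS sub1 a1)) /grid_sum.
have shift q y : M (clo q) -> rectb (lo q) (hi q) y -> rectb (clo q) (chi q) (g' y).
  move=> Mq yq.
  have yq' : rectb (clo q) (chi q) (y - (g (clo q) - clo q)).
    by apply/forallP => j; have := forallP yq j; rewrite /lo /hi !mxE; lra.
  have [Mz E] := cells_sub ag Mq yq'.
  have E1 : g (y - (g (clo q) - clo q)) = y.
    by rewrite -[LHS](subrK (y - (g (clo q) - clo q))) E addrC subrK.
  by have -> : g' y = y - (g (clo q) - clo q) by rewrite -[in LHS]E1 gK.
rewrite -(tiling_sum (S := fun y => `[< M y >]) (F := Phi i) (r := r) (lo := lo) (hi := hi)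
    (w := fun q => H (clo q)) (h := fun y => (f y - y) ord0 i)).
- apply: eq_bigr => q _; congr (Phi _ _ _); apply: eq_from_tnth => j.
  by rewrite !tnth_mktuple /lo /hi !mxE; ring.
- exact: Phi_multiadditive.
- move=> q qr; have [e1 e2] := @endpointsP _ _ [seq (lo q, hi q) | q <- r] _ (map_f _ qr).
  have sub' : {subset cuts <= c1 ++ cuts} by move=> x xc; rewrite mem_cat xc orbT.
  split=> [||j]; [exact: in_cutsS sub' e1|exact: in_cutsS sub' e2|].
  by rewrite /lo /hi !mxE lerDl subr_ge0 ltW // pt_lt_cell.
- move=> y; apply: (count_cells (P := fun y q => rectb (lo q) (hi q) y)).
    by move=> q q' Mq Mq' /(shift _ _ Mq) yq /(shift _ _ Mq'); apply: cell_uniq.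
  split=> [My|[q [Mq /(shift _ _ Mq) yq]]].
    have [q [Mq yq]] := cells_cover ag (g'M _ My); exists q; split=> //.
    have [_ E] := cells_sub ag Mq yq; rewrite -[y]g'K -[g (g' y)](subrK (g' y)) E.
    by apply/forallP => j; have := forallP yq j; rewrite /lo /hi !mxE; lra.
  by rewrite -[y]g'K; apply: gM; case: (cells_sub ag Mq yq).
- move=> q y; rewrite mem_filter => /andP[/asboolP Mq _] /(shift _ _ Mq) yq.
  have [_ E] := cells_sub ag Mq yq; have [_ E'] := cells_sub afg Mq yq.
  move: E E'; rewrite /= g'K => /rowP/(_ i) + /rowP/(_ i).
  by rewrite /H !mxE; lra.
Qed.
End GridSum.
End TensorInvariant.

(** * Swaps and restricted rotations *)

Section Pieces.
Variables (R : realType) (d : nat) (M : set 'rV[R]_d).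
Implicit Types (a b y v : 'rV[R]_d) (s : seq ('rV[R]_d * 'rV[R]_d * 'rV[R]_d)).
Implicit Types (f : 'rV[R]_d -> 'rV[R]_d).

(** The vectors of overlapping pieces add up, in agreement with the additivity of [Phi] in the
    displacement; empty pieces are allowed so that a rotation may have its cut at an end. *)
Definition pieces_of f s :=
  (forall p j, p \in s -> p.1.1 ord0 j <= p.1.2 ord0 j) /\
  (forall p y, p \in s -> rectb p.1.1 p.1.2 y -> M y) /\
  forall y, f y = y + \sum_(p <- s) (if rectb p.1.1 p.1.2 y then p.2 else 0).

Lemma pieces_eqc f s y z : pieces_of f s -> eqc (endpoints [seq p.1 | p <- s]) y z ->
  f y - y = f z - z.
Proof.
move=> [_ [_ fE]] yz; rewrite !fE ![_ + \sum_(p <- s) _]addrC !addrK.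
apply: eq_big_seq => p ps; have [ac bc] := endpointsP (map_f fst ps).
by rewrite (eqc_rectb ac bc yz).
Qed.

Lemma adapted_pieces f s : multirect M -> pieces_of f s ->
  exists c, {subset endpoints [seq p.1 | p <- s] <= c} /\ adapted c M f.
Proof.
move=> [r [_ rM]] fs; pose c := endpoints r ++ endpoints [seq p.1 | p <- s].
have sub1 : {subset endpoints r <= c} by move=> x xc; rewrite mem_cat xc.
have sub2 : {subset endpoints [seq p.1 | p <- s] <= c}.
  by move=> x xc; rewrite mem_cat xc orbT.
exists c; split=> //; split=> [y /rM[p pr /rectbP yp]|y z yz My].
  have [ac bc] := endpointsP pr.
  by exists p.1, p.2; split=> //; apply: in_cutsS sub1 _.
split; last exact/esym/(pieces_eqc fs)/(eqcS sub2).
have /rM[p pr /rectbP yp] := My; have [ac bc] := endpointsP pr.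
by apply/rM; exists p => //; apply/rectbP; rewrite -(eqc_rectb ac bc (eqcS sub1 yz)).
Qed.

Lemma pieces_id f s y : pieces_of f s -> ~ M y -> f y = y.
Proof.
move=> [_ [sM ->]] nMy; rewrite big1_seq ?addr0 // => p /= ps.
by case: ifP => // /(sM _ _ ps).
Qed.

Lemma inRec_pieces f f' s : multirect M -> pieces_of f s -> cancel f f' -> cancel f' f ->
  (forall y, M y -> M (f y)) -> (forall y, M y -> M (f' y)) -> inRec M f.
Proof.
move=> mM fs fK f'K fM f'M; have [c [_ ac]] := adapted_pieces mM fs.
by apply: inRecI ac fK f'K _ fM f'M => y; apply: pieces_id fs.
Qed.
End Pieces.

Section ElementaryMaps.
Variables (R : realType) (d : nat).
Implicit Types (a b y z v : 'rV[R]_d) (i j : 'I_d).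

Lemma rectbD a b v y : rectb (a + v) (b + v) (y + v) = rectb a b y.
Proof. by apply: eq_forallb => j; rewrite !mxE lerD2r ltrD2r. Qed.

Lemma rectbB a b v y : rectb (a + v) (b + v) y = rectb a b (y - v).
Proof. by rewrite -{1}[y](subrK v) rectbD. Qed.

Definition swap a b v y :=
  if rectb a b y then y + v else if rectb (a + v) (b + v) y then y - v else y.

Definition disjoint_shift a b v := forall y, rectb a b y -> rectb a b (y + v) -> False.

Lemma swap_in a b v y : rectb a b y -> swap a b v y = y + v.
Proof. by rewrite /swap => ->. Qed.

Lemma swap_in' a b v y : disjoint_shift a b v -> rectb (a + v) (b + v) y ->
  swap a b v y = y - v.
Proof.
rewrite /swap => dj h; rewrite h; case: ifP => // h'; rewrite rectbB in h.
by have := dj (y - v) h; rewrite subrK => /(_ h').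
Qed.

Lemma swap_out a b v y : ~~ rectb a b y -> ~~ rectb (a + v) (b + v) y -> swap a b v y = y.
Proof. by rewrite /swap => /negPf -> /negPf ->. Qed.

Lemma swapK a b v : disjoint_shift a b v -> involutive (swap a b v).
Proof.
move=> dj y; have [h|h] := boolP (rectb a b y).
  by rewrite (swap_in v h) swap_in' ?rectbD ?addrK.
have [h'|h'] := boolP (rectb (a + v) (b + v) y).
  by rewrite (swap_in' dj h') swap_in ?subrK // -rectbB.
by rewrite swap_out // swap_out.
Qed.

Definition shift i (x : R) : 'rV[R]_d := \row_j (if j == i then x else 0).

Definition rot i a b (m : R) y :=
  if rectb a b y then
    if y ord0 i < m then y + shift i (b ord0 i - m) else y - shift i (m - a ord0 i)
  else y.

Lemma rectb_shift i a b y x : rectb a b y ->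
  rectb a b (y + shift i x) = (a ord0 i <= y ord0 i + x < b ord0 i).
Proof.
move=> /forallP h; apply/forallP/idP => [/(_ i)|H j]; first by rewrite !mxE eqxx.
by rewrite !mxE; case: eqP => [->//|_]; rewrite addr0.
Qed.

Lemma shiftN i x : - shift i x = shift i (- x).
Proof. by apply/rowP => j; rewrite !mxE; case: eqP => _; rewrite ?oppr0. Qed.

Lemma rot_rectb i a b m y : a ord0 i <= m <= b ord0 i ->
  rectb a b (rot i a b m y) = rectb a b y.
Proof.
rewrite /rot => am; case: ifPn => [h|/negPf //].
have := forallP h i => hi; have [ym|ym] := ltP (y ord0 i) m.
  by rewrite rectb_shift //; apply/andP; split; lra.
by rewrite shiftN rectb_shift //; apply/andP; split; lra.
Qed.

(** After the exchange the piece of length [b - m] comes first, so the cut lies at [a + b - m]. *)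
Lemma rotK i a b m : a ord0 i <= m <= b ord0 i ->
  cancel (rot i a b m) (rot i a b (a ord0 i + b ord0 i - m)).
Proof.
move=> am y; rewrite {1}/rot rot_rectb // /rot; have [h|//] := boolP (rectb a b y).
have := forallP h i => hi; have [ym|ym] := ltP (y ord0 i) m.
  rewrite !mxE eqxx ltNge (_ : a ord0 i + b ord0 i - m <= _) /=; last lra.
  by apply/rowP => j; rewrite !mxE; case: eqP => [->|_]; lra.
rewrite !mxE eqxx (_ : _ - (m - a ord0 i) < _) /=; last lra.
by apply/rowP => j; rewrite !mxE; case: eqP => [->|_]; lra.
Qed.

Lemma rotK' i a b m : a ord0 i <= m <= b ord0 i ->
  cancel (rot i a b (a ord0 i + b ord0 i - m)) (rot i a b m).
Proof.
move=> am y; rewrite -[m in rot i a b m _](_ : a ord0 i + b ord0 i - (a ord0 i + b ord0 i - m) = m).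
  by rewrite rotK //; lra.
ring.
Qed.

Section InRec.
Variable M : set 'rV[R]_d.
Hypothesis mM : multirect M.

Lemma swap_pieces a b v : valid_rect a b -> disjoint_shift a b v ->
  (forall y, rectb a b y -> M y) -> (forall y, rectb a b y -> M (y + v)) ->
  pieces_of M (swap a b v) [:: (a, b, v); (a + v, b + v, - v)].
Proof.
move=> ab dj aM avM; split=> [p j|].
  by rewrite !inE => /orP[] /eqP -> /=; rewrite ?mxE ?lerD2r ltW.
split=> [p y|y].
  rewrite !inE => /orP[] /eqP -> /=; first exact: aM.
  by rewrite rectbB => /avM; rewrite subrK.
rewrite !big_cons big_nil /= addr0; have [h|h] := boolP (rectb a b y).
  rewrite swap_in // ifN ?addr0 // rectbB; apply/negP => h'.
  by have := dj _ h'; rewrite subrK => /(_ h).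
rewrite add0r; have [h'|h'] := boolP (rectb (a + v) (b + v) y); first exact: swap_in'.
by rewrite swap_out // addr0.
Qed.

Lemma inRec_swap a b v : valid_rect a b -> disjoint_shift a b v ->
  (forall y, rectb a b y -> M y) -> (forall y, rectb a b y -> M (y + v)) ->
  inRec M (swap a b v).
Proof.
move=> ab dj aM avM; have K := swapK dj.
have sM y : M y -> M (swap a b v y).
  move=> My; rewrite /swap; case: ifP => [/avM//|_].
  by case: ifP => // h; apply: aM; rewrite -rectbB.
exact: (inRec_pieces mM (swap_pieces ab dj aM avM) K K sM sM).
Qed.

Definition upd a i (x : R) : 'rV[R]_d := \row_j (if j == i then x else a ord0 j).

Lemma rectb_updr i a b x y : x <= b ord0 i ->
  rectb a (upd b i x) y = rectb a b y && (y ord0 i < x).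
Proof.
move=> xb; apply/forallP/andP => [h|[/forallP h yx] j].
  have := h i; rewrite mxE eqxx => /andP[hi ->]; split=> //.
  apply/forallP => j; have := h j; rewrite mxE; case: eqP => // -> /andP[-> /=].
  by move=> yx; apply: lt_le_trans xb.
by have := h j; rewrite mxE; case: eqP => // -> /andP[-> /=].
Qed.

Lemma rectb_updl i a b x y : a ord0 i <= x ->
  rectb (upd a i x) b y = rectb a b y && (x <= y ord0 i).
Proof.
move=> ax; apply/forallP/andP => [h|[/forallP h xy] j].
  have := h i; rewrite mxE eqxx => /andP[hi _]; split=> //.
  apply/forallP => j; have := h j; rewrite mxE; case: eqP => // -> /andP[xy ->].
  by rewrite (le_trans ax xy).
by have := h j; rewrite mxE; case: eqP => // -> /andP[_ ->]; rewrite xy.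
Qed.

Lemma rot_pieces i a b m : valid_rect a b -> a ord0 i <= m <= b ord0 i ->
  (forall y, rectb a b y -> M y) ->
  pieces_of M (rot i a b m) [:: (a, upd b i m, shift i (b ord0 i - m));
     (upd a i m, b, - shift i (m - a ord0 i))].
Proof.
move=> ab /andP[am mb] aM; split=> [p j|].
  rewrite !inE => /orP[] /eqP -> /=; rewrite mxE; case: eqP => [->|_] //; exact: ltW.
split=> [p y|y].
  by rewrite !inE => /orP[] /eqP -> //=; rewrite ?rectb_updr ?rectb_updl // => /andP[/aM].
rewrite !big_cons big_nil /= addr0 rectb_updr // rectb_updl // /rot.
by case: (rectb a b y); case: ltP; rewrite /= ?addr0 ?add0r.
Qed.

Lemma inRec_rot i a b m : valid_rect a b -> a ord0 i <= m <= b ord0 i ->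
  (forall y, rectb a b y -> M y) -> inRec M (rot i a b m).
Proof.
move=> ab am aM; have rM m' y : a ord0 i <= m' <= b ord0 i -> M y -> M (rot i a b m' y).
  move=> am' My; have [h|h] := boolP (rectb a b y); first by apply: aM; rewrite rot_rectb.
  by rewrite /rot (negPf h).
apply: inRec_pieces mM (rot_pieces ab am aM) (rotK am) (rotK' am) _ _ => y; apply: rM => //.
lra.
Qed.
End InRec.
End ElementaryMaps.

(** * Tensor invariants of swaps and rotations *)

Section ElementaryInvariant.
Variables (R : realType) (n : nat) (V : zmodType) (tv : ftens R n.+2 -> V).
Hypotheses (tvD : forall s s', tv (s ++ s') = tv s + tv s')
  (tvE : forall s s', tv s = tv s' <-> teq s s').
Variable M : set 'rV[R]_n.+1.
Hypothesis mM : multirect M.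
Implicit Types (a b v : 'rV[R]_n.+1) (i : 'I_n.+1) (x : n.+2.-tuple R).

Lemma Tmap_pieces f s i : inRec M f -> pieces_of M f s ->
  tv (Tmap M f i) = \sum_(p <- s) Phi tv i (p.2 ord0 i) (sides p.1.1 p.1.2).
Proof.
move=> rf fs; have [c [sub ac]] := adapted_pieces mM fs.
have [sv [sM fE]] := fs.
rewrite (Tmap_grid tvD tvE i rf ac) /grid_sum.
have Phi_mor t : {morph (fun u => Phi tv i u t) : u w / u + w} by move=> u w; rewrite (Phi_add tvD tvE).
have Phi0 t : Phi tv i 0 t = 0 by exact: (addmap0 (f := fun u => Phi tv i u t) (Phi_mor t)).
transitivity (\sum_(q : cell_index n.+1 c) \sum_(p <- s)
    (if rectb p.1.1 p.1.2 (clo q) then Phi tv i (p.2 ord0 i) (sides (clo q) (chi q)) else 0)).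
  apply: eq_bigr => q _; case: asboolP => Mq; last first.
    by rewrite big1_seq // => p /= ps; case: ifP => // /(sM _ _ ps).
  rewrite fE addrC addrA addNr add0r summxE.
  rewrite (big_morph (fun u => Phi tv i u (sides (clo q) (chi q))) (Phi_mor _) (Phi0 _)).
  by apply: eq_bigr => p _; case: ifP => // _; rewrite mxE Phi0.
rewrite exchange_big /=; apply: eq_big_seq => p ps.
have [e1 e2] := endpointsP (map_f fst ps).
rewrite (rect_expand (Phi_multiadditive tvD tvE i (p.2 ord0 i)) (in_cutsS sub e1) (in_cutsS sub e2)) //.
by move=> j; apply: sv.
Qed.

Lemma Tmap_swap a b v i : valid_rect a b -> disjoint_shift a b v ->
  (forall y, rectb a b y -> M y) -> (forall y, rectb a b y -> M (y + v)) ->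
  tv (Tmap M (swap a b v) i) = 0.
Proof.
move=> ab dj aM avM.
rewrite (Tmap_pieces i (inRec_swap mM ab dj aM avM) (swap_pieces ab dj aM avM)).
rewrite !big_cons big_nil /= addr0 -(_ : sides a b = sides (a + v) (b + v)).
  by rewrite -(Phi_add tvD tvE) !mxE subrr (addmap0 (f := fun u => Phi tv i u _)) // => u w;
    rewrite (Phi_add tvD tvE).
by apply: eq_from_tnth => j; rewrite !tnth_mktuple !mxE; ring.
Qed.

(* A shape lists the sides transverse to direction [i] (the one of index [n] in
   place of that of index [i]) and then the two lengths that the rotation exchanges. *)
Definition srow i x : 'rV[R]_n.+1 := \row_j tnth x (lift ord_max (swap_last i j)).
Definition slast x : R := tnth x ord_max.
Definition sprev : 'I_n.+2 := lift ord_max (ord_max : 'I_n.+1).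
Definition shi i a x := a + srow i x + shift i (slast x).
Definition srot i a x := rot i a (shi i a x) (a ord0 i + srow i x ord0 i).
Definition xswap x : n.+2.-tuple R := tset (tset x sprev (slast x)) ord_max (tnth x sprev).

Lemma srow_i i x : srow i x ord0 i = tnth x sprev.
Proof. by rewrite mxE /swap_last eqxx. Qed.

Lemma shiE i a x j : shi i a x ord0 j
  = a ord0 j + tnth x (lift ord_max (swap_last i j)) + (if j == i then slast x else 0).
Proof. by rewrite !mxE. Qed.

Lemma swapt_srow i a x :
  rcons_tuple (swapt i (sides a (a + srow i x))) (slast x) = x.
Proof.
apply: eq_from_tnth => k; rewrite tnth_rcons_tuple.
case: unliftP => [j ->|->//]; rewrite !tnth_mktuple !mxE swap_lastK; ring.
Qed.

Definition spos x := forall k, 0 < tnth x k.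

Lemma shi_valid i a x : spos x -> valid_rect a (shi i a x).
Proof.
move=> x0 j; rewrite shiE; have := x0 (lift ord_max (swap_last i j)).
by have := x0 ord_max; rewrite -/(slast x); case: eqP => _; lra.
Qed.

Lemma srot_mid i a x : spos x -> a ord0 i <= a ord0 i + srow i x ord0 i <= shi i a x ord0 i.
Proof.
move=> x0; rewrite shiE srow_i /swap_last !eqxx.
by have := (x0 ord_max, x0 sprev); rewrite -/(slast x) -/sprev => -[]; lra.
Qed.

Lemma inRec_srot i a x : spos x -> (forall y, rectb a (shi i a x) y -> M y) ->
  inRec M (srot i a x).
Proof. by move=> x0; apply: inRec_rot => //; [exact: shi_valid|exact: srot_mid]. Qed.

(** The lower piece, of length [tnth x sprev], moves up by [slast x] and gives x; the upper one, of
    length [slast x], moves down by [tnth x sprev] and gives minus [xswap x]. *)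
Lemma Tmap_srot i j a x : spos x -> (forall y, rectb a (shi i a x) y -> M y) ->
  tv (Tmap M (srot i a x) j) = if j == i then tv [:: (1, x)] - tv [:: (1, xswap x)] else 0.
Proof.
move=> x0 aM; have ab := shi_valid i a x0; have am := srot_mid i a x0.
rewrite (Tmap_pieces j (inRec_srot x0 aM) (rot_pieces ab am aM)).
rewrite !big_cons big_nil /= addr0.
have Phi0 t : Phi tv j 0 t = 0.
  by apply: (addmap0 (f := fun u => Phi tv j u t)) => u w; rewrite (Phi_add tvD tvE).
case: eqP => [->|/eqP ji]; last first.
  by rewrite !mxE (negPf ji) oppr0 !Phi0 addr0.
have PhiN u t : Phi tv i (- u) t = - Phi tv i u t.
  by apply: (addmapN (f := fun u => Phi tv i u t)) => ? ?; rewrite (Phi_add tvD tvE).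
have -> : (- shift i (a ord0 i + srow i x ord0 i - a ord0 i)) ord0 i = - tnth x sprev.
  by rewrite -(srow_i i) !mxE eqxx; ring.
rewrite PhiN; congr (_ - _); rewrite /Phi; congr (tv [:: (1, _)]).
  rewrite -[RHS](swapt_srow i a); congr rcons_tuple; last first.
    by rewrite !mxE eqxx; ring.
  congr swapt; apply: eq_from_tnth => k; rewrite !tnth_mktuple !mxE.
  by case: eqP => [->|_]; ring.
rewrite -[RHS](swapt_srow i a); congr rcons_tuple; last first.
  by rewrite /slast tnth_tset eqxx.
congr swapt; apply: eq_from_tnth => k; rewrite !tnth_mktuple !mxE /xswap.
rewrite !tnth_tset (negPf (_ : lift _ _ != ord_max)); last by rewrite eq_sym neq_lift.
rewrite (inj_eq lift_inj) /swap_last; case: (eqVneq k i) => [->|ki].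
  by rewrite !eqxx; ring.
case: (eqVneq k ord_max) => [km|km]; last by rewrite (negPf km); ring.
by rewrite -km eq_sym (negPf ki); ring.
Qed.
End ElementaryInvariant.

(** * The abelianization *)

Section Abelianization.
Variables (R : realType) (d : nat) (M : set 'rV[R]_d).
Hypothesis mM : multirect M.
Implicit Types (f g h k : 'rV[R]_d -> 'rV[R]_d).

Lemma inRec_id : inRec M id.
Proof.
apply: (inRec_pieces (f := id) (f' := id) (s := [::]) mM) => //.
by split=> //; split=> // y; rewrite big_nil addr0.
Qed.

Lemma inRec_inv f : inRec M f ->
  exists f', [/\ inRec M f', cancel f f' & cancel f' f].
Proof.
move=> rf; have [f' [fK f'K f'M f'id]] := inRec_can rf; exists f'; split=> //.
have [c ac] := inRec_adapted rf; have [bM e] := ac.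
have [vs vsP] := adapted_values ac.
pose zs := [seq (v : 'rV[R]_d) ord0 j | v <- vs, j <- enum 'I_d].
(* The grid of f is pushed forward by all its displacements. *)
pose c' := c ++ [seq x + t | x <- c, t <- zs].
have [fid fM _ _ _] := rf.
apply: (inRecI (c := c') _ f'K fK f'id f'M fM); split.
  by apply: bounded_byS bM => x xc; rewrite mem_cat xc.
move=> y z yz My; pose v := f (f' y) - f' y.
have yE : f' y = y - v by rewrite /v f'K opprB addrC subrK.
have yzv : eqc c (y - v) (z - v).
  move=> x j xc; have mem : x + v ord0 j \in c'.
    rewrite mem_cat; apply/orP; right; apply: allpairs_f => //.
    by apply: allpairs_f; rewrite ?mem_enum // vsP //; apply: f'M.
  by rewrite ![(_ - v) _ _]mxE ![(- v) _ _]mxE !lerBrDr yz.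
have My' : M (y - v) by rewrite -yE; apply: f'M.
have [Mz' E] := e _ _ yzv My'.
have fz : f (z - v) = z.
  by rewrite -[LHS](subrK (z - v)) E -yE -/v addrC subrK.
have -> : f' z = z - v by rewrite -[in LHS]fz fK.
split; first by rewrite -fz; apply: fM.
by rewrite yE ![_ - v]addrC !addrK.
Qed.

Lemma derived_comp f g : derived M f -> derived M g -> derived M (f \o g).
Proof. by move=> df; elim=> [//|g1 g' h h' k rg rh ? ? ? ? _ IH]; apply: der_mul IH. Qed.

Lemma derived_comm g g' h h' : inRec M g -> inRec M h -> cancel g g' -> cancel g' g ->
  cancel h h' -> cancel h' h -> derived M (g' \o h' \o g \o h).
Proof. by move=> rg rh gK g'K hK h'K; exact: (der_mul rg rh gK g'K hK h'K (der_id M)). Qed.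

Lemma inRec_cancel g g' : inRec M g -> cancel g g' -> inRec M g'.
Proof.
move=> rg gK; have [g1 [rg1 gK1 g1K]] := inRec_inv rg.
by have -> : g' = g1 by apply/funext => y; rewrite -[y in g' y]g1K gK.
Qed.

Lemma derived_inRec f : derived M f -> inRec M f.
Proof.
elim=> [|g g' h h' k rg rh gK g'K hK h'K _ rk]; first exact: inRec_id.
apply: inRec_comp rk _; do 2!apply: inRec_comp => //.
by apply: inRec_comp; [exact: inRec_cancel gK|exact: inRec_cancel hK].
Qed.

Lemma derived_inv f : derived M f ->
  exists f', [/\ derived M f', cancel f f' & cancel f' f].
Proof.
elim=> [|g g' h h' k rg rh gK g'K hK h'K _ [k' [dk' kK k'K]]].
  by exists id; split=> //; apply: der_id.
exists ((h' \o g' \o h \o g) \o k'); split.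
- by apply: derived_comp dk'; apply: derived_comm.
- by move=> y /=; rewrite kK g'K h'K gK hK.
- by move=> y /=; rewrite h'K g'K hK gK k'K.
Qed.

(** The conjugate is k times the commutator [k' \o f' \o k \o f], which is the shape of
    [der_mul]. *)
Lemma derived_conj f f' k : inRec M f -> cancel f f' -> cancel f' f -> derived M k ->
  derived M (f' \o k \o f).
Proof.
move=> rf fK f'K dk; have [k' [_ kK k'K]] := derived_inv dk.
have := der_mul (derived_inRec dk) rf kK k'K fK f'K dk.
by congr (derived M _); apply/funext => y /=; rewrite k'K.
Qed.

(** Exchanges are identified when they differ by a derived left factor; [derived_conj] makes this
    compatible with composition. Maps that are not exchanges get the default class 0. *)
Lemma abelianization : exists (A : zmodType) (cl : ('rV[R]_d -> 'rV[R]_d) -> A),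
  (forall f g, inRec M f -> inRec M g -> cl (f \o g) = cl f + cl g) /\
  (forall f, inRec M f -> (cl f = 0 <-> derived M f)).
Proof.
pose T := {classic {f | inRec M f}}.
have /choice[iv ivP] : forall f : T, exists f' : T, cancel (sval f) (sval f') /\ cancel (sval f') (sval f).
  by move=> [f rf]; have [f' [rf' fK f'K]] := inRec_inv rf; exists (exist _ f' rf').
pose op (f g : T) : T := exist _ (sval f \o sval g) (inRec_comp (svalP f) (svalP g)).
pose e : T := exist _ id inRec_id.
pose E (f g : T) := exists2 k, derived M k & sval f = k \o sval g.
have [] := @quotient_zmod T op iv e E.
- by move=> f; exists id => //; apply: der_id.
- move=> f g [k dk fE]; have [k' [dk' kK _]] := derived_inv dk.
  by exists k' => //; apply/funext => y; rewrite fE /= kK.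
- move=> f g h [k dk fE] [l dl gE]; exists (k \o l); first exact: derived_comp.
  by rewrite fE gE.
- move=> x x' y y' [k dk xE] [l dl yE]; have [K K'] := ivP x'.
  exists (k \o (sval x' \o l \o sval (iv x'))).
    by apply: derived_comp => //; apply: (derived_conj (svalP (iv x')) K' K).
  by apply/funext => z /=; rewrite xE yE /= K.
- by move=> x y z; exists id => //; apply: der_id.
- move=> x y; have [xK xK'] := ivP x; have [yK yK'] := ivP y.
  exists (sval x \o sval y \o sval (iv x) \o sval (iv y)).
    exact: (derived_comm (svalP (iv x)) (svalP (iv y)) xK' xK yK' yK).
  by apply/funext => z /=; rewrite yK xK.
- by move=> x; exists id => //; apply: der_id.
- move=> x; have [xK xK'] := ivP x; exists id; first exact: der_id.
  by apply/funext => z /=; rewrite xK.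
move=> A [F [FD FE]].
exists A, (fun f => if pselect (inRec M f) is left rf then F (exist _ f rf) else 0).
have opE f g (rf : inRec M f) (rg : inRec M g) (rfg : inRec M (f \o g)) :
    op (exist _ f rf) (exist _ g rg) = exist _ (f \o g) rfg.
  by rewrite /op; congr exist; apply: Prop_irrelevance.
split=> [f g rf rg|f rf].
  case: pselect => [rfg|/(_ (inRec_comp rf rg))//].
  case: pselect => [rf'|/(_ rf)//]; case: pselect => [rg'|/(_ rg)//].
  by rewrite -FD opE.
case: pselect => [rf'|/(_ rf)//].
have F0 : F e = 0.
  apply: (addrI (F e)); rewrite -FD addr0; apply/FE.
  by exists id => //; apply: der_id.
rewrite -F0 FE; split=> [[k dk /= ->]|df]; first by [].
by exists f.
Qed.
End Abelianization.

(** * A swap is a commutator *)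

Section SwapCommutator.
Variables (R : realType) (d : nat).
Implicit Types (a b y z v w : 'rV[R]_d) (i : 'I_d).

(* Swapping [a, b) with its translate by v is the commutator of the map that
   swaps their lower halves and of the map that exchanges the two halves of each. *)
Lemma swap_commutator i a b v : valid_rect a b -> disjoint_shift a b v ->
  let b' := upd b i ((a ord0 i + b ord0 i) / 2) in
  let w := shift i ((b ord0 i - a ord0 i) / 2) in
  let t := swap a b' v in
  let s1 := swap a b' w in
  let s2 := swap (a + v) (b' + v) w in
  [/\ forall y, rectb a b' y -> rectb a b y /\ rectb a b (y + w),
      valid_rect a b', disjoint_shift a b' v, disjoint_shift a b' w &
      swap a b v = t \o (s2 \o s1) \o t \o (s1 \o s2)].
Proof.
move=> ab dj b' w t s1 s2; have abi := ab i.
set m := (a ord0 i + b ord0 i) / 2.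
have mb : m <= b ord0 i by rewrite /m; lra.
have pE y : rectb a b' y = rectb a b y && (y ord0 i < m) by apply: rectb_updr.
have rw y : rectb a b' y -> rectb a b y /\ rectb a b (y + w).
  rewrite pE => /andP[h ym]; split=> //; rewrite rectb_shift //.
  by have := forallP h i; move: ym; rewrite /m; lra.
have rpE y : rectb a b y = rectb a b' y || rectb a b' (y - w).
  have [h|h] := boolP (rectb a b y); last first.
    symmetry; apply/negbTE; rewrite negb_or; apply/andP; split; apply: contra h.
      by move=> /rw[].
    by move=> /rw[]; rewrite subrK.
  rewrite !pE h /=; case: ltP => //= ym; rewrite /w shiftN rectb_shift //.
  have := forallP h i; rewrite !mxE eqxx => hi; move: ym; rewrite /m => ym; lra.
have djb : disjoint_shift a b' v by move=> y /rw[h _] /rw[h' _]; apply: dj h h'.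
have djw : disjoint_shift a b' w.
  by move=> y; rewrite !pE => /andP[/forallP/(_ i) h _] /andP[_]; rewrite !mxE eqxx /m; lra.
split=> //.
  by move=> j; rewrite mxE; case: eqP => // ->; rewrite /m; lra.
clear pE; clearbody b' w.
(* The two boxes consist of four pieces, the translates of [a, b') by 0, w, v and w + v. N1 to N7
   keep them apart, after which t, s1 and s2 are tabulated on each. *)
have N1 z : rectb a b' z -> ~~ rectb a b' (z + w) by move=> h; apply/negP => /(djw _ h).
have N2 z : rectb a b' z -> ~~ rectb a b' (z + v) by move=> h; apply/negP => /(djb _ h).
have N3 z : rectb a b' z -> ~~ rectb a b' (z + v - w).
  move=> /rw[h _]; apply/negP => /rw[_]; rewrite subrK; exact: (dj _ h).
have N4 z : rectb a b' z -> ~~ rectb a b' (z + w + v).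
  by move=> /rw[_ h]; apply/negP => /rw[h' _]; apply: dj h h'.
have N5 z : rectb a b' z -> ~~ rectb a b' (z - v).
  by move=> h; apply/negP => h'; apply: (djb _ h'); rewrite subrK.
have N6 z : rectb a b' z -> ~~ rectb a b' (z - w - v).
  move=> /rw[h _]; apply/negP => /rw[_]; rewrite addrAC subrK => h'.
  by apply: (dj _ h'); rewrite subrK.
have N7 z : rectb a b' z -> ~~ rectb a b' (z + w - v).
  move=> /rw[_ h]; apply/negP => /rw[h' _].
  by apply: (dj _ h'); rewrite subrK.
have t1 z : rectb a b' z -> t z = z + v by apply: swap_in.
have t2 z : rectb a b' z -> t (z + v) = z.
  by move=> h; rewrite /t swap_in' ?rectbD ?addrK.
have t3 z : rectb a b' z -> t (z + w) = z + w.
  by move=> h; rewrite /t swap_out //; [exact: N1|rewrite rectbB; exact: N7].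
have t4 z : rectb a b' z -> t (z + w + v) = z + w + v.
  by move=> h; rewrite /t swap_out //; [exact: N4|rewrite rectbB addrK; exact: N1].
have s11 z : rectb a b' z -> s1 z = z + w by apply: swap_in.
have s12 z : rectb a b' z -> s1 (z + w) = z.
  by move=> h; rewrite /s1 swap_in' ?rectbD ?addrK.
have s13 z : rectb a b' z -> s1 (z + v) = z + v.
  by move=> h; rewrite /s1 swap_out //; [exact: N2|rewrite rectbB; exact: N3].
have s14 z : rectb a b' z -> s1 (z + w + v) = z + w + v.
  by move=> h; rewrite /s1 swap_out //; [exact: N4|rewrite rectbB addrAC addrK; exact: N2].
have s21 z : rectb a b' z -> s2 z = z.
  by move=> h; rewrite /s2 swap_out // !rectbB ?(N5 z) ?N6.
have s22 z : rectb a b' z -> s2 (z + w) = z + w.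
  by move=> h; rewrite /s2 swap_out // !rectbB; [rewrite N7|rewrite addrK N5].
have s23 z : rectb a b' z -> s2 (z + v) = z + w + v.
  by move=> h; rewrite /s2 swap_in ?rectbD // addrAC.
have djw2 : disjoint_shift (a + v) (b' + v) w.
  by move=> y; rewrite !rectbB addrAC; apply: djw.
have s24 z : rectb a b' z -> s2 (z + w + v) = z + v.
  by move=> h; rewrite /s2 addrAC swap_in' ?addrK // !rectbD.
apply/funext => y /=.
have [h1|h1] := boolP (rectb a b' y).
  by rewrite (s21 _ h1) (s11 _ h1) (t3 _ h1) (s12 _ h1) (s21 _ h1) (t1 _ h1) swap_in //; case: (rw _ h1).
have [h2|h2] := boolP (rectb a b' (y - w)).
  rewrite -[y](subrK w); move: (y - w) h2 => z h2.
  by rewrite (s22 _ h2) (s12 _ h2) (t1 _ h2) (s13 _ h2) (s23 _ h2) (t4 _ h2) swap_in //; case: (rw _ h2).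
have rN : ~~ rectb a b y by rewrite rpE negb_or h1.
have [h3|h3] := boolP (rectb a b' (y - v)).
  rewrite -[y](subrK v); move: (y - v) h3 => z h3.
  rewrite (s23 _ h3) (s14 _ h3) (t4 _ h3) (s14 _ h3) (s24 _ h3) (t2 _ h3) swap_in' ?addrK // rectbD.
  by case: (rw _ h3).
have [h4|h4] := boolP (rectb a b' (y - v - w)).
  have -> : y = (y - v - w) + w + v by rewrite !subrK.
  move: (y - v - w) h4 => z h4.
  rewrite (s24 _ h4) (s13 _ h4) (t2 _ h4) (s11 _ h4) (s22 _ h4) (t3 _ h4) swap_in' ?addrK // rectbD.
  by case: (rw _ h4).
have s2y : s2 y = y by rewrite /s2 swap_out // !rectbB // addrAC.
have s1y : s1 y = y by rewrite /s1 swap_out // rectbB.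
have ty : t y = y by rewrite /t swap_out // rectbB.
by rewrite s2y s1y ty s1y s2y ty swap_out // rectbB rpE negb_or h3.
Qed.
End SwapCommutator.

Section DerivedSwap.
Variables (R : realType) (n : nat) (M : set 'rV[R]_n.+1).
Hypothesis mM : multirect M.
Implicit Types (a b y z v w : 'rV[R]_n.+1) (i j k : 'I_n.+1).

Lemma derived_swap a b v : valid_rect a b -> disjoint_shift a b v ->
  (forall y, rectb a b y -> M y) -> (forall y, rectb a b y -> M (y + v)) ->
  derived M (swap a b v).
Proof.
move=> ab dj aM avM; have [] := swap_commutator ord0 ab dj.
move: (upd _ _ _) (shift _ _) => b' w rw ab' djv djw ->.
have djw2 : disjoint_shift (a + v) (b' + v) w.
  by move=> y; rewrite !rectbB addrAC; apply: djw.
have r1 : inRec M (swap a b' w).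
  by apply: inRec_swap => // y /rw[/aM h /aM h'].
have r2 : inRec M (swap (a + v) (b' + v) w).
  apply: inRec_swap => // [j|y|y]; first by rewrite !mxE ltrD2r.
    by rewrite rectbB => /rw[/avM]; rewrite subrK.
  by rewrite rectbB => /rw[_ /avM]; rewrite addrAC subrK.
have rt : inRec M (swap a b' v).
  by apply: inRec_swap => // y /rw[? _]; auto.
apply: (derived_comm rt (inRec_comp r1 r2) (swapK djv) (swapK djv)).
  by apply: can_comp; apply: swapK.
by apply: can_comp; apply: swapK.
Qed.

Lemma rot_translate i a b m v y :
  rot i (a + v) (b + v) (m + v ord0 i) (y + v) = rot i a b m y + v.
Proof.
rewrite /rot rectbD; case: ifP => // _; rewrite !mxE ltrD2r.
case: ifP => _; apply/rowP => j; rewrite !mxE; case: eqP => _; ring.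
Qed.

Lemma swap_rot i a b m v : valid_rect a b -> a ord0 i <= m <= b ord0 i ->
  disjoint_shift a b v ->
  swap a b v \o rot i a b m = rot i (a + v) (b + v) (m + v ord0 i) \o swap a b v.
Proof.
move=> ab am dj; apply/funext => y /=; have [h|h] := boolP (rectb a b y).
  by rewrite !swap_in ?rot_rectb // rot_translate.
rewrite {1}/rot (negPf h); have [h'|h'] := boolP (rectb (a + v) (b + v) y).
  rewrite swap_in' //; have hy : rectb a b (y - v) by rewrite -rectbB.
  rewrite /rot ifN // rectbB; apply/negP => h2; apply: (dj _ h2).
  by rewrite subrK.
by rewrite swap_out // /rot ifN.
Qed.

Lemma rot_cut_side i k a b m u : k != i -> a ord0 k <= u <= b ord0 k ->
  rot i a b m = rot i a (upd b k u) m \o rot i (upd a k u) b m.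
Proof.
move=> ki /andP[au ub]; have ik : i != k by rewrite eq_sym.
apply/funext => y /=; have [h|h] := boolP (rectb a b y); last first.
  by rewrite [rot i (upd a k u) b m y]/rot rectb_updl // (negPf h) /rot /= rectb_updr // (negPf h).
have [uy|yu] := leP u (y ord0 k); last first.
  rewrite [rot i (upd a k u) b m y]/rot rectb_updl // leNgt yu andbF.
  by rewrite /rot rectb_updr // h yu /= mxE (negPf ik).
have -> : rot i (upd a k u) b m y = rot i a b m y.
  by rewrite /rot rectb_updl // h uy /= mxE (negPf ik).
have zk : u <= rot i a b m y ord0 k.
  by rewrite /rot h; case: ifP => _; rewrite !mxE (negPf ki) ?oppr0 addr0.
by rewrite [RHS]/rot rectb_updr // [_ < u]ltNge zk andbF.
Qed.

(** The upper block [q, b) passes the lower block in two stages: first below [p, q), which brings it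
    to [p, p + b - q), then below [a, p). *)
Lemma rot_cut_length i a b p q : a ord0 i <= p -> p <= q -> q <= b ord0 i ->
  rot i a b q = rot i a (upd b i (p + b ord0 i - q)) p \o rot i (upd a i p) b q.
Proof.
move=> ap pq qb; have le : p + b ord0 i - q <= b ord0 i by lra.
apply/funext => y /=; have [h|h] := boolP (rectb a b y); last first.
  by rewrite [rot i (upd a i p) b q y]/rot rectb_updl // (negPf h) /rot /= rectb_updr // (negPf h).
have /andP[ay yb] := forallP h i.
have [py|yp] := leP p (y ord0 i); last first.
  rewrite [rot i (upd a i p) b q y]/rot rectb_updl // leNgt yp andbF.
  rewrite /rot rectb_updr // h (lt_le_trans yp pq) mxE eqxx yp (lt_le_trans yp) /=; last lra.
  by congr (_ + shift _ _); ring.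
rewrite [rot i (upd a i p) b q y]/rot rectb_updl // h py /= mxE eqxx.
have [yq|qy] := ltP (y ord0 i) q.
  rewrite /rot h yq rectb_updr // ifN // negb_and -leNgt orbC !mxE eqxx.
  by apply/orP; left; lra.
have nq : (y ord0 i < q) = false by rewrite ltNge qy.
rewrite /rot h nq rectb_updr // !shiftN rectb_shift // !mxE eqxx.
rewrite ifT; last by apply/andP; split; [apply/andP; split|]; lra.
rewrite ltNge (_ : p <= _) /=; last lra.
by apply/rowP => j; rewrite !mxE; case: eqP => _; ring.
Qed.
End DerivedSwap.

(** * Generation by swaps and small rotations *)

Section Generators.
Variables (R : realType) (d : nat) (M : set 'rV[R]_d) (eps : R).
Hypothesis mM : multirect M.
Implicit Types (a b y z v : 'rV[R]_d) (f g h : 'rV[R]_d -> 'rV[R]_d) (i j : 'I_d).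

(** Rotations are small so that their class can be computed by [phi_base]; swaps of every size are
    commutators. *)
Inductive generated : ('rV[R]_d -> 'rV[R]_d) -> Prop :=
  | gen_id : generated id
  | gen_swap a b v f : valid_rect a b -> disjoint_shift a b v ->
      (forall y, rectb a b y -> M y) -> (forall y, rectb a b y -> M (y + v)) ->
      generated f -> generated (swap a b v \o f)
  | gen_rot i a b m f : valid_rect a b -> a ord0 i < m < b ord0 i ->
      (forall y, rectb a b y -> M y) -> (forall j, b ord0 j - a ord0 j <= eps) ->
      generated f -> generated (rot i a b m \o f).

Lemma generated_comp f g : generated f -> generated g -> generated (f \o g).
Proof.
move=> gf gg; elim: gf => [//|a b v h ab dj aM avM _ IH|i a b m h ab am aM le _ IH].
  exact: (gen_swap ab dj aM avM IH).
exact: (gen_rot ab am aM le IH).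
Qed.

Lemma generated_swap a b v : valid_rect a b -> disjoint_shift a b v ->
  (forall y, rectb a b y -> M y) -> (forall y, rectb a b y -> M (y + v)) ->
  generated (swap a b v).
Proof. by move=> ab dj aM avM; exact: (gen_swap ab dj aM avM gen_id). Qed.

Lemma generated_rot i a b m : valid_rect a b -> a ord0 i < m < b ord0 i ->
  (forall y, rectb a b y -> M y) -> (forall j, b ord0 j - a ord0 j <= eps) ->
  generated (rot i a b m).
Proof. by move=> ab am aM le; exact: (gen_rot ab am aM le gen_id). Qed.

Lemma generated_inRec f : generated f -> inRec M f.
Proof.
elim=> [|a b v h ab dj aM avM _ IH|i a b m h ab /andP[am mb] aM le _ IH].
- exact: inRec_id.
- by apply: inRec_comp IH; apply: inRec_swap.
- by apply: inRec_comp IH; apply: inRec_rot => //; rewrite !ltW.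
Qed.

Lemma generated_inv f : generated f ->
  exists f', [/\ generated f', cancel f f' & cancel f' f].
Proof.
elim=> [|a b v h ab dj aM avM _ [h' [gh hK h'K]]|i a b m h ab am aM le _ [h' [gh hK h'K]]].
- by exists id; split=> //; apply: gen_id.
- exists (h' \o swap a b v); split.
  + by apply: generated_comp gh _; apply: generated_swap.
  + by apply: can_comp hK; apply: swapK.
  + by apply: can_comp h'K _; apply: swapK.
- have am' : a ord0 i <= m <= b ord0 i by case/andP: am => ? ?; rewrite !ltW.
  exists (h' \o rot i a b (a ord0 i + b ord0 i - m)); split.
  + by apply: generated_comp gh _; apply: generated_rot => //; lra.
  + by apply: can_comp (rotK am') hK.
  + by apply: can_comp h'K (rotK' am').
Qed.

(** The cells are permuted by f, and the permutation is sorted by swaps, with induction on the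
    number of cells that move. *)
Lemma generated_cells c f : bounded_by c M ->
  (forall y z, eqc c y z -> M y -> M z) -> inRec M f ->
  (forall q : cell_index d c, M (clo q) -> exists q' : cell_index d c,
     chi q' - clo q' = chi q - clo q /\
     forall y, rectb (clo q) (chi q) y -> f y = y + (clo q' - clo q)) ->
  generated f.
Proof.
move=> bM eM; pose moved g := #|[set q : cell_index d c | `[< M (clo q) >] && (g (clo q) != clo q)]|.
have [k] := ubnP (moved f); elim: k f => // k IH f; rewrite ltnS => mk rf fP.
have [/existsP[q /andP[/asboolP Mq fq]]|/existsPn fixed] :=
  boolP [exists q : cell_index d c, `[< M (clo q) >] && (f (clo q) != clo q)]; last first.
  have -> : f = id; last exact: gen_id.
  apply/funext => y; have [My|nMy] := pselect (M y); last by case: rf => ->.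
  have [a [b [ac bc yab]]] := bM y My; have [q yq] := cell_of ac bc yab.
  have Mq := eM _ _ (cell_eqc yq (clo_in_cell q)) My.
  have [q' [_ fE]] := fP q Mq; have := fixed q; rewrite asboolT //= negbK.
  rewrite fE ?clo_in_cell // addrC subrK => /eqP E.
  by rewrite fE // E subrr addr0.
have [q' [sE fE]] := fP q Mq; pose v := clo q' - clo q.
have loE : clo q + v = clo q' by rewrite /v addrC subrK.
have hiE : chi q + v = chi q'.
  by rewrite -[chi q](subrK (clo q)) -sE -addrA loE subrK.
have qq' : q != q'.
  by apply: contraNneq fq => qE; rewrite fE ?clo_in_cell // -qE subrr addr0.
have in_q' y : rectb (clo q') (chi q') (y + v) = rectb (clo q) (chi q) y.
  by rewrite -loE -hiE rectbD.
have dj : disjoint_shift (clo q) (chi q) v.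
  move=> y h h'; move: qq'; rewrite (cell_uniq (c := c) (g := q) (g' := q') (y := y + v)) ?eqxx //.
  by rewrite in_q'.
have ab : valid_rect (clo q) (chi q) by move=> j; rewrite !mxE pt_lt_cell.
have qM y : rectb (clo q) (chi q) y -> M y.
  by move=> yq; apply: eM (cell_eqc (clo_in_cell q) yq) Mq.
have qvM y : rectb (clo q) (chi q) y -> M (y + v).
  by move=> yq; rewrite -fE //; case: rf => _ fM _ _ _; apply/fM/qM.
set t := swap (clo q) (chi q) v.
have gt : generated t by apply: generated_swap.
(* The map [t \o f] fixes q, and it still fixes every cell that f fixes: by injectivity of f such a
   cell is neither q nor q'. *)
have -> : f = t \o (t \o f) by apply/funext => y /=; rewrite [t (t _)]swapK.
apply: generated_comp (gt) _; have [_ _ finj _ _] := rf.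
have tq y : rectb (clo q) (chi q) y -> t y = y + (clo q' - clo q) by apply: swap_in.
have tq' y : rectb (clo q') (chi q') y -> t y = y + (clo q - clo q').
  by rewrite -{1}loE -{1}hiE => h; rewrite /t swap_in' // /v opprB.
have tout q1 y : q1 != q -> q1 != q' -> rectb (clo q1) (chi q1) y -> t y = y.
  move=> n1 n2 h; rewrite /t swap_out ?loE ?hiE //.
    by apply: contra n1 => h'; apply/eqP/(cell_uniq h h').
  by apply: contra n2 => h'; apply/eqP/(cell_uniq h h').
apply: IH.
- apply: leq_trans mk; apply: proper_card; apply/properP; split.
    apply/fintype.subsetP => q1; rewrite !inE => /andP[Mq1 tfq1]; rewrite Mq1 /=.
    apply: contraNneq tfq1 => fq1; rewrite /= fq1; apply/eqP.
    apply: (tout q1); [| |exact: clo_in_cell].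
      by apply: contraNneq fq => <-; rewrite fq1.
    apply: contraNneq qq' => q1E; apply/eqP; apply: (cell_uniq (clo_in_cell q)).
    have fqE : f (clo q) = f (clo q').
      by rewrite fE ?clo_in_cell // -/v loE -[in RHS]q1E fq1 q1E.
    rewrite (finj _ _ Mq _ fqE) ?clo_in_cell //.
    by rewrite -q1E; apply/asboolP.
  exists q; first by rewrite inE fq asboolT.
  rewrite !inE asboolT //= negbK fE ?clo_in_cell // -/v loE.
  by rewrite tq' ?clo_in_cell // addrC subrK.
- exact: inRec_comp (generated_inRec gt) rf.
- move=> q1 Mq1; have [q1' [s1E f1E]] := fP q1 Mq1.
  have f1in y : rectb (clo q1) (chi q1) y -> rectb (clo q1') (chi q1') (f y).
    move=> h; rewrite f1E //.
    have -> : chi q1' = chi q1 + (clo q1' - clo q1).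
      by rewrite -[LHS](subrK (clo q1')) s1E addrA addrAC [_ + clo q1']addrC addrA.
    by rewrite -{1}(subrK (clo q1) (clo q1')) [_ + clo q1]addrC rectbD.
  have [E|n1] := eqVneq q1' q.
    exists q'; rewrite sE -E s1E; split=> // y h /=; rewrite tq ?f1E -?E ?f1in //.
    + by rewrite -addrA; congr (_ + _); rewrite addrC addrA subrK.
    + by rewrite -f1E // f1in.
  have [E|n2] := eqVneq q1' q'.
    exists q; rewrite -s1E E sE; split=> // y h /=; rewrite tq' ?f1E -?E ?f1in //.
    + by rewrite -addrA; congr (_ + _); rewrite addrC addrA subrK.
    + by rewrite -f1E // f1in.
  exists q1'; split=> // y h /=; rewrite (tout q1') //; [exact: f1E|exact: f1in].
Qed.
End Generators.

Lemma cat_cons_cases (T : Type) (u1 u2 w1 w2 : seq T) q x :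
  u1 ++ q :: u2 = w1 ++ x :: w2 ->
  [\/ exists w, w1 = u1 ++ q :: w /\ u2 = w ++ x :: w2,
      [/\ u1 = w1, q = x & u2 = w2]
    | exists w, u1 = w1 ++ x :: w /\ w2 = w ++ q :: u2].
Proof.
elim: u1 w1 => [|p u1 IH] [|p' w1] /= [].
- by move=> -> ->; constructor 2.
- by move=> -> ->; constructor 1; exists w1.
- by move=> -> <-; constructor 3; exists u1.
- move=> -> /IH[[w [-> ->]]|[-> -> ->]|[w [-> ->]]].
  + by constructor 1; exists w.
  + by constructor 2.
  + by constructor 3; exists w.
Qed.

(** * Rearranging the slices of a box by small rotations *)

Section Rearrangement.
Variables (R : realType) (d : nat) (M : set 'rV[R]_d) (eps : R).
Hypothesis mM : multirect M.
Variables (T : finType) (len : T -> R).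
Hypothesis len_gt0 : forall q, 0 < len q.
Implicit Types (a b y z : 'rV[R]_d) (i j : 'I_d) (u v w : seq T).
Implicit Types (G : 'rV[R]_d -> 'rV[R]_d).

Local Notation wl := (wlen len).

Definition supported a b G := (forall y, ~~ rectb a b y -> G y = y) /\
  (forall y, rectb a b y -> rectb a b (G y)).

(* In direction [i] the box [a, b) is sliced according to the word [u]; [G] moves
   each slice to the place of a slice with the same letter in the word [v]. *)
Definition moves_slices a b G i u v := forall u1 q u2, u = u1 ++ q :: u2 ->
  exists v1 v2, v = v1 ++ q :: v2 /\
  forall y, rectb a b y -> a ord0 i + wl u1 <= y ord0 i < a ord0 i + wl u1 + len q ->
    G y ord0 i = y ord0 i - wl u1 + wl v1.

Lemma supported_comp a b G G' : supported a b G -> supported a b G' -> supported a b (G \o G').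
Proof.
move=> [G1 G2] [G1' G2']; split=> y h /=; last by apply/G2/G2'.
by rewrite G1' // G1.
Qed.

Lemma supported_sub a b a' b' G : (forall y, rectb a' b' y -> rectb a b y) ->
  supported a' b' G -> supported a b G.
Proof.
move=> sub [G1 G2]; split=> y h; first by apply: G1; apply: contra h; apply: sub.
by have [h'|h'] := boolP (rectb a' b' y); [apply/sub/G2|rewrite G1].
Qed.

Lemma rot_supported i a b m : a ord0 i <= m <= b ord0 i -> supported a b (rot i a b m).
Proof.
by move=> am; split=> y h; [rewrite /rot (negPf h)|rewrite rot_rectb].
Qed.

Lemma rot_other i a b m y j : j != i -> rot i a b m y ord0 j = y ord0 j.
Proof.
move=> /negPf ji; rewrite /rot; case: ifP => // _.
by case: ifP => _; rewrite !mxE ji ?oppr0 addr0.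
Qed.

Lemma bring_to_front i a b w q : (forall j, j != i -> a ord0 j < b ord0 j) ->
  a ord0 i + wl w + len q <= b ord0 i ->
  (forall y, rectb a b y -> M y) -> (forall j, b ord0 j - a ord0 j <= eps) ->
  exists G, [/\ generated M eps G, supported a b G,
    forall y j, j != i -> G y ord0 j = y ord0 j &
    forall y, rectb a b y -> G y ord0 i =
      if y ord0 i < a ord0 i + wl w then y ord0 i + len q
      else if y ord0 i < a ord0 i + wl w + len q then y ord0 i - wl w else y ord0 i].
Proof.
move=> ab le aM abe; have q0 := len_gt0 q; have w0 := wlen_ge0 len_gt0 w.
(* If nothing precedes the slice, it is already in front; [generated_rot] wants a cut strictly
   inside the box, so the identity is used. *)
have {w0} [w0|w0] : wl w = 0 \/ 0 < wl w by lra.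
  exists id; split=> [||//|y h]; [exact: gen_id|by split|].
  rewrite w0 addr0 ifF; last by have /andP[h1 _] := forallP h i; lra.
  by case: ifP => _; rewrite ?subr0.
pose b' := upd b i (a ord0 i + wl w + len q).
have sub y : rectb a b' y -> rectb a b y by rewrite rectb_updr // => /andP[].
have bi : b' ord0 i = a ord0 i + wl w + len q by rewrite mxE eqxx.
have am : a ord0 i <= a ord0 i + wl w <= b' ord0 i by rewrite bi; lra.
exists (rot i a b' (a ord0 i + wl w)); split.
- apply: generated_rot.
  + by move=> j; rewrite mxE; case: eqVneq => [->|/ab]; lra.
  + by rewrite bi; lra.
  + by move=> y /sub/aM.
  + by move=> j; have := abe j; rewrite mxE; case: eqP => [->|_]; lra.
- exact: supported_sub sub (rot_supported am).
- by move=> y j; apply: rot_other.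
- move=> y h; rewrite /rot rectb_updr // h /=.
  have [y1|y1] := ltP (y ord0 i) (a ord0 i + wl w).
    by rewrite (lt_le_trans y1) ?lerDl ?ltW // !mxE eqxx; lra.
  by case: ifP => // _; rewrite !mxE eqxx; lra.
Qed.

(** The first letter of v is brought to the front and the induction goes on in the box above it.
    Strict sides are asked for only in the directions other than i, because the remaining box
    finally becomes flat in direction i. *)
Lemma rearrange_slices i v : forall u a b, perm_eq u v ->
  (forall j, j != i -> a ord0 j < b ord0 j) -> b ord0 i - a ord0 i = wl u ->
  (forall y, rectb a b y -> M y) -> (forall j, b ord0 j - a ord0 j <= eps) ->
  exists G, [/\ generated M eps G, supported a b G,
    forall y j, j != i -> G y ord0 j = y ord0 j & moves_slices a b G i u v].
Proof.
elim: v => [|x v IH] u a b uv ab abi aM abe.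
  exists id; split=> //; first exact: gen_id.
  by move: uv => /perm_nilP ->; move=> [].
have xu : x \in u by rewrite (perm_mem uv) inE eqxx.
case/splitPr: xu uv abi => w1 w2 uv abi.
have uv' : perm_eq (w1 ++ w2) v.
  by move: uv; rewrite -[x :: w2]cat1s perm_catCA perm_cons.
move: abi; rewrite wlen_cat wlen_cons => abi.
have := (len_gt0 x, wlen_ge0 len_gt0 w1, wlen_ge0 len_gt0 w2) => -[[x0 w10] w20].
have [|G1 [gG1 [out1 in1] oth1 G1E]] := @bring_to_front i a b w1 x ab _ aM abe; first lra.
pose a' := upd a i (a ord0 i + len x).
have ai : a' ord0 i = a ord0 i + len x by rewrite mxE eqxx.
have rE y : rectb a' b y = rectb a b y && (a ord0 i + len x <= y ord0 i).
  by apply: rectb_updl; lra.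
have sub y : rectb a' b y -> rectb a b y by rewrite rE => /andP[].
have [||||G2 [gG2 [out2 in2] oth2 G2E]] := IH (w1 ++ w2) a' b uv'.
- by move=> j ji; rewrite mxE (negPf ji); apply: ab.
- by rewrite ai wlen_cat; lra.
- by move=> y /sub/aM.
- by move=> j; have := abe j; rewrite mxE; case: eqP => [->|_]; lra.
have sup2 : supported a b G2 by apply: supported_sub sub _; split.
exists (G2 \o G1); split.
- exact: generated_comp.
- by apply: supported_comp sup2 _; split.
- by move=> y j ji /=; rewrite oth2 // oth1.
(* The slice q lies before the chosen slice x, is x itself, or lies after it; correspondingly [G1]
   moves it up by [len x], moves it to the bottom, or leaves it. *)
move=> u1 q u2 /esym uE; have [[w [w1E u2E]]|[-> -> _]|[w [u1E w2E]]] := cat_cons_cases uE.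
- have [v1 [v2 [vE G2y]]] := G2E u1 q (w ++ w2) (etrans (congr1 (cat^~ w2) w1E) (esym (catA _ (q :: w) w2))).
  exists (x :: v1), v2; split; first by rewrite vE.
  move=> y h hy /=; have q0 := len_gt0 q; have ww := wlen_ge0 len_gt0 w.
  have w1l : wl w1 = wl u1 + len q + wl w by rewrite w1E wlen_cat wlen_cons addrA.
  have E : G1 y ord0 i = y ord0 i + len x by rewrite G1E // ifT //; lra.
  rewrite G2y ?ai ?E ?wlen_cons; [lra| |lra].
  by rewrite rE in1 // E /=; have := wlen_ge0 len_gt0 u1; lra.
- exists [::], v; split=> // y h hy /=.
  have E : G1 y ord0 i = y ord0 i - wl w1.
    by rewrite G1E // ifF ?ifT //; lra.
  by rewrite out2 ?E ?wlen_nil ?addr0 // rE in1 // E /= -ltNge; lra.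
- have [v1 [v2 [vE G2y]]] := G2E (w1 ++ w) q u2 (etrans (congr1 (cat w1) w2E) (catA _ _ _)).
  exists (x :: v1), v2; split; first by rewrite vE.
  move=> y h hy /=; have q0 := len_gt0 q; have ww := wlen_ge0 len_gt0 w.
  have u1l : wl u1 = wl w1 + len x + wl w by rewrite u1E wlen_cat wlen_cons addrA.
  have E : G1 y ord0 i = y ord0 i by rewrite G1E // ifF ?ifF //; lra.
  rewrite G2y ?ai ?E ?wlen_cons ?wlen_cat; [lra| |lra].
  by rewrite rE in1 // E /=; lra.
Qed.

(** One direction at a time: the map for direction i changes no other coordinate, hence leaves the
    slices of the other directions in place. *)
Lemma rearrange_box (u v : 'I_d -> seq T) a b : (forall j, perm_eq (u j) (v j)) ->
  valid_rect a b -> (forall j, b ord0 j - a ord0 j = wl (u j)) ->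
  (forall y, rectb a b y -> M y) -> (forall j, b ord0 j - a ord0 j <= eps) ->
  exists G, [/\ generated M eps G, supported a b G & forall j, moves_slices a b G j (u j) (v j)].
Proof.
move=> uv ab abu aM abe.
suff [G [gG sG oG mG]] : exists G, [/\ generated M eps G, supported a b G,
    forall y j, j \notin enum 'I_d -> G y ord0 j = y ord0 j &
    forall j, j \in enum 'I_d -> moves_slices a b G j (u j) (v j)].
  by exists G; split=> // j; apply: mG; rewrite mem_enum.
elim: (enum 'I_d) (enum_uniq 'I_d) => [_|i J IH /= /andP[iJ uJ]].
  by exists id; split=> //; exact: gen_id.
have [G [gG sG oG mG]] := IH uJ.
have [|G1 [gG1 sG1 oG1 mG1]] := @rearrange_slices i (v i) (u i) a b (uv i) _ (abu i) aM abe.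
  by move=> j _; apply: ab.
exists (G1 \o G); split.
- exact: generated_comp.
- exact: supported_comp.
- by move=> y j; rewrite inE negb_or => /andP[ji jJ] /=; rewrite oG1 // oG.
move=> j; rewrite inE; case: (eqVneq j i) => [-> _|ji /= jJ] u1 q u2 uE.
  have [v1 [v2 [vE E]]] := mG1 u1 q u2 uE; exists v1, v2; split=> // y h hy /=.
  have Gi : G y ord0 i = y ord0 i by apply: oG.
  by rewrite E ?Gi //; apply: sG.2.
have [v1 [v2 [vE E]]] := mG j jJ u1 q u2 uE; exists v1, v2; split=> // y h hy /=.
by rewrite oG1 // E.
Qed.
End Rearrangement.

(** An arithmetic progression of step eps is added, starting at -B and ending beyond B, where B
    bounds the absolute values in c. *)
Lemma fine_cuts (R : realType) (c : seq R) (eps : R) : 0 < eps ->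
  exists c', {subset c <= c'} /\ forall x y, adj c' x y -> y - x <= eps.
Proof.
move=> e0; have [B [B0 BP]] : exists B : R, 0 <= B /\ forall x, x \in c -> `|x| <= B.
  elim: c => [|z c [B [B0 BP]]]; first by exists 0.
  exists (B + `|z|); split=> [|x]; first by rewrite addr_ge0.
  have z0 := normr_ge0 z.
  by rewrite inE => /orP[/eqP ->|/BP h]; lra.
pose N := Num.bound (B *+ 2 / eps).
have NB : B *+ 2 < N%:R * eps.
  by rewrite -ltr_pdivrMr // archi_boundP // divr_ge0 ?mulrn_wge0 // ltW.
pose p (k : nat) := - B + k%:R * eps.
have pS k : p k.+1 = p k + eps by rewrite /p -natr1; ring.
have ple k l : (k <= l)%N -> p k <= p l.
  by move=> kl; rewrite /p lerD2l ler_pM2r // ler_nat.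
pose c' := c ++ [seq p k | k <- iota 0 N.+1].
have pc k : (k <= N)%N -> p k \in c'.
  by move=> kN; rewrite mem_cat map_f ?orbT // mem_iota.
have c'B x : x \in c' -> p 0%N <= x <= p N.
  rewrite mem_cat => /orP[/BP|/mapP[k]].
    rewrite /p mul0r addr0 ler_norml => /andP[-> h] /=; apply: le_trans h _.
    by move: NB; rewrite mulr2n; lra.
  by rewrite mem_iota ltnS => /= kN ->; rewrite !ple.
exists c'; split=> [x xc|x y /and4P[xc yc xy /allP nb]]; first by rewrite mem_cat xc.
rewrite leNgt; apply/negP => gap.
have ex : exists k, (k <= N)%N && (x < p k).
  by exists N; rewrite leqnn (lt_le_trans xy) //; case/andP: (c'B y yc).
case: (ex_minnP ex) => -[|k] /andP[kN xk] kmin.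
  by have /andP[] := c'B x xc; lra.
have px : p k <= x.
  rewrite leNgt; apply/negP => h; have := kmin k; rewrite h ltnW // => /(_ isT).
  by rewrite ltnn.
by have := nb _ (pc _ kN); rewrite pS in xk *; lra.
Qed.

(** * Swaps and small rotations generate *)

Section GenerationTheorem.
Variables (R : realType) (d : nat) (M : set 'rV[R]_d) (eps : R).
Hypotheses (mM : multirect M) (eps_gt0 : 0 < eps).
Implicit Types (a b y z : 'rV[R]_d) (i j : 'I_d).
Implicit Types (f G : 'rV[R]_d -> 'rV[R]_d).

Lemma glue_cells c (Gs : cell_index d c -> 'rV[R]_d -> 'rV[R]_d) (L : seq (cell_index d c)) :
  uniq L -> (forall q, q \in L -> generated M eps (Gs q) /\ supported (clo q) (chi q) (Gs q)) ->
  exists G, [/\ generated M eps G,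
    forall q y, q \in L -> rectb (clo q) (chi q) y -> G y = Gs q y &
    forall y, (forall q, q \in L -> ~~ rectb (clo q) (chi q) y) -> G y = y].
Proof.
elim: L => [_ _|q0 L IH /= /andP[qL uL] GsP].
  by exists id; split=> //; exact: gen_id.
have [|G [gG inG outG]] := IH uL; first by move=> q qL'; apply: GsP; rewrite inE qL' orbT.
have [gq [oq sq]] := GsP q0 (mem_head _ _).
exists (Gs q0 \o G); split=> [|q y|y out] /=.
- exact: generated_comp.
- rewrite inE; case: (eqVneq q q0) => [-> _|qq0 /= qL'] h.
    rewrite outG // => q1 qL'; apply: contra qL => h'.
    by rewrite (cell_uniq h h').
  have [_ [_ sq']] := GsP q (mem_behead (s := q0 :: L) qL').
  rewrite (inG q) // oq //; apply: contra qq0 => h'.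
  by apply/eqP; apply: cell_uniq (sq' _ h) h'.
- rewrite outG; first by rewrite oq // out ?mem_head.
  by move=> q qL'; apply: out; rewrite inE qL' orbT.
Qed.

Lemma adj_cell c (lo hi : 'rV[R]_d) : (forall j, adj c (lo ord0 j) (hi ord0 j)) ->
  exists q : cell_index d c, clo q = lo /\ chi q = hi.
Proof.
move=> adjc; have /fin_all_exists[k kP] : forall j, exists k : 'I_(nint c),
    lo ord0 j = pt c k /\ hi ord0 j = pt c k.+1.
  by move=> j; have [k ? ?] := adjP (adjc j); exists k.
exists [ffun j => k j]; split; apply/rowP => j; rewrite mxE ffunE.
  by case: (kP j).
by case: (kP j).
Qed.

Lemma inRec_generated f : inRec M f -> generated M eps f.
Proof.
move=> rf; have [c0 a0] := inRec_adapted rf.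
(* Cells at most eps wide force the rotations inside them to be small. The cut 0 makes the list
   nonempty, as [subdivision] requires. *)
have [c [sub0 fine]] := fine_cuts (0 :: c0) eps_gt0.
have ac : adapted c M f by apply: adaptedS a0 => x xc; apply: sub0; rewrite inE xc orbT.
pose L := [seq q <- enum (cell_index d c) | `[< M (clo q) >]].
have LP q : q \in L <-> M (clo q).
  by rewrite mem_filter mem_enum andbT; split=> /asboolP.
pose lo' (q : cell_index d c) := f (clo q).
pose hi' (q : cell_index d c) : 'rV[R]_d := f (clo q) + (chi q - clo q).
pose c1 := c ++ endpoints [seq (lo' q, hi' q) | q <- L].
have sub1 : {subset c <= c1} by move=> x xc; rewrite mem_cat xc.
have img q : q \in L -> in_cuts c1 (lo' q) /\ in_cuts c1 (hi' q).
  move=> qL; have [e1 e2] := @endpointsP _ _ [seq (lo' q, hi' q) | q <- L] _ (map_f _ qL).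
  by split=> j; rewrite mem_cat ?e1 ?e2 orbT.
pose rels := [seq ((clo q ord0 j, chi q ord0 j), (lo' q ord0 j, hi' q ord0 j)) | q <- L, j <- enum 'I_d].
have lt_cell (q : cell_index d c) j : clo q ord0 j < chi q ord0 j by rewrite !mxE pt_lt_cell.
have [||T [len [W [c2 [len_gt0 sub2 WP Wrel]]]]] := @subdivision R c1 rels.
- by exists 0; apply/sub1/sub0; rewrite inE eqxx.
- move=> r /allpairsP[[q j] [/= qL _ ->]] /=; have [i1 i2] := img q qL.
  split; first by split; rewrite ?i1 ?i2 // sub1 // ?clo_cuts ?chi_cuts.
  have lt_q := lt_cell q j; split; first exact: ltW.
    by move: lt_q; rewrite /lo' /hi' !mxE; lra.
  by rewrite /lo' /hi' !mxE; ring.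
pose u (q : cell_index d c) j := W (clo q ord0 j) (chi q ord0 j).
pose v (q : cell_index d c) j := W (lo' q ord0 j) (hi' q ord0 j).
have uv q j : q \in L -> perm_eq (u q j) (v q j).
  move=> qL; apply: (Wrel ((clo q ord0 j, chi q ord0 j), (lo' q ord0 j, hi' q ord0 j))).
  by apply/allpairsP; exists (q, j); rewrite mem_enum.
have inM q y : q \in L -> rectb (clo q) (chi q) y -> M y /\ f y - y = f (clo q) - clo q.
  move=> /LP Mq yq; exact: (ac.2 _ _ (cell_eqc (clo_in_cell q) yq) Mq).
have uP q j : q \in L -> wlen len (u q j) = chi q ord0 j - clo q ord0 j /\
    forall u1 p u2, u q j = u1 ++ p :: u2 ->
      adj c2 (clo q ord0 j + wlen len u1) (clo q ord0 j + wlen len u1 + len p).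
  by move=> qL; apply: WP; [exact/sub1/clo_cuts|exact/sub1/chi_cuts|exact: ltW].
have vP q j : q \in L -> forall u1 p u2, v q j = u1 ++ p :: u2 ->
      adj c2 (lo' q ord0 j + wlen len u1) (lo' q ord0 j + wlen len u1 + len p).
  move=> qL; have [i1 i2] := img q qL.
  apply: (proj2 (WP _ _ (i1 j) (i2 j) _)).
  by have := lt_cell q j; rewrite /lo' /hi' !mxE; lra.
have /choice[Gs GsP] : forall q, exists G, q \in L -> [/\ generated M eps G,
    supported (clo q) (chi q) G &
    forall j, moves_slices len (clo q) (chi q) G j (u q j) (v q j)].
  move=> q; have [qL|nqL] := boolP (q \in L); last by exists id.
  have [|||||G GP] := @rearrange_box R d M eps T len len_gt0 (u q) (v q) (clo q) (chi q).
  - by move=> j; apply: uv.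
  - by move=> j.
  - by move=> j; rewrite (uP q j qL).1.
  - by move=> y yq; case: (inM q y qL yq).
  - by move=> j; rewrite !mxE; apply: fine; apply: adj_pt.
  by exists G.
have [||G [gG inG outG]] := @glue_cells c Gs L.
- by rewrite filter_uniq // enum_uniq.
- by move=> q /GsP[].
have [G' [gG' GK G'K]] := generated_inv gG.
(* Inside each cell q of c, G puts the slices in the order v that the image of q shows on the grid
   c2; hence [f \o G] translates cells of c2 onto cells of c2. *)
have -> : f = (f \o G) \o G' by apply/funext => y /=; rewrite G'K.
apply: generated_comp gG'.
have sub3 : {subset c <= c2} by move=> x /sub1/sub2.
apply: (@generated_cells R d M eps mM c2).
- exact: bounded_byS sub3 ac.1.
- by move=> y z /(eqcS sub3) yz My; case: (ac.2 y z yz My).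
- exact: inRec_comp rf (generated_inRec mM gG).
move=> Q MQ; have [q [Mq Qq]] : exists q : cell_index d c, M (clo q) /\ rectb (clo q) (chi q) (clo Q).
  have [a [b [aM bM yab]]] := ac.1 _ MQ; have [q yq] := cell_of aM bM yab.
  by exists q; split=> //; case: (ac.2 _ _ (cell_eqc yq (clo_in_cell q)) MQ).
have qL : q \in L by apply/LP.
have [gq sq mq] := GsP q qL.
(* The target cell is found coordinatewise: in direction j, Q is a slice of q with some letter, and
   the target is the slice with this letter in the image of q. *)
have /fin_all_exists[tgt tgtP] : forall j, exists xy : R * R, [/\ adj c2 xy.1 xy.2,
    xy.2 - xy.1 = chi Q ord0 j - clo Q ord0 j &
    forall y, rectb (clo q) (chi q) y -> clo Q ord0 j <= y ord0 j < chi Q ord0 j ->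
      Gs q y ord0 j - clo q ord0 j + lo' q ord0 j = y ord0 j + (xy.1 - clo Q ord0 j)].
  move=> j; have [ul uadj] := uP q j qL; have hQ := forallP Qq j.
  have [|u1 [p [u2 [uE hz]]]] := @word_locate R T len (u q j) (clo Q ord0 j - clo q ord0 j).
    by rewrite ul; lra.
  have adjQ : adj c2 (clo Q ord0 j) (chi Q ord0 j) by rewrite !mxE; apply: adj_pt.
  have [||E1 E2] := adj_uniq (z := clo Q ord0 j) adjQ (uadj _ _ _ uE).
  - by rewrite lexx !mxE pt_lt_cell.
  - lra.
  have [v1 [v2 [vE mv]]] := mq j u1 p u2 uE.
  exists (lo' q ord0 j + wlen len v1, lo' q ord0 j + wlen len v1 + len p); split=> /=.
  - exact: vP vE.
  - lra.
  - by move=> y yq hy; rewrite mv //; lra.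
have [|Q' [lo_E hi_E]] := @adj_cell c2 (\row_j (tgt j).1) (\row_j (tgt j).2).
  by move=> j; rewrite !mxE; case: (tgtP j).
exists Q'; split.
  by rewrite lo_E hi_E; apply/rowP => j; have [_ E _] := tgtP j; rewrite !mxE in E *.
move=> y yQ; have yq : rectb (clo q) (chi q) y.
  by rewrite -(eqc_rectb (clo_cuts q) (chi_cuts q) (eqcS sub3 (cell_eqc (clo_in_cell Q) yQ))).
have [_ fE] := inM q (Gs q y) qL (sq.2 _ yq).
rewrite /= (inG q y qL yq) -[f (Gs q y)](subrK (Gs q y)) fE.
apply/rowP => j; have [_ _ /(_ y yq (forallP yQ j)) E] := tgtP j.
rewrite lo_E; move: E; rewrite /lo' !mxE => E; lra.
Qed.
End GenerationTheorem.

(** * Classes of small rotations *)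

Section Shapes.
Variables (R : realType) (n : nat).
Implicit Types (a b y v : 'rV[R]_n.+1) (i j l : 'I_n.+1) (x t : n.+2.-tuple R) (k : 'I_n.+2).

Local Notation sp := (sprev n).

Lemma sp_max : (sp == ord_max) = false.
Proof. by rewrite eq_sym (negPf (neq_lift _ _)). Qed.

Lemma tnth_xswap x k : tnth (xswap x) k
  = if k == ord_max then tnth x sp else if k == sp then tnth x ord_max else tnth x k.
Proof. by rewrite !tnth_tset. Qed.

Lemma xswap_tset x k u : xswap (tset x k u) = tset (xswap x) (tperm sp ord_max k) u.
Proof.
apply: eq_from_tnth => k'; rewrite tnth_xswap [RHS]tnth_tset tnth_xswap !tnth_tset.
case: tpermP => [->|->|/eqP k1 /eqP k2].
- rewrite eqxx; case: (eqVneq k' ord_max) => // k'm; case: (eqVneq k' sp) => // _.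
  by rewrite eq_sym sp_max.
- rewrite eqxx sp_max; case: (eqVneq k' ord_max) => [->|_]; last by case: (k' == sp).
  by rewrite (eq_sym ord_max) sp_max.
- case: (eqVneq k' ord_max) => [->|k'm].
    by rewrite (eq_sym sp) (negPf k1) eq_sym (negPf k2).
  case: (eqVneq k' sp) => [->|k's]; last by [].
  by rewrite (eq_sym ord_max) (negPf k2) eq_sym (negPf k1).
Qed.

Lemma srow_tset i x l u j : srow i (tset x (lift ord_max l) u) ord0 j
  = if j == swap_last i l then u else srow i x ord0 j.
Proof.
rewrite !mxE tnth_tset (inj_eq lift_inj); congr (if _ then _ else _).
by rewrite (can2_eq (@swap_lastK n i) (@swap_lastK n i)).
Qed.

Lemma slast_tset x l u : slast (tset x (lift ord_max l) u) = slast x.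
Proof. by rewrite /slast tnth_tset (negPf (neq_lift _ _)). Qed.

Lemma shiE' i a x j : shi i a x ord0 j
  = a ord0 j + srow i x ord0 j + (if j == i then slast x else 0).
Proof. by rewrite !mxE. Qed.

Lemma shi_tset i a x l u w : shi i (a + shift (swap_last i l) u) (tset x (lift ord_max l) w)
  = shi i a (tset x (lift ord_max l) (u + w)).
Proof.
apply/rowP => j; rewrite !shiE' !srow_tset !slast_tset !mxE.
by case: (j == swap_last i l); ring.
Qed.

Lemma shi_upd i a x l u w :
  upd (shi i a (tset x (lift ord_max l) (u + w))) (swap_last i l)
    (a ord0 (swap_last i l) + u + (if swap_last i l == i then slast x else 0))
  = shi i a (tset x (lift ord_max l) u).
Proof.
apply/rowP => j; rewrite mxE !shiE' !srow_tset !slast_tset.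
by case: (eqVneq j (swap_last i l)) => [->|].
Qed.

Lemma lo_upd i a l u : upd a (swap_last i l) (a ord0 (swap_last i l) + u)
  = a + shift (swap_last i l) u.
Proof.
by apply/rowP => j; rewrite !mxE; case: (eqVneq j (swap_last i l)) => [->|]; rewrite ?addr0.
Qed.

(** The source of additivity. The entry l stands for direction [swap_last i l]: when this is i one
    of the exchanged lengths is cut, otherwise the rectangle is cut sideways. The remaining entry,
    the last one, is reached through [xswap]. *)
Lemma srot_cut i a x l u w : 0 < u -> 0 < w -> 0 <= slast x ->
  srot i a (tset x (lift ord_max l) (u + w))
  = srot i a (tset x (lift ord_max l) u)
    \o srot i (a + shift (swap_last i l) u) (tset x (lift ord_max l) w).
Proof.
move=> u0 w0 x0; rewrite /srot !shi_tset.
rewrite -(lo_upd i a l u) -(shi_upd i a x l u w).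
set b := shi i a _.
have bE : b ord0 (swap_last i l) = a ord0 (swap_last i l) + (u + w)
    + (if swap_last i l == i then slast x else 0).
  by rewrite shiE' srow_tset eqxx slast_tset.
move: bE; rewrite !srow_tset; have [li bE|li bE] := eqVneq i (swap_last i l).
  rewrite -li in bE *.
  rewrite (@rot_cut_length _ _ i a b (a ord0 i + u)); [|lra..].
  congr (_ \o _).
    by congr (rot i a (upd b i _) _); rewrite bE; ring.
  by rewrite mxE eqxx; congr (rot i _ b _); ring.
rewrite (@rot_cut_side _ _ i (swap_last i l) a b _ (a ord0 (swap_last i l) + u)); last 2 first.
- by rewrite eq_sym.
- by rewrite bE; lra.
by rewrite addr0 [upd a _ _ ord0 i]mxE (negPf li).
Qed.

Lemma shi_xswap i a x : shi i a (xswap x) = shi i a x.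
Proof.
apply/rowP => j; rewrite !shiE' !mxE /slast !tnth_xswap eqxx.
rewrite [lift _ _ == _]eq_sym (negPf (neq_lift _ _)) (inj_eq lift_inj).
have si : swap_last i i = ord_max by rewrite /swap_last eqxx.
have [->|ji] := eqVneq j i; first by rewrite si eqxx; ring.
rewrite ifN // /swap_last (negPf ji); case: (eqVneq j ord_max) => // jm.
by rewrite eq_sym -jm.
Qed.

(** Interchanging the two lengths inverts the rotation; this makes its class antisymmetric. *)
Lemma srotK i a x : spos x -> srot i a x \o srot i a (xswap x) = id.
Proof.
move=> x0; apply/funext => y /=; rewrite /srot shi_xswap.
have E : a ord0 i + srow i (xswap x) ord0 i
    = a ord0 i + shi i a x ord0 i - (a ord0 i + srow i x ord0 i).
  rewrite shiE' eqxx srow_i srow_i tnth_xswap sp_max eqxx /slast; ring.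
by rewrite E rotK' // srot_mid.
Qed.

Lemma shi_translate i a v x : shi i (a + v) x = shi i a x + v.
Proof. by apply/rowP => j; rewrite !mxE; ring. Qed.

Lemma srot_translate i a v x :
  srot i (a + v) x = rot i (a + v) (shi i a x + v) (a ord0 i + srow i x ord0 i + v ord0 i).
Proof. by rewrite /srot shi_translate; congr (rot _ _ _ _); rewrite !mxE; ring. Qed.

(** Gives an arbitrary rotation a shape; each entry is bounded by a side of the box, so smallness
    carries over. *)
Lemma rot_srot i a b m : valid_rect a b -> a ord0 i < m < b ord0 i ->
  exists x, [/\ rot i a b m = srot i a x, shi i a x = b &
    forall k, exists j, 0 < tnth x k <= b ord0 j - a ord0 j].
Proof.
move=> ab am; pose h l := if swap_last i l == i then m - a ord0 i
  else b ord0 (swap_last i l) - a ord0 (swap_last i l).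
pose x : n.+2.-tuple R := [tuple if unlift ord_max k is Some l then h l else b ord0 i - m | k < n.+2].
have xl l : tnth x (lift ord_max l) = h l by rewrite tnth_mktuple liftK.
have xm : tnth x ord_max = b ord0 i - m by rewrite tnth_mktuple unlift_none.
have bE : shi i a x = b.
  apply/rowP => j; rewrite shiE xl /h swap_lastK /slast xm.
  by case: (eqVneq j i) => [->|_]; ring.
have sE : srow i x ord0 i = m - a ord0 i by rewrite mxE xl /h swap_lastK eqxx.
exists x; split=> // [|k].
  by rewrite /srot bE sE addrC subrK.
case: (unliftP ord_max k) => [l ->|->].
  exists (swap_last i l); rewrite xl /h; case: eqP => [->|_]; first lra.
  by have := ab (swap_last i l); lra.
by exists i; rewrite xm; lra.
Qed.

Lemma rcons2P x : exists (t : n.-tuple R) p q, x = rcons_tuple (rcons_tuple t p) q.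
Proof.
exists [tuple tnth x (lift ord_max (lift ord_max k)) | k < n], (tnth x sp), (tnth x ord_max).
apply: eq_from_tnth => k; rewrite tnth_rcons_tuple.
case: unliftP => [l ->|-> //]; rewrite tnth_rcons_tuple.
by case: unliftP => [k' ->|-> //]; rewrite tnth_mktuple.
Qed.
End Shapes.

(** The factor 6 is 4 + 2: a box of side at most [eps *+ 2] has to fit in M even after a translation
    by up to [eps *+ 4]. *)
Lemma multirect_box (R : realType) n (M : set 'rV[R]_n.+1) : multirect M -> (exists y, M y) ->
  exists (a : 'rV[R]_n.+1) eps, 0 < eps /\ forall y : 'rV[R]_n.+1, (forall j, a ord0 j <= y ord0 j < a ord0 j + eps *+ 6) -> M y.
Proof.
move=> [s [sv sM]] [y0 /sM[[a b] ps _]]; have ab := sv _ ps.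
have [e [e0 eP]] : exists e : R, 0 < e /\ forall j, j \in enum 'I_n.+1 -> a ord0 j + e <= b ord0 j.
  elim: (enum _) => [|j J [e [e0 eP]]]; first by exists 1.
  have := ab j => /= abj; exists (Order.min e (b ord0 j - a ord0 j)).
  split=> [|k]; first by rewrite lt_min e0 subr_gt0.
  rewrite inE => /orP[/eqP ->|/eP le]; first by rewrite -lerBrDl ge_min lexx orbT.
  by apply: le_trans le; rewrite lerD2l ge_min lexx.
exists a, (e / 6); split=> [|y yP]; first by rewrite divr_gt0.
apply/sM; exists (a, b) => //= j; have := yP j; have := eP j; rewrite mem_enum => /(_ isT).
have -> : e / 6 *+ 6 = e by rewrite -[LHS]mulr_natr divfK // pnatr_eq0.
lra.
Qed.

Section RotationClass.
Variables (R : realType) (n : nat) (M : set 'rV[R]_n.+1).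
Hypothesis mM : multirect M.
Variables (A : zmodType) (cl : ('rV[R]_n.+1 -> 'rV[R]_n.+1) -> A).
Hypothesis clD : forall f g, inRec M f -> inRec M g -> cl (f \o g) = cl f + cl g.
Variables (a0 : 'rV[R]_n.+1) (eps : R).
Hypothesis eps_gt0 : 0 < eps.
Hypothesis a0M : forall y : 'rV[R]_n.+1, (forall j, a0 ord0 j <= y ord0 j < a0 ord0 j + eps *+ 6) -> M y.
Implicit Types (a b y v : 'rV[R]_n.+1) (i j l : 'I_n.+1) (x t : n.+2.-tuple R) (k : 'I_n.+2).

Local Notation box x := (in_box eps x [::]).

Lemma box_spos x : box x -> spos x.
Proof. by move=> xb k; case/andP: (xb k isT). Qed.

(** The factor 2 comes from direction i, where the side is the sum of the two exchanged lengths. *)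
Lemma box_sides i a x j : box x ->
  0 < shi i a x ord0 j - a ord0 j <= eps *+ 2.
Proof.
move=> xb; rewrite shiE /slast; have := xb (lift ord_max (swap_last i j)) isT.
by have := xb ord_max isT; rewrite mulr2n; case: eqP => _; lra.
Qed.

(** By [swap_rot] a swap intertwines the two rotations, and its class cancels in the abelian group
    A. *)
Lemma cl_srot_shift i a v x : spos x -> disjoint_shift a (shi i a x) v ->
  (forall y, rectb a (shi i a x) y -> M y) -> (forall y, rectb a (shi i a x) y -> M (y + v)) ->
  cl (srot i (a + v) x) = cl (srot i a x).
Proof.
move=> x0 dj aM avM; have ab := shi_valid i a x0; have am := srot_mid i a x0.
have rs := inRec_swap mM ab dj aM avM.
have rr := inRec_rot mM ab am aM.
have avM' y : rectb (a + v) (shi i (a + v) x) y -> M y.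
  by rewrite shi_translate rectbB => /avM; rewrite subrK.
have rr' := inRec_srot mM x0 avM'.
apply: (addIr (cl (swap a (shi i a x) v))).
by rewrite -clD // srot_translate -swap_rot // clD // addrC.
Qed.

Definition phi i x := cl (srot i a0 x).

Lemma base_sub i x v : box x -> (forall j, 0 <= v ord0 j <= eps *+ 4) ->
  forall y, rectb a0 (shi i a0 x) y -> M (y + v).
Proof.
move=> xb vb y /forallP h; apply: a0M => j; have := h j; have := vb j.
by have := @box_sides i a0 x j xb; rewrite !mxE !mulrS !mulr0n; lra.
Qed.

(* A small rectangle is disjoint from the one of the same shape at [a0] or from
   the translate of the latter by [4 eps] along the first axis, so that at most two swaps move it to [a0]. *)
Lemma phi_base i a x : box x -> (forall y, rectb a (shi i a x) y -> M y) ->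
  cl (srot i a x) = phi i x.
Proof.
move=> xb aM; have x0 := box_spos xb; pose w := shift ord0 (eps *+ 4) : 'rV[R]_n.+1.
have w4 j : 0 <= w ord0 j <= eps *+ 4.
  by rewrite mxE; case: eqP => _; rewrite ?lexx ?mulrn_wge0 ?ltW.
have base y : rectb a0 (shi i a0 x) y -> M y.
  move=> h; rewrite -[y]addr0; apply: base_sub xb _ y h => j.
  by rewrite mxE lexx mulrn_wge0 ?ltW.
have far v : eps *+ 2 <= `|v ord0 ord0| -> forall b, disjoint_shift b (shi i b x) v.
  move=> vl b y /forallP/(_ ord0) h1 /forallP/(_ ord0); rewrite [(y + v) _ _]mxE => h2.
  have := @box_sides i b x ord0 xb; move: vl; rewrite ler_normr => /orP[]; lra.
have to v : disjoint_shift a (shi i a x) v ->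
    (forall y, rectb a0 (shi i a0 x) y -> M (y + (a + v - a0))) ->
    cl (srot i (a + v) x) = cl (srot i a x).
  move=> dj vM; apply: cl_srot_shift => // y h.
  have := vM (y + (a0 - a)).
  have -> : y + (a0 - a) + (a + v - a0) = y + v by apply/rowP => j; rewrite !mxE; ring.
  by apply; have -> : shi i a0 x = shi i a x + (a0 - a);
    [rewrite -shi_translate addrC subrK|rewrite -{1}(subrK a a0) addrC rectbD].
have [/far/(_ a) dj|close] := pselect (eps *+ 2 <= `|(a0 - a) ord0 ord0|).
  have e : a + (a0 - a) = a0 by rewrite addrC subrK.
  have := to _ dj; rewrite e subrr => <- // y; rewrite addr0; exact: base.
(* Here a is within [eps *+ 2] of a0 along the first axis, so both steps of the detour, from a to a0
   + w and from there to a0, are at least that long. *)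
have dj : disjoint_shift a (shi i a x) (a0 + w - a).
  apply: far; move/negP: close; rewrite -ltNge ltr_norml ler_normr !mxE eqxx.
  by rewrite !mulrS !mulr0n; lra.
rewrite -(to _ dj); last first.
  have -> : a + (a0 + w - a) - a0 = w by apply/rowP => j; rewrite !mxE; ring.
  exact: base_sub.
have -> : a + (a0 + w - a) = a0 + w by apply/rowP => j; rewrite !mxE; ring.
apply: cl_srot_shift => //; last exact: base_sub.
apply: far; rewrite mxE eqxx ger0_norm; last by rewrite mulrn_wge0 ?ltW.
by rewrite !mulrS !mulr0n; move: eps_gt0; lra.
Qed.

Lemma cl_id : cl id = 0.
Proof. by apply: (addrI (cl id)); rewrite -clD ?addr0 //; apply: inRec_id. Qed.

Lemma base_in i x : box x -> forall y, rectb a0 (shi i a0 x) y -> M y.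
Proof.
move=> xb y h; rewrite -[y]addr0; apply: (base_sub (v := 0) xb) h => j.
by rewrite mxE lexx mulrn_wge0 ?ltW.
Qed.

Lemma box_xswap x : box x -> box (xswap x).
Proof. by move=> xb k _; rewrite tnth_xswap; case: ifP => _; [|case: ifP => _]; apply: xb. Qed.

Lemma phi_xswap i x : box x -> phi i (xswap x) = - phi i x.
Proof.
move=> xb; apply/eqP; rewrite -addr_eq0 addrC; apply/eqP; rewrite /phi -clD ?srotK ?cl_id //.
- exact: box_spos.
- by apply: inRec_srot (base_in xb) => //; apply: box_spos.
- by apply: inRec_srot (base_in (box_xswap xb)) => //; apply/box_spos/box_xswap.
Qed.

Lemma phi_cut i t l u w : in_box eps t [:: lift ord_max l] -> 0 < u -> 0 < w -> u + w <= eps ->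
  phi i (tset t (lift ord_max l) (u + w))
  = phi i (tset t (lift ord_max l) u) + phi i (tset t (lift ord_max l) w).
Proof.
move=> tb u0 w0 uw.
have inb z : 0 < z <= eps -> box (tset t (lift ord_max l) z).
  move=> zb k _; rewrite tnth_tset; case: eqVneq => // kl; apply: tb.
  by rewrite inE.
have bu : box (tset t (lift ord_max l) u) by apply: inb; lra.
have bw : box (tset t (lift ord_max l) w) by apply: inb; lra.
have buw : box (tset t (lift ord_max l) (u + w)) by apply: inb; lra.
have /andP[t0 _] : 0 < slast t <= eps by apply: tb; rewrite inE neq_lift.
have wM y : rectb (a0 + shift (swap_last i l) u)
    (shi i (a0 + shift (swap_last i l) u) (tset t (lift ord_max l) w)) y -> M y.
  rewrite shi_tset => /forallP h; apply: (base_in buw); apply/forallP => j; have := h j.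
  by rewrite [(a0 + _) _ _]mxE [shift _ _ _ _]mxE; case: eqP => _; lra.
rewrite [LHS]/phi srot_cut // ?ltW // clD.
- by rewrite (phi_base bw wM).
- by apply: inRec_srot (base_in bu) => //; apply: box_spos.
- by apply: inRec_srot wM => //; apply: box_spos.
Qed.

Lemma phi_additive i : box_multiadditive eps (phi i) [::].
Proof.
move=> t k u w tb /= /and3P[u0 w0 uw].
case: (unliftP ord_max k) tb => [l ->|->] tb; first exact: phi_cut.
(* Copying the entry [sprev] to the last place lets the varying entry sit at [sprev], where
   [phi_cut] applies, and return to the last place by [xswap]. *)
pose t' := tset t ord_max (tnth t (sprev n)).
have E z : tset t ord_max z = xswap (tset t' (sprev n) z).
  apply: eq_from_tnth => k'; rewrite tnth_xswap !tnth_tset !eqxx.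
  rewrite (eq_sym ord_max) sp_max; case: eqVneq => // _.
  by case: eqVneq => [->|].
have t'b : in_box eps t' [:: sprev n].
  move=> k'; rewrite inE tnth_tset => ks; case: eqVneq => [_|km]; apply: tb.
    by rewrite inE sp_max.
  by rewrite inE.
have inb z : 0 < z <= eps -> box (tset t' (sprev n) z).
  by move=> zb k' _; rewrite tnth_tset; case: eqVneq => // ks; apply: t'b; rewrite inE.
by rewrite !E !phi_xswap; [rewrite phi_cut ?opprD|apply: inb; lra..].
Qed.
End RotationClass.

(** * Kernel and image *)

Section Kernel.
Variables (R : realType) (n : nat) (M : set 'rV[R]_n.+1).
Hypothesis mM : multirect M.
Variables (V : zmodType) (tv : ftens R n.+2 -> V).
Hypotheses (tvD : forall s s', tv (s ++ s') = tv s + tv s')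
  (tvE : forall s s', tv s = tv s' <-> teq s s').
Variables (A : zmodType) (cl : ('rV[R]_n.+1 -> 'rV[R]_n.+1) -> A).
Hypotheses (clD : forall f g, inRec M f -> inRec M g -> cl (f \o g) = cl f + cl g)
  (cl0 : forall f, inRec M f -> (cl f = 0 <-> derived M f)).
Variables (a0 : 'rV[R]_n.+1) (eps : R).
Hypothesis eps_gt0 : 0 < eps.
Hypothesis a0M : forall y : 'rV[R]_n.+1,
  (forall j, a0 ord0 j <= y ord0 j < a0 ord0 j + eps *+ 6) -> M y.
Implicit Types (i j : 'I_n.+1) (x t : n.+2.-tuple R) (k : 'I_n.+2).

Lemma Tmap_id i : tv (Tmap M id i) = 0.
Proof.
have := Tmap_comp tvD tvE i (inRec_id mM) (inRec_id mM).
by move=> /(congr1 (fun v => v - tv (Tmap M id i))); rewrite addrK subrr.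
Qed.

Lemma Tmap_inv f f' i : inRec M f -> cancel f f' -> cancel f' f ->
  tv (Tmap M f' i) = - tv (Tmap M f i).
Proof.
move=> rf fK f'K; have rf' := inRec_cancel rf fK.
apply/eqP; rewrite -addr_eq0 -(Tmap_comp tvD tvE) // -(Tmap_id i).
by apply/eqP; congr (tv (Tmap M _ i)); apply/funext => y /=.
Qed.

Lemma tv2 (q : rat) x t : tv [:: (q, x); (- q, t)] = tv [:: (q, x)] - tv [:: (q, t)].
Proof.
rewrite -tv_scaleN // -tvD /= mulN1r; by [].
Qed.

Lemma Tmap_derived f i : derived M f -> tv (Tmap M f i) = 0.
Proof.
elim=> [|g g' h h' k rg rh gK g'K hK h'K dk IH]; first exact: Tmap_id.
have rg' := inRec_cancel rg gK; have rh' := inRec_cancel rh hK.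
have r1 := inRec_comp rg' rh'; have r2 := inRec_comp r1 rg; have r3 := inRec_comp r2 rh.
rewrite (Tmap_comp tvD tvE i (derived_inRec mM dk) r3) (Tmap_comp tvD tvE i r2 rh).
rewrite (Tmap_comp tvD tvE i r1 rg) (Tmap_comp tvD tvE i rg' rh') IH.
rewrite (Tmap_inv i rg gK g'K) (Tmap_inv i rh hK h'K) add0r.
by rewrite addrAC addrNK addNr.
Qed.

Lemma half_ratr (u : R) : ratr 2^-1 * u + ratr 2^-1 * u = u.
Proof. by rewrite -mulrDl -rmorphD /= (_ : 2^-1 + 2^-1 = 1 :> rat) ?rmorph1 ?mul1r. Qed.

Section Psi.
Variable F : 'I_n.+1 -> n.+2.-tuple R -> A.
Hypotheses (FD : forall i, multiadditive (F i))
  (FE : forall i x, in_box eps x [::] -> F i x = phi cl a0 i x).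

(* The halving makes up for the factor 2 in
   F (s (x) t) - F (t (x) s) = 2 F (s (x) t) for an antisymmetric F. *)
Definition Psi i x := F i (tset x ord_max (ratr 2^-1 * tnth x ord_max)).

Lemma Psi_multiadditive i : multiadditive (Psi i).
Proof.
move=> t k u w; rewrite /Psi !tnth_tset; case: (eqVneq ord_max k) => [<-|km].
  by rewrite !tset_tset mulrDr FD.
by rewrite !(tsetC _ _ _ (_ : k != ord_max)) ?FD // eq_sym.
Qed.

(** By antisymmetry the second term becomes F at x with the entry [sprev] halved. The factor one
    half may be moved to the last entry, and the two halves add up to F at x. *)
Lemma Psi_rotation i x : in_box eps x [::] ->
  tlift (Psi i) [:: (1, x); (-1, xswap x)] = phi cl a0 i x.
Proof.
move=> xb; rewrite /tlift !big_cons big_nil addr0 /= rmorph1 rmorphN rmorph1 mul1r tset_id.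
rewrite mulN1r (multiadditiveN (Psi_multiadditive i)) tset_id.
(* Antisymmetry is known for [phi], hence for F only on small shapes; halving an entry keeps the
   shape small. *)
have hb k : 0 < ratr 2^-1 * tnth x k <= eps.
  have /andP[h1 h2] := xb k isT; have := half_ratr (tnth x k).
  have : 0 < ratr 2^-1 * tnth x k by rewrite mulr_gt0 // ltr0q invr_gt0.
  lra.
have sb k : in_box eps (tset x k (ratr 2^-1 * tnth x k)) [::].
  by move=> k' _; rewrite tnth_tset; case: eqP => _; [apply: hb|apply: xb].
have -> : Psi i (xswap x) = - F i (tset x (sprev n) (ratr 2^-1 * tnth x (sprev n))).
  rewrite (FE i (sb _)) -(phi_xswap mM clD eps_gt0 a0M i (sb _)) -FE; last exact: box_xswap.
  rewrite /Psi xswap_tset tpermL tnth_xswap eqxx //.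
rewrite opprK /Psi (multiadditive_ratr (FD i) x (sprev n) ord_max) -FD half_ratr tset_id.
exact: FE.
Qed.

(** Both sides are additive under composition, so only generators have to be compared: swaps, where
    both vanish, and small rotations, where [Psi_rotation] applies. *)
Lemma cl_generated f : generated M eps f -> cl f = \sum_i tlift (Psi i) (Tmap M f i).
Proof.
have comp g h : inRec M g -> inRec M h ->
    cl g = \sum_i tlift (Psi i) (Tmap M g i) -> cl h = \sum_i tlift (Psi i) (Tmap M h i) ->
    cl (g \o h) = \sum_i tlift (Psi i) (Tmap M (g \o h) i).
  move=> rg rh gE hE; rewrite clD // gE hE -big_split; apply: eq_bigr => i _ /=.
  rewrite -tlift_cat; apply: tlift_teq; first exact: Psi_multiadditive.
  by apply/tvE; rewrite tvD Tmap_comp.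
have lift0 i s : tv s = 0 -> tlift (Psi i) s = 0.
  move=> s0; have -> : tlift (Psi i) s = tlift (Psi i) [::].
    by apply: tlift_teq; [exact: Psi_multiadditive|apply/tvE; rewrite tv_nil].
  exact: big_nil.
elim=> [|a b v h ab dj aM avM gh IH|i a b m h ab am aM le gh IH].
- rewrite (cl_id mM clD) big1 // => i _; apply: lift0; exact: Tmap_id.
- have rs := inRec_swap mM ab dj aM avM.
  apply: comp => //; first exact: generated_inRec gh.
  rewrite (proj2 (cl0 rs) (derived_swap mM ab dj aM avM)) big1 // => i _.
  by apply: lift0; apply: Tmap_swap.
- have [x [rE bE xP]] := rot_srot ab am.
  have xb : in_box eps x [::].
    by move=> k _; have [j hj] := xP k; have := le j; lra.
  have x0 := box_spos xb.
  have aM' y : rectb a (shi i a x) y -> M y by rewrite bE; apply: aM.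
  have rr := inRec_srot mM x0 aM'.
  rewrite rE; apply: comp => //; first exact: generated_inRec gh.
  rewrite (phi_base mM clD eps_gt0 a0M xb aM') -Psi_rotation //.
  rewrite (bigD1 i) //= big1 ?addr0.
    apply: tlift_teq; first exact: Psi_multiadditive.
    by apply/tvE; rewrite tv2 Tmap_srot // eqxx.
  by move=> j ji; apply: lift0; rewrite Tmap_srot // (negPf ji).
Qed.
End Psi.

Lemma Tmap_kernel f : inRec M f -> (forall i, tv (Tmap M f i) = 0) -> derived M f.
Proof.
move=> rf T0; apply/cl0 => //.
have /choice[F FP] : forall i, exists F, multiadditive F /\
    forall x, in_box eps x [::] -> F x = phi cl a0 i x.
  move=> i; have [F FD FE] := multiadditive_extension eps_gt0
    (phi_additive mM clD eps_gt0 a0M i).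
  by exists F.
have FD i := proj1 (FP i); have FE i := proj2 (FP i).
rewrite (cl_generated FD FE (inRec_generated mM eps_gt0 rf)) big1 // => i _.
have -> : tlift (Psi F i) (Tmap M f i) = tlift (Psi F i) [::].
  by apply: tlift_teq; [exact: Psi_multiadditive|apply/tvE; rewrite T0 tv_nil].
exact: big_nil.
Qed.
End Kernel.

(** * The image of T *)

Section Image.
Variables (R : realType) (n : nat) (M : set 'rV[R]_n.+1).
Hypothesis mM : multirect M.
Variables (V : zmodType) (tv : ftens R n.+2 -> V).
Hypotheses (tvD : forall s s', tv (s ++ s') = tv s + tv s')
  (tvE : forall s s', tv s = tv s' <-> teq s s').
Implicit Types (i j : 'I_n.+1) (x : n.+2.-tuple R).

Lemma xswap_rcons (t : n.-tuple R) p q :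
  xswap (rcons_tuple (rcons_tuple t p) q) = rcons_tuple (rcons_tuple t q) p.
Proof.
apply: eq_from_tnth => k; rewrite tnth_xswap !tnth_rcons_tuple.
rewrite /sprev liftK unlift_none !tnth_rcons_tuple unlift_none.
case: (unliftP ord_max k) => [l ->|->]; last by rewrite eqxx.
rewrite eq_sym (negPf (neq_lift _ _)) (inj_eq lift_inj) !tnth_rcons_tuple.
by case: unliftP => [l' ->|->]; rewrite ?eqxx // eq_sym (negPf (neq_lift _ _)).
Qed.

Definition wedge (p : rat * n.-tuple R * R * R) : ftens R n.+2 :=
  [:: (p.1.1.1, rcons_tuple (rcons_tuple p.1.1.2 p.1.2) p.2);
      (- p.1.1.1, rcons_tuple (rcons_tuple p.1.1.2 p.2) p.1.2)].

Lemma inWP w : inW w <-> exists l, tv w = tv (flatten [seq wedge p | p <- l]).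
Proof. by split=> -[l lP]; exists l; apply/tvE. Qed.

Lemma inW_Tmap f i : inRec M f -> inW (Tmap M f i).
Proof.
(* The size of the rotations is irrelevant to their invariant, so the bound 1 is as good as any
   other. *)
move=> /(inRec_generated mM (ltr01 : 0 < 1 :> R)) gf; apply/inWP.
elim: gf => [|a b v h ab dj aM avM gh [l IH]|i' a b m h ab am aM le gh [l IH]].
- by exists [::]; rewrite Tmap_id //= tv_nil.
- exists l; rewrite (Tmap_comp tvD tvE) ?Tmap_swap ?add0r //; first exact: inRec_swap.
  exact: generated_inRec gh.
have [x [rE bE xP]] := rot_srot ab am.
have x0 : spos x by move=> k; have [j /andP[]] := xP k.
have aM' y : rectb a (shi i' a x) y -> M y by rewrite bE; apply: aM.
have rr := inRec_srot mM x0 aM'.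
rewrite rE (Tmap_comp tvD tvE) //; last exact: generated_inRec gh.
rewrite Tmap_srot //; case: eqP => _; last by exists l; rewrite add0r.
have [t [p [q xE]]] := rcons2P x.
exists ((1, t, p, q) :: l).
rewrite -[RHS]/(tv (wedge (1, t, p, q) ++ flatten [seq wedge u | u <- l])) tvD -IH.
by congr (_ + _); rewrite /wedge /= -(tv2 tvD tvE) xE xswap_rcons.
Qed.

Variables (a0 : 'rV[R]_n.+1) (eps : R).
Hypothesis eps_gt0 : 0 < eps.
Hypothesis a0M : forall y : 'rV[R]_n.+1,
  (forall j, a0 ord0 j <= y ord0 j < a0 ord0 j + eps *+ 6) -> M y.

(** The vanishing of the other components lets each direction be realized separately and the
    resulting maps be composed in [Tmap_onto]. *)
Definition realized i (v : V) := exists2 f, inRec M f &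
  forall j, tv (Tmap M f j) = if j == i then v else 0.

Lemma realized0 i : realized i 0.
Proof. by exists id => [|j]; [exact: inRec_id|rewrite Tmap_id // if_same]. Qed.

Lemma realizedB i u v : realized i u -> realized i v -> realized i (u - v).
Proof.
move=> [f rf fE] [g rg gE]; have [g' [rg' gK g'K]] := inRec_inv rg.
exists (f \o g') => [|j]; first exact: inRec_comp.
rewrite (Tmap_comp tvD tvE) // (Tmap_inv mM tvD tvE j rg gK g'K) fE gE.
by case: ifP => //; rewrite subr0.
Qed.

(** For a small positive shape this is a rotation inside M; general x follow by multiadditivity, as
    the realized values form a subgroup. *)
Lemma realized_rotation i x : realized i (tv [:: (1, x)] - tv [:: (1, xswap x)]).
Proof.
apply: (multiadditive_span eps_gt0
  (F := fun x => tv [:: (1, x)] - tv [:: (1, xswap x)])).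
- move=> t k u w; rewrite !xswap_tset !(tv_multiadditive tvD tvE).
  by rewrite opprD addrACA.
- exact: realized0.
- exact: realizedB.
move=> t tb; have t0 := box_spos tb; have tM := base_in eps_gt0 a0M (i := i) tb.
exists (srot i a0 t) => [|j]; first exact: inRec_srot.
exact: Tmap_srot.
Qed.

Lemma realized_wedges i l : realized i (tv (flatten [seq wedge p | p <- l])).
Proof.
elim: l => [|[[[q t] p1] p2] l IH]; first by rewrite tv_nil //; exact: realized0.
rewrite -[flatten _]/(wedge (q, t, p1, p2) ++ flatten [seq wedge u | u <- l]) tvD.
rewrite -[tv (flatten _)]opprK; apply: realizedB; last first.
  by rewrite -sub0r; apply: realizedB => //; exact: realized0.
rewrite (tv2 tvD tvE) /=.
(* The coefficient q goes into entry [sprev] of the first tensor and into the last entry of the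
   second, so that [xswap] still exchanges the two tuples. *)
rewrite (tv_rat tvD tvE _ _ (sprev n)) (tv_rat tvD tvE _ q ord_max).
set x := rcons_tuple (rcons_tuple t p1) p2.
have -> : rcons_tuple (rcons_tuple t p2) p1 = xswap x by rewrite xswap_rcons.
have -> : tset (xswap x) ord_max (ratr q * tnth (xswap x) ord_max)
    = xswap (tset x (sprev n) (ratr q * tnth x (sprev n))).
  by rewrite xswap_tset tpermL tnth_xswap eqxx.
exact: realized_rotation.
Qed.

Lemma Tmap_onto (w : 'I_n.+1 -> ftens R n.+2) : (forall i, inW (w i)) ->
  exists2 f, inRec M f & forall i, tv (Tmap M f i) = tv (w i).
Proof.
move=> wW; have [f rf fE] : exists2 f, inRec M f &
    forall i, tv (Tmap M f i) = if i \in enum 'I_n.+1 then tv (w i) else 0.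
  elim: (enum _) (enum_uniq 'I_n.+1) => [_|i J IH /= /andP[iJ /IH[f rf fE]]].
    by exists id => [|j]; [exact: inRec_id|rewrite Tmap_id].
  have /inWP[l lE] := wW i; have [g rg gE] := realized_wedges i l.
  exists (g \o f) => [|j]; first exact: inRec_comp.
  rewrite (Tmap_comp tvD tvE) // fE gE inE; case: (eqVneq j i) => [->|_] /=.
    by rewrite (negPf iJ) addr0 lE.
  by rewrite add0r.
by exists f => // i; rewrite fE mem_enum.
Qed.
End Image.

Theorem mainTheorem6 (R : realType) (n : nat) (M : set 'rV[R]_n.+1) :
  multirect M -> (exists y, M y) ->
  [/\ (* T is a homomorphism (group law of Rec = composition) *)
      forall f g, inRec M f -> inRec M g ->
        forall i, teq (Tmap M (f \o g) i) (Tmap M f i ++ Tmap M g i),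
      (* T takes values in (R^{(x)(d-1)} (x) /\^2 R)^d *)
      forall f, inRec M f -> forall i, inW (Tmap M f i),
      (* T is onto (R^{(x)(d-1)} (x) /\^2 R)^d *)
      forall w : 'I_n.+1 -> ftens R n.+2, (forall i, inW (w i)) ->
        exists2 f, inRec M f & forall i, teq (Tmap M f i) (w i)
    & (* ker T = D(Rec_d(M)) *)
      forall f, inRec M f -> (derived M f <-> forall i, teq (Tmap M f i) [::])].
Proof.
move=> mM neM; have [V [tv [tvD tvE]]] := tensor_space R n.+1.
have [A [cl [clD cl0]]] := abelianization mM.
have [a0 [eps [eps_gt0 a0M]]] := multirect_box mM neM.
split=> [f g rf rg i|f rf i|w wW|f rf].
- by apply/tvE; rewrite tvD Tmap_comp.
- exact: (inW_Tmap mM tvD tvE).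
- have [f rf fE] := Tmap_onto mM tvD tvE eps_gt0 a0M wW.
  by exists f => // i; apply/tvE.
split=> [df i|T0]; first by apply/tvE; rewrite tv_nil // (Tmap_derived mM tvD tvE).
apply: (Tmap_kernel mM tvD tvE clD cl0 eps_gt0 a0M rf) => i.
by rewrite (proj2 (tvE _ _) (T0 i)) tv_nil.
Qed.
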